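(* Consider a sequence of parameter spaces $\mathcal{P}_n'(\theta,p,q,k,\beta;\delta,\alpha)$ with $\alpha\ge1$ a constant and $\beta=1$, such that as $n\to\infty$: $\delta=o(1)$, $1<p/q=O(1)$, $\|\theta\|_\infty=o(n/k)$, $k=O(1)$, $\min_i\theta_i=\Omega(1)$, $\delta=o\big(\frac{p-q}{p}\big)$, $\|\theta\|_\infty^2p\ge n^{-1}$, and $\frac{(1+\epsilon)\|\theta\|_\infty p^{3/2}}{\sqrt n(p-q)^2}=o(1)$. Let $\hat z$ be the output of Algorithm 3, in which Algorithm 1 is run with slack $\epsilon$ and $\tau=C_1(np\|\theta\|_\infty^2+1)$ for some sufficiently large constant $C_1>0$. Then there is a sequence $\eta=o(1)$ such that $$\lim_{n\to\infty}\inf_{\mathcal{P}_n'(\theta,p,q,k,\beta;\delta,\alpha)}\mathbb{P}\big\{\ell(\hat z,z)\le\exp(-(1-\eta)I)\big\}=1.$$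
   Context: Notation: $[k]=\{1,\dots,k\}$; $k\ge2$; $\|\theta\|_\infty=\max_i|\theta_i|$; $\|v\|_1=\sum_i|v_i|$; $\|\cdot\|_{\rm F}$ is the Frobenius norm; $a_n=\Omega(b_n)$ means $a_n\ge Cb_n$ for some absolute constant $C>0$. Asymptotics are as $n\to\infty$, and $\theta,p,q,k,\delta$ may depend on $n$. Parameter space. Given $\theta\in\mathbb{R}_+^n$, for $z\in[k]^n$ let $n_u=n_u(z)=|\{i\in[n]:z(i)=u\}|$. $\mathcal{P}_n(\theta,p,q,k,\beta;\delta)$ is the set of $P\in[0,1]^{n\times n}$ for which there exist $z\in[k]^n$ and $B=B^T\in\mathbb{R}^{k\times k}$ such that: $P_{ii}=0$, $P_{ij}=\theta_i\theta_jB_{z(i)z(j)}$ for $i\ne j$; $\frac1{n_u}\sum_{i:z(i)=u}\theta_i\in[1-\delta,1+\delta]$ for all $u$; $\max_{u\ne v}B_{uv}\le q<p\le\min_uB_{uu}$; $\frac n{\beta k}-1\le n_u\le\frac{\beta n}k+1$ for all $u$. $\mathcal{P}_n'(\theta,p,q,k,\beta;\delta,\alpha)$ is the subset where in addition $\max_{u}B_{uu}\le\alpha p$; $\alpha\ge1$ is a constant not depending on $n$. Model: for such $P$ with true label vector $z$, one observes symmetric $A\in\{0,1\}^{n\times n}$ with zero diagonal and independent $A_{ij}=A_{ji}\sim\mathrm{Bern}(P_{ij})$, $i<j$; $\mathbb{P}$ is the corresponding probability. Loss: $\ell(\hat z,z)=\frac1n\min_{\pi\in\Pi_k}\sum_i\mathbf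 1_{\{\hat z(i)\ne\pi(z(i))\}}$, $\Pi_k$ the permutations of $[k]$. $I$ is defined by $\exp(-I)=\frac1n\sum_{i=1}^n\exp(-\theta_i\frac n2(\sqrt p-\sqrt q)^2)$ if $k=2$, and $\exp(-I)=\frac1n\sum_{i=1}^n\exp(-\theta_i\frac n{\beta k}(\sqrt p-\sqrt q)^2)$ if $k\ge3$. Algorithm 1 (input: adjacency matrix $A\in\{0,1\}^{n\times n}$, $k$, $\tau$, slack $\epsilon$): (1) let $T_\tau(A)$ be obtained from $A$ by replacing by zeros the $i$th row and column for every $i$ whose row sum in $A$ is larger than $\tau$; (2) let $\hat P$ be a minimizer of $\|T_\tau(A)-P\|_{\rm F}^2$ over matrices $P$ with $\mathrm{rank}(P)\le k$; (3) let $\hat P_i$ be the $i$th row of $\hat P$, $S_0=\{i:\|\hat P_i\|_1=0\}$, set $\hat z^0(i)=0$ for $i\in S_0$ and $\tilde P_i=\hat P_i/\|\hat P_i\|_1$ for $i\notin S_0$; (4) find labels $\{\hat z^0(i)\}_{i\in S_0^c}$ in $[k]$ with $$\sum_{u=1}^k\min_{v_u\in\mathbb{R}^n}\sum_{i\in S_0^c:\hat z^0(i)=u}\|\hat P_i\|_1\|\tilde P_i-v_u\|_1\le(1+\epsilon)\min_{z\in[k]^n}\sum_{u=1}^k\min_{v_u\in\mathbb{R}^n}\sum_{i\in S_0^c:z(i)=u}\|\hat P_i\|_1\|\tilde P_i-v_u\|_1.$$ Output $\hat z^0$. Algorithm 3 (input $A$, $k$): (1) for each $i\in[n]$, apply Algorithm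 1 to $A_{-i}$, the submatrix of $A$ with $i$th row and column removed, giving labels $\hat z_{-i}^0(j)$, $j\ne i$; (2) for each $i$, set $\hat z_{-i}^0(i)=\mathop{\rm argmax}_{u\in[k]}\frac1{|\{j:\hat z_{-i}^0(j)=u\}|}\sum_{j:\hat z_{-i}^0(j)=u}A_{ij}$; (3) set $\hat z(1)=\hat z_{-1}^0(1)$ and, for $i=2,\dots,n$, $\hat z(i)=\mathop{\rm argmax}_{u\in[k]}|\{j:\hat z_{-1}^0(j)=u\}\cap\{j:\hat z_{-i}^0(j)=\hat z_{-i}^0(i)\}|$. Ties are broken arbitrarily. Output $\hat z\in[k]^n$. *)

(* Defs.v *)
From HB Require Import structures.
From mathcomp Require Import all_boot all_order all_algebra all_fingroup.
From mathcomp Require Import all_classical all_reals all_analysis.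

Set Implicit Arguments.
Unset Strict Implicit.
Unset Printing Implicit Defensive.

Import Order.TTheory GRing.Theory Num.Theory.
Import numFieldNormedType.Exports.

Local Open Scope classical_set_scope.
Local Open Scope ring_scope.

(* Indices [n] and labels [k] are 'I_n and 'I_k (shifted by one). *)

Definition supnorm (R : realType) (n : nat) (theta : 'I_n -> R) : R :=
  \big[Num.max/0]_(i < n) `|theta i|.

Definition l1norm (R : realType) (n : nat) (v : 'rV[R]_n) : R :=
  \sum_(j < n) `|v 0 j|.

Definition frob (R : realType) (m n : nat) (M : 'M[R]_(m, n)) : R :=
  Num.sqrt (\sum_(i < m) \sum_(j < n) M i j ^+ 2).

Definition csize (n k : nat) (z : 'I_n -> 'I_k) (u : 'I_k) : nat :=
  #|[set i | z i == u]%SET|.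

Definition dcbm_rep (R : realType) (n k : nat) (theta : 'I_n -> R)
    (p q beta delta : R) (P : 'M[R]_n) (z : 'I_n -> 'I_k) (B : 'M[R]_k) : Prop :=
  (forall i j, 0 <= P i j <= 1) /\
  B^T = B /\
  (forall i, P i i = 0) /\
  (forall i j, i != j -> P i j = theta i * theta j * B (z i) (z j)) /\
  (forall u, 1 - delta <= (\sum_(i | z i == u) theta i) / (csize z u)%:R
                       <= 1 + delta) /\
  (forall u v, u != v -> B u v <= q) /\
  q < p /\
  (forall u, p <= B u u) /\
  (forall u, n%:R / (beta * k%:R) - 1 <= (csize z u)%:R
                       <= beta * n%:R / k%:R + 1).

(* The members P of the parameter space, each paired with a true label vector
   z representing it. *)
Definition param_space (R : realType) (n : nat) (theta : 'I_n -> R) (p q : R)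
    (k : nat) (beta delta alpha : R) : set ('M[R]_n * ('I_n -> 'I_k)) :=
  [set Pz | exists B : 'M[R]_k,
     dcbm_rep theta p q beta delta Pz.1 Pz.2 B /\
     (forall u, B u u <= alpha * p)].
Arguments param_space {R n} theta p q k beta delta alpha.

Definition is_adjacency (n : nat) (A : 'M[bool]_n) : bool :=
  (A^T == A) && [forall i, ~~ A i i].

(* Law of the symmetric hollow matrix whose entries above the diagonal are
   independent, A i j being Bernoulli of parameter P i j. *)
Definition graph_prob (R : realType) (n : nat) (P : 'M[R]_n)
    (E : pred 'M[bool]_n) : R :=
  \sum_(A : 'M[bool]_n | is_adjacency A && E A)
    \prod_(i < n) \prod_(j < n | (i < j)%N) (if A i j then P i j else 1 - P i j).

(* Each count is at most n, so the default value n of the minimum is inert. *)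
Definition loss (R : realType) (n k : nat) (zhat z : 'I_n -> 'I_k) : R :=
  (\big[minn/n]_(s : 'S_k) #|[set i | zhat i != s (z i)]%SET|)%:R / n%:R.

Definition rateI (R : realType) (n : nat) (theta : 'I_n -> R) (p q : R)
    (k : nat) (beta : R) : R :=
  let scale := if k == 2%N then n%:R / 2 else n%:R / (beta * k%:R) in
  - ln (n%:R^-1 * \sum_(i < n)
          expR (- (theta i * scale * (Num.sqrt p - Num.sqrt q) ^+ 2))).

Definition trim (R : realType) (m : nat) (tau : R) (A : 'M[bool]_m) : 'M[R]_m :=
  let heavy i := tau < \sum_(j < m) (A i j)%:R in
  \matrix_(i, j) if heavy i || heavy j then 0 else (A i j)%:R.

Definition best_low_rank (R : realType) (m k : nat) (M Q : 'M[R]_m) : Prop :=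
  (\rank Q <= k)%N /\
  (forall Q' : 'M[R]_m, (\rank Q' <= k)%N ->
     frob (M - Q) ^+ 2 <= frob (M - Q') ^+ 2).

(* Weighted k-median objective over the rows outside S_0 (nonzero rows). *)
Definition kmedian_cost (R : realType) (m k : nat) (Q : 'M[R]_m)
    (z : 'I_m -> option 'I_k) : R :=
  \sum_(u < k) inf [set (\sum_(i < m | (l1norm (row i Q) != 0) && (z i == Some u))
      l1norm (row i Q) *
      l1norm ((l1norm (row i Q))^-1 *: row i Q - v)) | v in [set: 'rV[R]_m]].

(* z0 is a possible output of the initial spectral k-median clustering of A;
   None is the label 0 of the vertices in S_0. *)
Definition algorithm1_output (R : realType) (m k : nat) (tau eps : R)
    (A : 'M[bool]_m) (z0 : 'I_m -> option 'I_k) : Prop :=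
  exists Q : 'M[R]_m,
    best_low_rank k (trim tau A) Q /\
    (forall i, (z0 i == None) = (l1norm (row i Q) == 0)) /\
    (forall z : 'I_m -> 'I_k,
       kmedian_cost Q z0 <= (1 + eps) * kmedian_cost Q (fun i => Some (z i))).

Definition is_argmax (R : realType) (k : nat) (f : 'I_k -> R) (u : 'I_k) : Prop :=
  forall v, f v <= f u.

(* zhat is a possible output of the leave-one-out algorithm on A, where alg1 is
   the initial clustering procedure; alg1 being a function, the labels it
   produces after deletion of vertex i depend only on the remaining graph.
   loo i j is the label of vertex j in the run that deletes i, and self i is
   loo i i.  The average over an empty cluster is 0. *)
Definition algorithm3_output (R : realType) (n k : nat)
    (alg1 : 'M[bool]_n.-1 -> 'I_n.-1 -> option 'I_k)
    (A : 'M[bool]_n) (zhat : 'I_n -> 'I_k) : Prop :=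
  exists (loo : 'I_n -> 'I_n -> option 'I_k) (self : 'I_n -> 'I_k),
    (forall i (j : 'I_n.-1), loo i (lift i j) = alg1 (row' i (col' i A)) j) /\
    (forall i, loo i i = Some (self i)) /\
    (forall i, is_argmax (fun u : 'I_k =>
       (\sum_(j < n | (j != i) && (loo i j == Some u)) (A i j)%:R) /
       #|[set j | (j != i) && (loo i j == Some u)]%SET|%:R : R) (self i)) /\
    (forall i1 : 'I_n, i1 = 0%N :> nat ->
       zhat i1 = self i1 /\
       (forall i, i != i1 -> is_argmax (fun u : 'I_k =>
          #|([set j | loo i1 j == Some u]
             :&: [set j | loo i j == Some (self i)])%SET|%:R : R) (zhat i))).

(* Infimum of a set of probabilities, in the complete lattice [0, 1]: the
   element 1 only matters when S is empty, i.e. for an empty parameter space,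
   where inf would return the junk value 0. *)
Definition prob_inf (R : realType) (S : set R) : R := inf (1 |` S).

(* Main.v *)
(** Everything about the random graph is contained in one event of probability
    tending to one, which transfers to all vertex-deleted subgraphs at once.
    Following Feige and Ofek, with [d = n p |theta|^2]:
    - on a lattice net of the unit ball, the part of the bilinear form of
      [A - P] carried by the pairs with [|x_i y_j| <= sqrt d / n] is [O (sqrt d)];
    - the number of edges between any two vertex sets obeys a discrepancy bound,
      which controls the remaining pairs on vertices of degree [O (d)] and shows
      that at most [O (n / d)] vertices have larger degree.
    Hence the trimmed adjacency matrix of each vertex-deleted graph is within
    [O (sqrt d)] of its mean in operator norm, its best rank [k] approximation
    is within [O (sqrt (k d))] in Frobenius norm, and k-median clustering of the
    normalised rows mislabels vertices of total weight
    [O ((1 + eps) sqrt d / (p - q))], which is [o (n (p - q) / p)].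
    Given the deleted graph, the edges at vertex [i] are still independent, so
    Chernoff's bound with tilt [ln (sqrt p / sqrt q)] shows that [i] is attached to
    a wrong cluster with probability at most
    [k exp (- (1 - o(1)) theta_i (n / k) (sqrt p - sqrt q)^2)].  Since the
    consensus step reproduces these labels up to one permutation, Jensen's and
    Markov's inequalities conclude. *)

Require Import Defs.
From HB Require Import structures.
From mathcomp Require Import all_boot all_order all_algebra all_fingroup.
From mathcomp Require Import all_classical all_reals all_analysis.
From mathcomp Require Import ring lra zify.

Import Order.TTheory GRing.Theory Num.Theory.
Import numFieldNormedType.Exports.

Local Open Scope classical_set_scope.
Local Open Scope ring_scope.

Set Implicit Arguments.
Unset Strict Implicit.
Unset Printing Implicit Defensive.

(** * Expectations over the random graph *)

(** Deleting a vertex changes which vertices get trimmed, so a norm bound for one trimmed matrix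
    would not serve all [n] runs. The two events are therefore stated for [A] itself, without
    trimming, and the norm is bounded deterministically for the restriction of [A - P] to any vertex
    set [W] with internal degrees [O (d)]; the untrimmed vertices of each run form such a [W].
    Throughout, [w] is the square root of [d], and the lower bound on [|theta|^2 p] says that
    [1 <= w]. The second obstacle is dependence. A labelling may steer the tilt of row [i] only if
    it is a function of the graph without that row, and the same holds for the permutation aligning
    it with the truth; hence [loo_perm] and the cut-off [well_labelled]. Errors in edge mass are
    measured against [rho = x * ((p - q) / p)] with [x] constant, because an error that is merely
    small relative to [p] would swamp [p - q] when the two rates are close. The constants [x] and
    [kap] depend on the accuracy [e] but not on [n] or [P], and a diagonal choice of [e] produces
    [eta]. *)

Definition gweight (R : realType) (n : nat) (P : 'M[R]_n) (A : 'M[bool]_n) : R :=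
  \prod_(i < n) \prod_(j < n | (i < j)%N) (if A i j then P i j else 1 - P i j).

Definition expect (R : realType) (n : nat) (P : 'M[R]_n) (f : 'M[bool]_n -> R) : R :=
  \sum_(A : 'M[bool]_n | is_adjacency A) f A * gweight P A.

Lemma adjacency_sym (n : nat) (A : 'M[bool]_n) i j :
  is_adjacency A -> A i j = A j i.
Proof. by case/andP => /eqP eA _; rewrite -[in LHS]eA mxE. Qed.

Lemma adjacency_diag (n : nat) (A : 'M[bool]_n) i : is_adjacency A -> A i i = false.
Proof. by case/andP => _ /forallP /(_ i) /negbTE. Qed.

Lemma graph_probE (R : realType) (n : nat) (P : 'M[R]_n) (E : pred 'M[bool]_n) :
  graph_prob P E = expect P (fun A => (E A)%:R).
Proof.
rewrite /graph_prob /expect big_mkcondr /=.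
by apply: eq_bigr => A _; case: (E A); rewrite ?mul1r ?mul0r.
Qed.

Section Expectation.
Variables (R : realType) (n : nat) (P : 'M[R]_n).

Lemma expectD f g : expect P (fun A => f A + g A) = expect P f + expect P g.
Proof. by rewrite /expect -big_split /=; apply: eq_bigr => A _; rewrite mulrDl. Qed.

Lemma expectZ c f : expect P (fun A => c * f A) = c * expect P f.
Proof. by rewrite /expect mulr_sumr; apply: eq_bigr => A _; rewrite mulrA. Qed.

Lemma expect_sum (I : finType) (Q : pred I) (f : I -> 'M[bool]_n -> R) :
  expect P (fun A => \sum_(i | Q i) f i A) = \sum_(i | Q i) expect P (f i).
Proof.
rewrite /expect exchange_big /=; apply: eq_bigr => A _.
by rewrite mulr_suml.
Qed.

Lemma expect_eq f g : (forall A, is_adjacency A -> f A = g A) ->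
  expect P f = expect P g.
Proof. by move=> fg; apply: eq_bigr => A /fg ->. Qed.

Hypothesis P01 : forall i j, 0 <= P i j <= 1.

Lemma gweight_ge0 A : 0 <= gweight P A.
Proof.
apply: prodr_ge0 => i _; apply: prodr_ge0 => j _.
by have /andP[p0 p1] := P01 i j; case: ifP => _; rewrite ?subr_ge0.
Qed.

Lemma expect_le f g : (forall A, is_adjacency A -> f A <= g A) ->
  expect P f <= expect P g.
Proof.
by move=> fg; apply: ler_sum => A /fg h; rewrite ler_wpM2r // gweight_ge0.
Qed.

Lemma expect_ge0 f : (forall A, is_adjacency A -> 0 <= f A) -> 0 <= expect P f.
Proof. by move=> f0; apply: sumr_ge0 => A /f0 h; rewrite mulr_ge0 // gweight_ge0. Qed.

End Expectation.

(** Independence of the edges. An adjacency matrix is determined by its entries above the diagonal,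
    so these matrices correspond to the functions on pairs that are [false] unless [i < j], and a
    product of two-term sums expands over such functions. *)
Lemma expect_prod (R : realType) (n : nat) (P : 'M[R]_n)
    (g : 'I_n -> 'I_n -> bool -> R) :
  expect P (fun A => \prod_(i < n) \prod_(j < n | (i < j)%N) g i j (A i j)) =
  \prod_(i < n) \prod_(j < n | (i < j)%N)
     (P i j * g i j true + (1 - P i j) * g i j false).
Proof.
pose F (u : 'I_n * 'I_n) (b : bool) : R :=
  g u.1 u.2 b * (if b then P u.1 u.2 else 1 - P u.1 u.2).
pose Q := [pred u : 'I_n * 'I_n | (u.1 < u.2)%N].
transitivity (\prod_(u | Q u) \sum_(b : bool) F u b); last first.
  rewrite pair_big_dep /=; apply: eq_bigr => -[i j] _.
  rewrite (bigD1 true) //= (bigD1 false) //= big1 ?addr0; last by case.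
  by rewrite /F /= ![_ * g _ _ _]mulrC.
rewrite (big_distr_big false) /expect.
pose h (f : {ffun 'I_n * 'I_n -> bool}) : 'M[bool]_n :=
  \matrix_(i, j) (if (i < j)%N then f (i, j) else if (j < i)%N then f (j, i) else false).
pose h' (A : 'M[bool]_n) : {ffun 'I_n * 'I_n -> bool} :=
  [ffun u : 'I_n * 'I_n => if (u.1 < u.2)%N then A u.1 u.2 else false].
rewrite (reindex_onto h h') => [|A adjA]; last first.
  apply/matrixP => i j; rewrite mxE !ffunE /=.
  case: ltngtP => // [ji|/val_inj ->]; first by rewrite (adjacency_sym _ _ adjA).
  by rewrite adjacency_diag.
apply: eq_big => [f|f _].
- apply/andP/pffun_onP => [[_ /eqP hf]|[sf _]].
    split=> //; apply/fintype.subsetP => -[i j]; rewrite !inE -{1}hf ffunE /=.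
    by case: ifP.
  split.
    apply/andP; split.
      by apply/eqP/matrixP => i j; rewrite !mxE; case: ltngtP.
    by apply/forallP => i; rewrite mxE ltnn.
  apply/eqP/ffunP => -[i j]; rewrite !ffunE !mxE /=.
  case: ifP => nij; first by rewrite nij.
  apply/esym/negbTE/negP => fij.
  by have := fintype.subsetP sf (i, j); rewrite !inE /= nij fij => /(_ isT).
- rewrite /gweight -big_split /=.
  under eq_bigr => i _ do rewrite -big_split /=.
  rewrite pair_big_dep /=.
  by apply: eq_bigr => -[i j] /= ij; rewrite /F /= mxE ij.
Qed.

Section Mgf.
Variables (R : realType) (n : nat) (P : 'M[R]_n).
Hypothesis P01 : forall i j, 0 <= P i j <= 1.

Lemma expect1 : expect P (fun=> 1) = 1.
Proof.
transitivity (expect P (fun A => \prod_(i < n) \prod_(j < n | (i < j)%N) (1 : R))).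
  by apply: expect_eq => A _; rewrite big1 // => i _; rewrite big1.
rewrite (expect_prod P (fun _ _ _ => 1)) big1 // => i _; rewrite big1 // => j _.
by rewrite !mulr1 subrKC.
Qed.

(** Union and Markov bounds in one: failure events are later dominated by nonnegative functions, and
    these simply add up. *)
Lemma graph_prob_ge (E : pred 'M[bool]_n) (f : 'M[bool]_n -> R) :
  (forall A, is_adjacency A -> 0 <= f A) ->
  (forall A, is_adjacency A -> ~~ E A -> 1 <= f A) ->
  1 - expect P f <= graph_prob P E.
Proof.
move=> f0 f1; rewrite graph_probE lerBlDr -[leLHS]expect1 -expectD.
apply: expect_le => // A adjA; case: (boolP (E A)) => [_|nE].
  by rewrite lerDl f0.
by rewrite add0r f1.
Qed.

Lemma bernoulli_tilt_le (p c : R) : 0 <= p ->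
  p * expR c + (1 - p) <= expR (p * (expR c - 1)).
Proof.
move=> p0; apply: le_trans (expR_ge1Dx _).
by rewrite mulrBr mulr1; lra.
Qed.

(** The bound [1 + x <= expR x] replaces each Bernoulli factor by the Poisson one of the same mean,
    which makes the exponent additive over the edges. *)
Lemma mgf_le (c : 'I_n -> 'I_n -> R) :
  expect P (fun A => expR (\sum_(i < n) \sum_(j < n | (i < j)%N) c i j * (A i j)%:R))
  <= expR (\sum_(i < n) \sum_(j < n | (i < j)%N) P i j * (expR (c i j) - 1)).
Proof.
have := expect_prod P (fun i j (b : bool) => expR (c i j * b%:R)).
under expect_eq => A _.
  under eq_bigr => i _ do rewrite -expR_sum.
  rewrite -expR_sum; over.
move=> ->; rewrite expR_sum; apply: ler_prod => i _.
rewrite expR_sum; apply/andP; split.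
  apply: prodr_ge0 => j _; have /andP[p0 p1] := P01 i j.
  by rewrite addr_ge0 // mulr_ge0 ?expR_ge0 // subr_ge0.
apply: ler_prod => j _; have /andP[p0 p1] := P01 i j.
rewrite mulr1 mulr0 expR0 mulr1 bernoulli_tilt_le // andbT.
by rewrite addr_ge0 ?subr_ge0 // mulr_ge0 ?expR_ge0.
Qed.

End Mgf.

(** Deletion is encoded by erasing row and column [i] rather than by a minor, so that the deleted
    graph and [A] live in the same type. *)
Definition offrow (n : nat) (i : 'I_n) (A : 'M[bool]_n) : 'M[bool]_n :=
  \matrix_(a, b) [&& a != i, b != i & A a b].

Lemma sum_pairs_at (R : realType) (n : nat) (i : 'I_n) (f : 'I_n -> R) :
  \sum_(a < n) \sum_(b < n | (a < b)%N)
     (if a == i then f b else if b == i then f a else 0) = \sum_(j < n | j != i) f j.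
Proof.
rewrite (bigD1 i) //= eqxx [RHS](bigID (fun j : 'I_n => (i < j)%N)) /=; congr (_ + _).
  by apply: eq_bigl => j; rewrite -val_eqE /=; case: ltngtP.
rewrite [RHS]big_mkcond [LHS]big_mkcond /=; apply: eq_bigr => a _.
case: (eqVneq a i) => //= ai; rewrite -leqNgt leq_eqVlt val_eqE (negbTE ai) /=.
rewrite big_mkcond (bigD1 i) //= eqxx big1 ?addr0 // => b /negbTE ->.
by case: ifP.
Qed.

(** Conditioning on the deleted graph [M]: the tilt [c M] is then constant, and row [i] is
    independent of [M]. Conditional expectation is replaced by a finite sum over the values of
    [M]. *)
Lemma row_tilt_le (R : realType) (n : nat) (P : 'M[R]_n) (i : 'I_n)
    (G : pred 'M[bool]_n) (c : 'M[bool]_n -> 'I_n -> R) (r : R) :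
  (forall a b, 0 <= P a b <= 1) -> (forall a b, P a b = P b a) ->
  (forall M, is_adjacency M -> G M ->
     \sum_(j < n | j != i) P i j * (expR (c M j) - 1) <= r) ->
  expect P (fun A => (G (offrow i A))%:R *
     expR (\sum_(j < n | j != i) c (offrow i A) j * (A i j)%:R)) <= expR r.
Proof.
move=> P01 Psym hr.
have adj_off A : is_adjacency A -> is_adjacency (offrow i A).
  move=> adjA; apply/andP; split.
    apply/eqP/matrixP => a b; rewrite !mxE andbCA.
    by rewrite (adjacency_sym b a adjA).
  by apply/forallP => a; rewrite !mxE adjacency_diag // !andbF.
have offK A : offrow i (offrow i A) = offrow i A.
  by apply/matrixP => a b; rewrite !mxE; case: (a != i) (b != i) => [] [].
(* Pairs at [i] carry the tilt, all other pairs the indicator that [A] agrees with [M] there. The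
   product over pairs is thus the indicator of [offrow i A == M] times the tilted row, in the form
   required by [expect_prod]. *)
pose g (c' : 'I_n -> R) (M : 'M[bool]_n) (a b : 'I_n) (x : bool) : R :=
  if a == i then expR (c' b * x%:R) else if b == i then expR (c' a * x%:R)
  else (x == M a b)%:R.
have gE c' M A : is_adjacency A -> is_adjacency M -> offrow i M = M ->
    \prod_(a < n) \prod_(b < n | (a < b)%N) g c' M a b (A a b) =
    (offrow i A == M)%:R * expR (\sum_(j < n | j != i) c' j * (A i j)%:R).
  move=> adjA adjM offM.
  rewrite -sum_pairs_at expR_sum.
  have -> : (offrow i A == M)%:R = \prod_(a < n) \prod_(b < n | (a < b)%N)
     (if a == i then 1 else if b == i then 1 else (A a b == M a b)%:R) :> R.
    case: eqP => [AM|nAM].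
      rewrite big1 // => a _; rewrite big1 // => b _.
      case: eqP => // /eqP ai; case: eqP => // /eqP bi.
      by rewrite -AM mxE ai bi eqxx.
    have [a [b [ab abM]]] : exists a b : 'I_n, (a < b)%N /\ offrow i A a b != M a b.
      apply: contrapT => nex; apply: nAM; apply/matrixP => a b.
      case: (ltngtP a b) => [ab|ba|/val_inj ->].
      - by apply/eqP; apply: contrapT => /negP h; apply: nex; exists a, b.
      - rewrite (adjacency_sym a b (adj_off _ adjA)) (adjacency_sym a b adjM).
        by apply/eqP; apply: contrapT => /negP h; apply: nex; exists b, a.
      - by rewrite !adjacency_diag // adj_off.
    apply/esym; rewrite (bigD1 a) //= (bigD1 b) //=.
    have Mab : M a b = [&& a != i, b != i & M a b] by rewrite -{1}offM mxE.
    move: abM; rewrite Mab mxE.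
    case: (eqVneq a i) => //= _; case: (eqVneq b i) => //= _ /negbTE ->.
    by rewrite !mul0r.
  rewrite -big_split /=; apply: eq_bigr => a _.
  rewrite expR_sum -big_split /=; apply: eq_bigr => b _; rewrite /g.
  case: eqP => [->|_]; first by rewrite mul1r.
  case: eqP => [->|_]; first by rewrite mul1r (adjacency_sym a i adjA).
  by rewrite expR0 mulr1.
pose S := [pred M : 'M[bool]_n | is_adjacency M && (offrow i M == M)].
have splitE c' : expect P (fun A => (G (offrow i A))%:R *
     expR (\sum_(j < n | j != i) c' (offrow i A) j * (A i j)%:R)) =
   \sum_(M | S M) (G M)%:R * expect P (fun A =>
     (offrow i A == M)%:R * expR (\sum_(j < n | j != i) c' M j * (A i j)%:R)).
  under [RHS]eq_bigr => M _ do rewrite -expectZ.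
  rewrite -expect_sum; apply: expect_eq => A adjA.
  rewrite (bigD1 (offrow i A)) /= ?adj_off ?offK ?eqxx //= mul1r [X in _ + X]big1 ?addr0 //.
  by move=> M /andP[_]; rewrite eq_sym => /negbTE ->; rewrite mul0r mulr0.
rewrite splitE.
have tot : \sum_(M | S M) expect P (fun A => (offrow i A == M)%:R) <= 1.
  rewrite -expect_sum -[leRHS](expect1 P); apply: expect_le => // A adjA.
  rewrite (bigD1 (offrow i A)) /= ?adj_off ?offK ?eqxx //= big1 ?addr0 //.
  by move=> M /andP[_]; rewrite eq_sym => /negbTE ->.
apply: (@le_trans _ _ (\sum_(M | S M) expR r * expect P (fun A => (offrow i A == M)%:R))).
  2: by rewrite -mulr_sumr ler_piMr ?expR_ge0.
apply: ler_sum => M /andP[adjM /eqP offM].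
case: (boolP (G M)) => GM; last first.
  by rewrite mul0r mulr_ge0 ?expR_ge0 // expect_ge0 // => A _; rewrite ler0n.
rewrite mul1r.
under expect_eq => A adjA do rewrite -gE //.
rewrite expect_prod.
(* The same product with zero tilt is the mass of [M], so the two sides can be compared pair by
   pair. *)
have -> : expect P (fun A => (offrow i A == M)%:R) =
    \prod_(a < n) \prod_(b < n | (a < b)%N)
       (P a b * g (fun=> 0) M a b true + (1 - P a b) * g (fun=> 0) M a b false).
  rewrite -expect_prod; apply: expect_eq => A adjA; rewrite gE //.
  by rewrite big1 ?expR0 ?mulr1 // => j _; rewrite mul0r.
apply: (@le_trans _ _ (expR (\sum_(j < n | j != i) P i j * (expR (c M j) - 1)) *
   \prod_(a < n) \prod_(b < n | (a < b)%N)
       (P a b * g (fun=> 0) M a b true + (1 - P a b) * g (fun=> 0) M a b false))).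
  2: apply: ler_wpM2r; last by rewrite ler_expR hr.
  2: { apply: prodr_ge0 => a _; apply: prodr_ge0 => b _.
       have /andP[p0 p1] := P01 a b.
       apply: addr_ge0; apply: mulr_ge0; rewrite ?subr_ge0 // /g;
       by case: ifP => _; rewrite ?expR_ge0 //; case: ifP => _; rewrite ?expR_ge0. }
rewrite -sum_pairs_at expR_sum -big_split /=; apply: ler_prod => a _.
apply/andP; split.
  apply: prodr_ge0 => b _; have /andP[p0 p1] := P01 a b.
  apply: addr_ge0; apply: mulr_ge0; rewrite ?subr_ge0 // /g;
  by case: ifP => _; rewrite ?expR_ge0 //; case: ifP => _; rewrite ?expR_ge0.
rewrite expR_sum -big_split /=; apply: ler_prod => b _.
have /andP[p0 p1] := P01 a b; apply/andP; split.
  apply: addr_ge0; apply: mulr_ge0; rewrite ?subr_ge0 // /g;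
  by case: ifP => _; rewrite ?expR_ge0 //; case: ifP => _; rewrite ?expR_ge0.
rewrite /g; case: eqP => [<-|_].
  rewrite !mul0r !mulr0 !mulr1 expR0 !mulr1 subrKC mulr1.
  by rewrite bernoulli_tilt_le.
case: eqP => [<-|_]; last by rewrite expR0 mul1r.
rewrite !mul0r !mulr0 !mulr1 expR0 !mulr1 subrKC mulr1 (Psym b a).
by rewrite bernoulli_tilt_le.
Qed.

(** * Light pairs *)

(** Squaring [1 - x / 2 <= expR (- (x / 2))] bounds [expR (- x)] from below; the rest is the
    identity [(1 - x/2)^2 (1 + x + 2 x^2) - 1 = x^2 (1 - x) (5/2 - x) / 2], nonnegative for
    [x <= 1]. *)
Lemma expR_le_quad (R : realType) (x : R) : x <= 1 -> expR x <= 1 + x + 2 * x ^+ 2.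
Proof.
move=> x1; have h : 1 - x / 2 <= expR (- (x / 2)) by apply: expR_ge1Dx.
have h2 : (1 - x / 2) ^+ 2 <= expR (- x).
  have -> : expR (- x) = expR (- (x / 2)) ^+ 2.
    by rewrite expr2 -expRD; congr expR; lra.
  by rewrite lerXn2r // nnegrE ?expR_ge0 //; lra.
have e0 := expR_gt0 (- x).
rewrite -[leLHS]invrK -expRN -[leRHS](mulKf (lt0r_neq0 e0)) ler_pMr ?invr_gt0 //.
apply: (@le_trans _ _ ((1 - x / 2) ^+ 2 * (1 + x + 2 * x ^+ 2))).
  have : 0 <= x ^+ 2 * ((1 - x) * (5 / 2 - x)).
    apply: mulr_ge0; first exact: sqr_ge0.
    by apply: mulr_ge0; lra.
  rewrite -subr_ge0 => h3; rewrite -subr_ge0.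
  by rewrite (_ : _ - 1 = (x ^+ 2 * ((1 - x) * (5 / 2 - x)) - 0) / 2) ?divr_ge0 //; field.
by apply: ler_wpM2r => //; nra.
Qed.

Lemma expR1_ge2 (R : realType) : 2 <= expR (1 : R).
Proof. by apply: le_trans (expR_ge1Dx _); lra. Qed.

Lemma sum_half_le2 (R : realType) (N : nat) : \sum_(m < N) (2^-1 : R) ^+ m <= 2.
Proof.
suff -> : \sum_(m < N) (2^-1 : R) ^+ m = 2 - 2 * 2^-1 ^+ N.
  by rewrite lerBlDr lerDl mulr_ge0 // exprn_ge0 // invr_ge0.
elim: N => [|N IH]; first by rewrite big_ord0; lra.
by rewrite big_ord_recr /= IH exprS; lra.
Qed.

Lemma sum_sym_pairs (R : realType) (n : nat) (h : 'I_n -> 'I_n -> R) :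
  (forall i, h i i = 0) ->
  \sum_i \sum_j h i j = \sum_(i < n) \sum_(j < n | (i < j)%N) (h i j + h j i).
Proof.
move=> h0.
have -> : \sum_i \sum_j h i j =
   \sum_(i < n) \sum_(j < n | (i < j)%N) h i j +
   \sum_(i < n) \sum_(j < n | (j < i)%N) h i j.
  rewrite -big_split /=; apply: eq_bigr => i _.
  rewrite (bigID (fun j : 'I_n => (i < j)%N)) /=; congr (_ + _).
  rewrite (bigID (fun j : 'I_n => (j < i)%N)) /= [X in _ + X]big1 ?addr0.
    by apply: eq_bigl => j; case: ltngtP.
  move=> j /andP[]; rewrite -!leqNgt => ji ij.
  by have -> : j = i by apply/val_inj/eqP; rewrite eqn_leq ji ij.
under [RHS]eq_bigr do rewrite big_split /=.
rewrite big_split /=; congr (_ + _).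
by rewrite (exchange_big_dep predT).
Qed.

Section Light.
Variables (R : realType) (n : nat) (P : 'M[R]_n) (alpha w : R).
Hypothesis P01 : forall i j, 0 <= P i j <= 1.
Hypothesis Psym : forall i j, P i j = P j i.
Hypothesis Pdiag : forall i, P i i = 0.
Hypothesis w_gt0 : 0 < w.
Hypothesis n_gt0 : (0 < n)%N.
Hypothesis Pbd : forall i j, P i j <= alpha * w ^+ 2 / n%:R.

Definition light (x y : 'I_n -> R) i j := `|x i * y j| <= w / n%:R.

Definition light_form (x y : 'I_n -> R) (A : 'M[bool]_n) : R :=
  \sum_i \sum_(j | light x y i j) x i * y j * ((A i j)%:R - P i j).

(** The tilt [l = n / (2 w)] is chosen so that an edge, which enters through both [(i, j)] and
    [(j, i)], gets a coefficient of modulus at most 1. Centring cancels the linear term of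
    [expR_le_quad], and the quadratic terms add up to at most [4 l^2 alpha w^2 / n = alpha n]. *)
Lemma light_mgf (x y : 'I_n -> R) :
  \sum_i x i ^+ 2 <= 1 -> \sum_i y i ^+ 2 <= 1 ->
  expect P (fun A => expR (n%:R / (2 * w) * light_form x y A)) <= expR (alpha * n%:R).
Proof.
move=> hx hy; set l := n%:R / (2 * w).
have n0 : (0 : R) < n%:R by rewrite ltr0n.
have [wn0 nn0] := (lt0r_neq0 w_gt0, lt0r_neq0 n0).
have l0 : 0 <= l by rewrite divr_ge0 // ?mulr_ge0 // ltW.
pose t i j : R := if light x y i j then x i * y j else 0.
pose c i j := l * (t i j + t j i).
have c1 i j : `|c i j| <= 1.
  have ht a b : `|t a b| <= w / n%:R.
    by rewrite /t; case: ifP => // _; rewrite normr0 divr_ge0 // ltW.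
  rewrite /c normrM (ger0_norm l0).
  apply: (@le_trans _ _ (l * (w / n%:R + w / n%:R))).
    by apply: ler_wpM2l => //; apply: le_trans (ler_normD _ _) _; apply: lerD.
  have -> : l * (w / n%:R + w / n%:R) = 1 by rewrite /l; field; rewrite ?wn0 ?nn0 //.
  by [].
have formE A : is_adjacency A -> l * light_form x y A =
    \sum_(i < n) \sum_(j < n | (i < j)%N) c i j * (A i j)%:R
    - \sum_(i < n) \sum_(j < n | (i < j)%N) c i j * P i j.
  move=> adjA; rewrite /light_form.
  under eq_bigr => i _.
    rewrite big_mkcond /=.
    under eq_bigr => j _.
      rewrite (_ : (if _ then _ else _) = t i j * ((A i j)%:R - P i j)); last first.
        by rewrite /t; case: ifP => // _; rewrite mul0r.
      over.
    over.
  rewrite sum_sym_pairs /= => [|i]; last by rewrite adjacency_diag // Pdiag subr0 mulr0.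
  rewrite -sumrB mulr_sumr; apply: eq_bigr => i _.
  rewrite -sumrB mulr_sumr; apply: eq_bigr => j _.
  by rewrite (adjacency_sym j i adjA) (Psym j i) /c; ring.
under expect_eq => A adjA do rewrite formE // expRD mulrC.
rewrite expectZ; apply: le_trans (ler_wpM2l (expR_ge0 _) (mgf_le P01 _)) _.
rewrite -expRD ler_expR -sumrN -big_split /=.
apply: (@le_trans _ _ (\sum_(i < n) \sum_(j < n | (i < j)%N)
   (alpha * w ^+ 2 / n%:R) * (4 * l ^+ 2 * (t i j ^+ 2 + t j i ^+ 2)))).
  apply: ler_sum => i _; rewrite -sumrN -big_split /=; apply: ler_sum => j _.
  have q := @expR_le_quad _ (c i j) (le_trans (ler_norm _) (c1 i j)).
  have /andP[p0 _] := P01 i j.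
  apply: (@le_trans _ _ (P i j * (2 * c i j ^+ 2))).
    rewrite -subr_ge0 (_ : _ - _ = P i j * (1 + c i j + 2 * c i j ^+ 2 - expR (c i j))).
      by rewrite mulr_ge0 // subr_ge0.
    by ring.
  apply: ler_pM => //; first by rewrite mulr_ge0 // sqr_ge0.
  rewrite /c exprMn.
  have := sqr_ge0 (t i j - t j i); have := sqr_ge0 l; nra.
have al0 : 0 <= alpha * w ^+ 2 / n%:R.
  by have i0 : 'I_n := Ordinal n_gt0; apply: le_trans (Pbd i0 i0); case/andP: (P01 i0 i0).
under eq_bigr do rewrite -!mulr_sumr.
rewrite -!mulr_sumr.
apply: (@le_trans _ _ ((alpha * w ^+ 2 / n%:R) * (4 * l ^+ 2 * 1))).
  2: by rewrite /l le_eqVlt; apply/orP; left; apply/eqP; field; rewrite ?wn0 ?nn0 //.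
apply: ler_wpM2l => //; apply: ler_wpM2l; first by rewrite mulr_ge0 // sqr_ge0.
apply: (@le_trans _ _ (\sum_i \sum_j (if i == j then 0 else (x i * y j) ^+ 2))).
  rewrite [leRHS]sum_sym_pairs => [|i]; last by rewrite eqxx.
  apply: ler_sum => i _; apply: ler_sum => j ij.
  have ne : (i == j) = false by apply/negbTE/negP => /eqP e; rewrite e ltnn in ij.
  rewrite [j == i]eq_sym ne /t.
  by apply: lerD; case: ifP => // _; rewrite expr0n /= sqr_ge0.
apply: (@le_trans _ _ (\sum_i \sum_j (x i ^+ 2 * y j ^+ 2))).
  apply: ler_sum => i _; apply: ler_sum => j _; rewrite exprMn.
  by case: ifP => // _; rewrite mulr_ge0 ?sqr_ge0.
under eq_bigr do rewrite -mulr_sumr.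
rewrite -mulr_suml -[leRHS]mulr1; apply: ler_pM => //; apply: sumr_ge0 => i _; exact: sqr_ge0.
Qed.

End Light.

(** * A lattice net of the unit ball *)

Notation lattice n := {ffun 'I_n -> bool * 'I_(4 * n).+1}.

Definition lat_ball (n : nat) (f : lattice n) : bool :=
  (\sum_i (f i).2 ^ 2 <= 16 * n)%N.

(** The mesh [1 / (4 sqrt n)] makes the rounding error at most 1/4 in Euclidean norm. Sign and
    modulus are kept apart because heavy pairs are later sorted by the integer modulus, which never
    exceeds [4 sqrt n <= 4 n] in the ball. *)
Definition lat_vec (R : realType) (n : nat) (f : lattice n) (i : 'I_n) : R :=
  (-1) ^+ (f i).1 * (f i).2%:R / (4 * Num.sqrt n%:R).

(** Exponential weights count the points: each point of the ball contributes at least 1 to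
    [expR (16 n)] times the product of the weights [expR (- m^2)]. The total factorises over
    coordinates, and each coordinate sum is at most [4 <= expR 2]. *)
Lemma lat_ball_card (R : realType) (n : nat) :
  (#|[pred f : lattice n | lat_ball f]|)%:R <= expR (18 * n%:R) :> R.
Proof.
pose F (u : bool * 'I_(4 * n).+1) : R := expR (- (u.2 ^ 2)%:R).
apply: (@le_trans _ _ (\sum_(f : lattice n) expR (16 * n%:R) * \prod_i F (f i))).
  rewrite -sum1_card natr_sum big_mkcond /=; apply: ler_sum => f _.
  case: ifP => [bf|_]; last first.
    by rewrite mulr_ge0 ?expR_ge0 // prodr_ge0 // => i _; exact: expR_ge0.
  rewrite -expR_sum -expRD -[leLHS]expR0 ler_expR sumrN subr_ge0.
  by rewrite -natr_sum -natrM ler_nat.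
rewrite -mulr_sumr -(bigA_distr_bigA (fun _ : 'I_n => F)) /=.
have -> : 18 * n%:R = 16 * n%:R + 2 * n%:R :> R by ring.
rewrite expRD; apply: ler_wpM2l; first exact: expR_ge0.
rewrite prodr_const card_ord mulrC expRM_natl; apply: lerXn2r; rewrite ?nnegrE ?expR_ge0 //.
  by apply: sumr_ge0 => u _; exact: expR_ge0.
apply: (@le_trans _ _ (\sum_(b : bool) \sum_(m < (4 * n).+1) (2^-1 : R) ^+ m)).
  rewrite pair_big /=; apply: ler_sum => -[b m] _; rewrite /F /=.
  apply: (@le_trans _ _ (expR (- m%:R))).
    by rewrite ler_expR lerN2 ler_nat; case: (m : nat) => // k; rewrite leq_pmulr.
  rewrite -[m%:R]mulr1 -mulrN mulrC expRM_natr; apply: lerXn2r; rewrite ?nnegrE ?expR_ge0 //.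
  by rewrite expRN lef_pV2 ?expR1_ge2 // posrE ?expR_gt0.
rewrite big_const card_bool /= addr0.
apply: (@le_trans _ _ 4); first by have := sum_half_le2 R (4 * n).+1; lra.
by have := expR1_ge2 R; have -> : (2 : R) = 1 + 1 by []; rewrite expRD; nra.
Qed.

Lemma lat_vec_sqr (R : realType) (n : nat) (f : lattice n) :
  lat_ball f -> (0 < n)%N -> \sum_i lat_vec R f i ^+ 2 <= 1.
Proof.
move=> bf n0; have n0' : (0 : R) < n%:R by rewrite ltr0n.
have -> : \sum_i lat_vec R f i ^+ 2 = (\sum_i (f i).2 ^ 2)%N%:R / (16 * n%:R).
  rewrite natr_sum mulr_suml; apply: eq_bigr => i _.
  rewrite /lat_vec exprMn exprMn sqrr_sign mul1r exprVn exprMn sqr_sqrtr ?ltW //.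
  by rewrite natrX; congr (_ / (_ * _)); ring.
by rewrite ler_pdivrMr ?mulr_gt0 // mul1r -natrM ler_nat.
Qed.

Definition light_event (R : realType) (n : nat) (P : 'M[R]_n) (w K : R)
    (A : 'M[bool]_n) : bool :=
  [forall f : lattice n, forall g : lattice n, lat_ball f ==> lat_ball g ==>
    (light_form P w (lat_vec R f) (lat_vec R g) A <= K * w)].

(** Chernoff with tilt [n / (2 w)]: the level [K * w] gains [K n / 2 >= (alpha + 37) n], of which
    [alpha n] pays for the moment bound and [36 n] for the pairs of net points, so [n] remains. *)
Lemma light_event_prob (R : realType) (n : nat) (P : 'M[R]_n) (alpha w K : R) :
  (forall i j, 0 <= P i j <= 1) -> (forall i j, P i j = P j i) ->
  (forall i, P i i = 0) -> 0 < w -> (0 < n)%N ->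
  (forall i j, P i j <= alpha * w ^+ 2 / n%:R) ->
  2 * (alpha + 37) <= K ->
  exists f : 'M[bool]_n -> R,
   [/\ forall A, 0 <= f A, forall A, ~~ light_event P w K A -> 1 <= f A &
      expect P f <= expR (- n%:R)].
Proof.
move=> P01 Psym Pd w0 n0 Pbd hK.
have n0' : (0 : R) < n%:R by rewrite ltr0n.
have [wn0 nn0] := (lt0r_neq0 w0, lt0r_neq0 n0').
pose l : R := n%:R / (2 * w).
pose B := [pred f : lattice n | lat_ball f].
pose F A : R := \sum_(f | B f) \sum_(g | B g)
   expR (- (l * (K * w))) * expR (l * light_form P w (lat_vec R f) (lat_vec R g) A).
have pos f g A : 0 <= expR (- (l * (K * w))) * expR (l * light_form P w (lat_vec R f) (lat_vec R g) A).
  by rewrite mulr_ge0 ?expR_ge0.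
exists F; split => [A|A|].
- by apply: sumr_ge0 => f _; apply: sumr_ge0 => g _.
- rewrite /light_event => /forallPn[f /forallPn[g]].
  rewrite !negb_imply => /andP[bf /andP[bg]]; rewrite -ltNge => h.
  rewrite /F (bigD1 f) //= (bigD1 g) //= -addrA.
  apply: ler_wpDr.
    apply: addr_ge0; first by apply: sumr_ge0 => g' _.
    by apply: sumr_ge0 => f' _; apply: sumr_ge0 => g' _.
  rewrite -expRD -[leLHS]expR0 ler_expR addrC subr_ge0 ler_wpM2l // ?ltW //.
  by rewrite divr_gt0 // mulr_gt0.
- rewrite /F expect_sum; under eq_bigr do rewrite expect_sum.
  apply: (@le_trans _ _ (\sum_(f | B f) \sum_(g | B g) expR (- (37 * n%:R)))).
    apply: ler_sum => f bf; apply: ler_sum => g bg.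
    rewrite expectZ; apply: le_trans.
      apply: ler_wpM2l; first exact: expR_ge0.
      by apply: (light_mgf P01 Psym Pd w0 n0 Pbd); apply: lat_vec_sqr.
    rewrite -expRD ler_expR.
    have -> : l * (K * w) = K / 2 * n%:R by rewrite /l; field; rewrite ?wn0 ?nn0 //.
    nra.
  rewrite !sumr_const -mulrnA -[leLHS]mulr_natl natrM.
  apply: (@le_trans _ _ (expR (18 * n%:R) * expR (18 * n%:R) * expR (- (37 * n%:R)))).
    apply: ler_wpM2r; first exact: expR_ge0.
    by apply: ler_pM => //; exact: lat_ball_card.
  by rewrite -!expRD ler_expR; lra.
Qed.

(** * Discrepancy *)

Definition edges (R : realType) (n : nat) (A : 'M[bool]_n) (S T : {set 'I_n}) : R :=
  \sum_(i in S) \sum_(j in T) (A i j)%:R.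

(** The exponent in the bound [(e n / s)^s] for the number of sets of size [s]; the factor [#|S|]
    makes it 0 on the empty set. *)
Definition ent (R : realType) (n : nat) (S : {set 'I_n}) : R :=
  #|S|%:R * (1 + ln (n%:R / #|S|%:R)).

Lemma ln4_ge1 (R : realType) (x : R) : 4 <= x -> 1 <= ln x.
Proof.
move=> x4; have x0 : 0 < x by lra.
rewrite -ler_expR lnK ?posrE //; apply: le_trans x4.
by have := @expR_le_quad R 1 (lexx _); lra.
Qed.

Lemma card_set_ord_le (n : nat) (S : {set 'I_n}) : (#|S| <= n)%N.
Proof. by rewrite -[leqRHS]card_ord max_card. Qed.

Lemma set_card_ge1 (R : realType) (n : nat) (S : {set 'I_n}) :
  S != finset.set0 -> (1 <= #|S|%:R :> R) && (#|S|%:R <= n%:R :> R).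
Proof.
move=> S0; rewrite ler1n card_gt0 S0 ler_nat.
exact: card_set_ord_le.
Qed.

(** Among nonempty sets the entropy is least at cardinality 1: the difference is
    [(s - 1) (ln n - ln s) + (s - 1 - ln s)]. *)
Lemma ent_ge (R : realType) (n : nat) (S : {set 'I_n}) :
  S != finset.set0 -> 1 + ln (n%:R : R) <= ent R S.
Proof.
move=> /(@set_card_ge1 R) /andP[]; rewrite /ent; set s := #|S|%:R => s1 sn.
have s0 : 0 < s by lra.
have n0 : 0 < n%:R :> R by lra.
rewrite ln_div ?posrE //.
have lsn : ln s <= ln n%:R by rewrite ler_ln ?posrE.
have ls : ln s <= s - 1.
  have -> : s = 1 + (s - 1) by ring.
  by apply: le_trans (le_ln1Dx _) _; lra.
rewrite -subr_ge0.
have -> : s * (1 + (ln n%:R - ln s)) - (1 + ln n%:R) =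
  (s - 1) * (ln n%:R - ln s) + (s - 1 - ln s) by ring.
by apply: addr_ge0; [apply: mulr_ge0|]; lra.
Qed.

Lemma ent_ge0 (R : realType) (n : nat) (S : {set 'I_n}) : 0 <= ent R S.
Proof.
have [->|S0] := eqVneq S finset.set0; first by rewrite /ent cards0 mul0r.
apply: le_trans (ent_ge _ S0); have /andP[s1 sn] := set_card_ge1 R S0.
by apply: addr_ge0 => //; apply: ln_ge0; lra.
Qed.

(** Each cardinality contributes at most 1: with [x] the ratio of the cardinality to [n], the number
    of sets times the matching power of [x] is a single term of [(1 + x)^n <= expR (n x)]. The index
    [s] stands for cardinality [s.+1], so that it ranges over ['I_n]. *)
Lemma sum_expR_ent (R : realType) (n : nat) :
  \sum_(S : {set 'I_n} | S != finset.set0) expR (- ent R S) <= n%:R.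
Proof.
have bound (s : 'I_n) :
    \sum_(S : {set 'I_n} | (S != finset.set0) && (#|S|.-1 == s)) expR (- ent R S) <= 1.
  have n0 : 0 < n%:R :> R by rewrite ltr0n (leq_ltn_trans _ (ltn_ord s)).
  pose x : R := s.+1%:R / n%:R.
  have x0 : 0 < x by rewrite divr_gt0.
  have eS (S : {set 'I_n}) : (S != finset.set0) && (#|S|.-1 == s) -> #|S| = s.+1.
    by rewrite -card_gt0 => /andP[? /eqP <-]; rewrite prednK.
  apply: (@le_trans _ _ (\sum_(S : {set 'I_n} | #|S| == s.+1) expR (- s.+1%:R) * x ^+ s.+1)).
    rewrite big_mkcond [leRHS]big_mkcond /=; apply: ler_sum => S _.
    case: ifP => [/eS e|_]; last first.
      by case: ifP => // _; rewrite mulr_ge0 ?expR_ge0 // exprn_ge0 // ltW.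
    rewrite e eqxx /ent e mulrDr mulr1 opprD expRD ler_wpM2l ?expR_ge0 //.
    by rewrite -[n%:R / _]invf_div lnV ?posrE // mulrN opprK expRM_natl lnK ?posrE.
  rewrite sumr_const -[leLHS]mulr_natl (_ : #|_| = 'C(n, s.+1)); last first.
    have := card_draws 'I_n s.+1; rewrite card_ord => <-.
    by apply: eq_card => S; rewrite !inE.
  rewrite mulrCA -ler_pdivlMl ?expR_gt0 // mulr1 expRN invrK.
  have -> : s.+1%:R = x * n%:R by rewrite /x divfK // lt0r_neq0.
  rewrite expRM_natr; apply: le_trans (_ : (1 + x) ^+ n <= _).
    rewrite exprDn (bigD1 (lift ord0 s)) //= expr1n mul1r mulr_natl lerDl.
    by apply: sumr_ge0 => i _; rewrite mulrn_wge0 // mulr_ge0 ?exprn_ge0 // ltW.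
  by apply: lerXn2r; rewrite ?nnegrE ?expR_ge0 ?expR_ge1Dx //; lra.
have [n0|n0] := posnP n.
  rewrite big1 ?ler0n // => S; rewrite -card_gt0 => S0.
  by have := card_set_ord_le S; lia.
pose s (S : {set 'I_n}) : 'I_n := insubd (Ordinal n0) #|S|.-1.
rewrite (partition_big s predT) //=.
rewrite -[n in leRHS]card_ord -sumr_const; apply: ler_sum => i _.
apply: le_trans (bound i); rewrite le_eqVlt; apply/orP; left; apply/eqP.
apply: eq_bigl => S; case: (boolP (S != _)) => //= S0.
rewrite -val_eqE /= val_insubd.
have h := card_set_ord_le S.
have S1 : (0 < #|S|)%N by rewrite card_gt0.
by rewrite ifT //; lia.
Qed.

(** The usual alternative between a bounded density ratio and an entropy bound is replaced by one
    additive inequality at each dyadic ratio [2 ^+ r / w], so that a union bound over [r] suffices.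
    The values used are [r = s + t] for levels [s, t <= 4 n], and the least admissible [r] in
    [heavy_card_le]. *)
Definition disc_event (R : realType) (n : nat) (alpha w K : R) (A : 'M[bool]_n) : bool :=
  [forall S : {set 'I_n}, forall T : {set 'I_n}, forall r : 'I_(8 * n + 3),
   [&& S != finset.set0, T != finset.set0 & 4 * w <= 2 ^+ r] ==>
   (edges R A S T <= 2 ^+ r / w * (alpha * w ^+ 2 / n%:R * (#|S|%:R * #|T|%:R))
      + K * (ent R S + ent R T) / ln (2 ^+ r / w))].

(** A pair with both orientations in [S] times [T] is counted twice, whence [2 * l]; a pair counted
    once is covered by [expR l - 1 <= expR (2 * l) / 2], which follows from
    [(expR l - 1) ^+ 2 >= 0]. *)
Lemma edges_mgf (R : realType) (n : nat) (P : 'M[R]_n) (b l : R) (S T : {set 'I_n}) :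
  (forall i j, 0 <= P i j <= 1) -> (forall i j, P i j = P j i) ->
  (forall i j, P i j <= b) -> 0 <= l -> 0 <= b ->
  expect P (fun A => expR (l * edges R A S T)) <=
  expR (expR (2 * l) / 2 * (b * (#|S|%:R * #|T|%:R))).
Proof.
move=> P01 Psym Pb l0 b0.
pose t i j : R := if i == j then 0 else ((i \in S) && (j \in T))%:R.
have edgesE A : is_adjacency A -> l * edges R A S T =
    \sum_(i < n) \sum_(j < n | (i < j)%N) (l * (t i j + t j i)) * (A i j)%:R.
  move=> adjA; rewrite /edges.
  transitivity (l * \sum_i \sum_j t i j * (A i j)%:R).
    congr (_ * _); rewrite big_mkcond; apply: eq_bigr => i _.
    case: (boolP (i \in S)) => iS; last first.
      by rewrite big1 // => j _; rewrite /t (negbTE iS); case: eqP => _; rewrite mul0r.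
    rewrite big_mkcond; apply: eq_bigr => j _; rewrite /t iS /=.
    case: eqP => [<-|_]; first by rewrite adjacency_diag // mulr0; case: ifP.
    by case: ifP => _; rewrite ?mul1r ?mul0r.
  rewrite sum_sym_pairs => [|i]; last by rewrite /t eqxx mul0r.
  rewrite mulr_sumr; apply: eq_bigr => i _; rewrite mulr_sumr; apply: eq_bigr => j _.
  by rewrite (adjacency_sym j i adjA); ring.
under expect_eq => A adjA do rewrite edgesE //.
apply: le_trans (mgf_le P01 _) _; rewrite ler_expR.
have e0 := expR_ge0 (2 * l).
apply: (@le_trans _ _ (\sum_(i < n) \sum_(j < n | (i < j)%N)
    (b * (expR (2 * l) / 2)) * (t i j + t j i))).
  apply: ler_sum => i _; apply: ler_sum => j _; rewrite -mulrA.
  have /andP[p0 p1] := P01 i j.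
  apply: (@le_trans _ _ (P i j * (expR (2 * l) / 2 * (t i j + t j i)))).
    apply: ler_wpM2l => //.
    have e2 : expR (2 * l) = expR l ^+ 2 by rewrite expr2 -expRD; congr expR; ring.
    have sq := sqr_ge0 (expR l - 1).
    rewrite /t [j == i]eq_sym; case: eqP => _; first by rewrite addr0 mulr0 expR0; lra.
    case: (_ && _); case: (_ && _) => /=.
    - by rewrite -[1 + 1]/(2 : R) (mulrC l 2); lra.
    - by rewrite addr0 !mulr1 e2; nra.
    - by rewrite add0r !mulr1 e2; nra.
    - by rewrite addr0 !mulr0 expR0; lra.
  apply: ler_wpM2r => //.
  apply: mulr_ge0; first by lra.
  by rewrite /t; apply: addr_ge0; case: ifP.
under eq_bigr do rewrite -mulr_sumr.
rewrite -mulr_sumr [leRHS]mulrCA -[leLHS]mulrA; apply: ler_wpM2l => //; apply: ler_wpM2l; first by lra.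
rewrite -sum_sym_pairs => [|i]; last by rewrite /t eqxx.
apply: (@le_trans _ _ (\sum_i \sum_j ((i \in S)%:R * (j \in T)%:R))).
  apply: ler_sum => i _; apply: ler_sum => j _; rewrite /t -natrM mulnb.
  by case: ifP.
under eq_bigr do rewrite -mulr_sumr.
by rewrite -mulr_suml -!natr_sum -!sum1_card ![(\sum_(i in _) 1)%N]big_mkcond.
Qed.

(** For [v = 2 ^+ r / w] and tilt [ln v / 2], the moment bound is [v / 2] times the mass term and is
    absorbed by the threshold because [ln v >= 1]; the constant 8 then leaves
    [expR (- 4 (ent S + ent T))] for each choice of [S], [T], [r]. *)
Lemma disc_event_prob (R : realType) (n : nat) (P : 'M[R]_n) (alpha w : R) :
  (forall i j, 0 <= P i j <= 1) -> (forall i j, P i j = P j i) ->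
  0 < w -> (0 < n)%N -> 0 <= alpha ->
  (forall i j, P i j <= alpha * w ^+ 2 / n%:R) ->
  exists f : 'M[bool]_n -> R,
   [/\ forall A, 0 <= f A, forall A, ~~ disc_event alpha w 8 A -> 1 <= f A &
      expect P f <= n%:R^-1].
Proof.
move=> P01 Psym w0 n0 al0 Pbd.
have n0' : (0 : R) < n%:R by rewrite ltr0n.
have n1' : (1 : R) <= n%:R by rewrite ler1n.
pose b := alpha * w ^+ 2 / n%:R.
have b0 : 0 <= b by rewrite /b divr_ge0 ?mulr_ge0 ?sqr_ge0 // ltW.
pose l (r : nat) : R := ln (2 ^+ r / w) / 2.
pose h (S T : {set 'I_n}) (r : nat) : R := 2 ^+ r / w * (b * (#|S|%:R * #|T|%:R))
      + 8 * (ent R S + ent R T) / ln (2 ^+ r / w).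
pose Q r := 4 * w <= 2 ^+ r.
pose F A : R := \sum_(S | S != finset.set0) \sum_(T | T != finset.set0)
  \sum_(r < 8 * n + 3 | Q r) expR (- (l r * h S T r)) * expR (l r * edges R A S T).
have pos S T r A : 0 <= expR (- (l r * h S T r)) * expR (l r * edges R A S T).
  by rewrite mulr_ge0 ?expR_ge0.
exists F; split => [A|A|].
- by apply: sumr_ge0 => S _; apply: sumr_ge0 => T _; apply: sumr_ge0 => r _.
- case/forallPn => S /forallPn[T /forallPn[r]].
  rewrite negb_imply -ltNge => /andP[/and3P[S0 T0 hr] lt].
  rewrite /F (bigD1 S) //= (bigD1 T) //= (bigD1 r) //= -!addrA.
  apply: ler_wpDr.
    apply: addr_ge0; first exact: sumr_ge0.
    by apply: addr_ge0; do ?[apply: sumr_ge0 => ? _].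
  rewrite -expRD -[leLHS]expR0 ler_expR addrC subr_ge0.
  apply: ler_wpM2l; last exact: ltW.
  by rewrite /l divr_ge0 // ln_ge0 // ler_pdivlMr //; lra.
- rewrite /F expect_sum; under eq_bigr do rewrite expect_sum.
  under eq_bigr do under eq_bigr do rewrite expect_sum.
  pose E0 : R := \sum_(S : {set 'I_n} | S != finset.set0) expR (- (4 * ent R S)).
  apply: (@le_trans _ _ (\sum_(S : {set 'I_n} | S != finset.set0) \sum_(T : {set 'I_n} | T != finset.set0)
     (8 * n + 3)%:R * (expR (- (4 * ent R S)) * expR (- (4 * ent R T))))).
    apply: ler_sum => S S0; apply: ler_sum => T T0.
    rewrite mulr_natl -[(8 * n + 3)%N in leRHS]card_ord -sumr_const big_mkcond /=.
    apply: ler_sum => r _; case: ifP => [hr|_]; last by rewrite mulr_ge0 ?expR_ge0.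
    have r4 : 4 <= 2 ^+ r / w by rewrite ler_pdivlMr.
    have L1 := ln4_ge1 r4.
    have lr0 : 0 <= l r by rewrite /l; lra.
    rewrite expectZ; apply: le_trans.
      apply: ler_wpM2l; first exact: expR_ge0.
      exact: (@edges_mgf _ _ _ b _ _ _ P01 Psym Pbd lr0 b0).
    rewrite -!expRD ler_expR.
    have -> : 2 * l r = ln (2 ^+ r / w) by rewrite /l mulrC divfK.
    rewrite lnK; last by rewrite posrE; lra.
    have -> : l r * h S T r = ln (2 ^+ r / w) / 2 * (2 ^+ r / w * (b * (#|S|%:R * #|T|%:R)))
       + 4 * (ent R S + ent R T).
      by rewrite /l /h; field; rewrite ?lt0r_neq0 //; lra.
    set u := b * _; have u0 : 0 <= u := mulr_ge0 b0 (mulr_ge0 (ler0n _ _) (ler0n _ _)).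
    set v := 2 ^+ r / w in r4 L1 *.
    have vu : 0 <= v * u by apply: mulr_ge0 => //; lra.
    have : 0 <= (ln v - 1) * (v * u) by apply: mulr_ge0 => //; lra.
    by lra.
  under eq_bigr do rewrite -mulr_sumr -mulr_sumr.
  rewrite -mulr_sumr -mulr_suml -/E0.
  have E0_ge0 : 0 <= E0 by apply: sumr_ge0 => S _; exact: expR_ge0.
  (* One of the four entropies pays for the sum over sets; the other three give [(2 n)^-3], since
     [expR (ent R S) >= expR 1 * n >= 2 n]. The square of this bound beats the number
     [8 n + 3 <= 11 n] of ratios. *)
  have E0_le : E0 <= n%:R * (2 * n%:R) ^- 3.
    apply: (@le_trans _ _ (\sum_(S : {set 'I_n} | S != finset.set0) (2 * n%:R) ^- 3 * expR (- ent R S))).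
      apply: ler_sum => S S0.
      have -> : - (4 * ent R S) = - (ent R S * 3%:R) - ent R S by ring.
      rewrite expRD ler_wpM2r ?expR_ge0 // expRN expRM_natr lef_pV2; last 2 first.
      - by rewrite posrE exprn_gt0 // expR_gt0.
      - by rewrite posrE exprn_gt0 // mulr_gt0.
      apply: lerXn2r; rewrite ?nnegrE ?expR_ge0 ?mulr_ge0 //.
      apply: le_trans (_ : expR (1 + ln n%:R) <= _); last by rewrite ler_expR ent_ge.
      by rewrite expRD lnK ?posrE // ler_wpM2r ?expR1_ge2 // ltW.
    rewrite -mulr_sumr mulrC ler_wpM2r ?sum_expR_ent // invr_ge0 exprn_ge0 //.
  apply: (@le_trans _ _ ((11 * n%:R) * ((n%:R * (2 * n%:R) ^- 3) * (n%:R * (2 * n%:R) ^- 3)))).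
    apply: ler_pM => //; first by rewrite mulr_ge0.
      by rewrite natrD natrM; lra.
    by apply: ler_pM.
  have -> : (11 * n%:R) * ((n%:R * (2 * n%:R) ^- 3) * (n%:R * (2 * n%:R) ^- 3)) =
     n%:R^-1 * (11 / 64 * n%:R ^- 2) :> R.
    by field; rewrite lt0r_neq0.
  apply: ler_piMr; rewrite ?invr_ge0 ?ler0n //.
  apply: (@le_trans _ _ (11 / 64 * 1)); last by lra.
  by rewrite ler_wpM2l // invf_le1 ?exprn_gt0 // exprn_ege1.
Qed.

(** * Heavy pairs *)

Lemma sum_geom_le (R : realType) (L : nat) (x U : R) : 0 <= x -> 0 <= U ->
  \sum_(s < L | 2 ^+ s * x <= U) 2 ^+ s * x <= 2 * U.
Proof.
move=> x0 U0; elim: L => [|L IH]; first by rewrite big_ord0 mulr_ge0.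
have geo : \sum_(s < L) 2 ^+ s * x <= 2 ^+ L * x.
  elim: (L) => [|M IHM]; first by rewrite big_ord0 mulr_ge0 // exprn_ge0.
  by rewrite big_ord_recr /= exprS; lra.
rewrite big_mkcond big_ord_recr /= -big_mkcond; case: ifP => [hL|_]; last by rewrite addr0.
apply: (@le_trans _ _ (2 ^+ L * x + 2 ^+ L * x)); last by lra.
rewrite lerD2r; apply: le_trans geo; rewrite big_mkcond /=; apply: ler_sum => s _.
by case: ifP => // _; rewrite mulr_ge0 // exprn_ge0.
Qed.

Lemma ln2_ge_half (R : realType) : 2^-1 <= ln (2 : R).
Proof.
have := @ln4_ge1 R 4 (lexx _).
have -> : (4 : R) = 2 * 2 by ring.
by rewrite lnM ?posrE //; lra.
Qed.

Lemma ln4_le2 (R : realType) : ln (4 : R) <= 2.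
Proof.
rewrite -ler_expR lnK ?posrE //.
have -> : (2 : R) = 1 + 1 by [].
by rewrite expRD; have := expR1_ge2 R; nra.
Qed.

(** Let [y = 2 ^+ (s + t) / w], so that [4 <= y <= 2 * 4 ^+ t]. Terms with [y <= 2 ^+ t] use
    [ln y >= 1] and sum to at most [2 * 2 ^+ t], already below [2 * 4 ^+ t / (t + 1)]; the others
    use [ln y >= (t + 1) / 3] and give the remaining 12. The gain [1 / (t + 1)] is what later
    offsets the entropy of level [t]. *)
Lemma sum_log_geom_le (R : realType) (L t : nat) (w : R) : 0 < w ->
  \sum_(s < L | (4 * w <= 2 ^+ (s + t)) && (2 ^+ s <= 2 * w * 2 ^+ t))
     2 ^+ (s + t) / ln (2 ^+ (s + t) / w) <= w * (14 * 4 ^+ t / t.+1%:R).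
Proof.
move=> w0; pose x := 2 ^+ t / w.
have x0 : 0 <= x by rewrite divr_ge0 ?exprn_ge0 // ltW.
have four : 4 ^+ t = 2 ^+ t * 2 ^+ t :> R by rewrite -exprMn; congr (_ ^+ _); ring.
have p2 : 0 < (2 : R) ^+ t by rewrite exprn_gt0.
pose V := 2 * 4 ^+ t : R.
have t1 : (0 : R) < t.+1%:R by rewrite ltr0n.
apply: (@le_trans _ _ (w * (3 / t.+1%:R * \sum_(s < L | 2 ^+ s * x <= V) 2 ^+ s * x +
    \sum_(s < L | 2 ^+ s * x <= 2 ^+ t) 2 ^+ s * x))).
  rewrite mulr_sumr [X in _ * (X + _)]big_mkcond [X in _ * (_ + X)]big_mkcond /=.
  rewrite -big_split /= mulr_sumr big_mkcond /=; apply: ler_sum => s _.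
  have ux : 2 ^+ (s + t) = w * (2 ^+ s * x).
    by rewrite /x exprD; field; rewrite lt0r_neq0.
  have y0 : 0 <= 2 ^+ s * x by rewrite mulr_ge0 // exprn_ge0.
  case: ifP => [/andP[h4 hU]|_]; last first.
    rewrite mulr_ge0 ?(ltW w0) //; apply: addr_ge0; case: ifP => // _.
    by rewrite mulr_ge0 // divr_ge0 // ltW.
  have -> : 2 ^+ s * x <= V.
    rewrite /x mulrA ler_pdivrMr // /V four.
    have -> : 2 * (2 ^+ t * 2 ^+ t) * w = 2 * w * 2 ^+ t * 2 ^+ t by ring.
    by rewrite ler_wpM2r // ltW.
  have uw : w * (2 ^+ s * x) / w = 2 ^+ s * x by rewrite mulrAC divff ?lt0r_neq0 ?mul1r.
  rewrite ux in h4 *; rewrite uw -[leLHS]mulrA; apply: ler_wpM2l; first exact: ltW.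
  set y := 2 ^+ s * x in y0 h4 *.
  have y4 : 4 <= y by rewrite -(ler_pM2l w0) mulrC.
  have L1 := ln4_ge1 y4.
  have [yt|yt] := lerP y (2 ^+ t).
    apply: ler_wpDl; first by rewrite mulr_ge0 // divr_ge0 // ltW.
    by rewrite ler_pdivrMr ?ler_peMr //; lra.
  rewrite addr0 mulrC; apply: ler_wpM2r => //.
  rewrite -[leRHS]invf_div lef_pV2 ?posrE ?divr_gt0 //; last by lra.
  have Lt : t%:R / 2 <= ln y.
    apply: le_trans (_ : ln (2 ^+ t) <= _); last by rewrite ler_ln ?posrE ?ltW //; lra.
    rewrite lnXn // -[leRHS]mulr_natl; apply: ler_wpM2l => //; exact: ln2_ge_half.
  case: (ltnP t 3) => ht; last first.
    by have : (3 : R) <= t%:R; [rewrite ler_nat|rewrite -[t.+1%:R]natr1; lra].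
  by have : (t%:R : R) <= 2; [rewrite ler_nat|rewrite -[t.+1%:R]natr1; lra].
apply: ler_wpM2l; first exact: ltW.
have V0 : 0 <= V by rewrite mulr_ge0 // exprn_ge0.
have g1 := sum_geom_le L x0 V0.
have g2 := sum_geom_le L x0 (ltW p2).
apply: (@le_trans _ _ (3 / t.+1%:R * (2 * V) + 2 * 2 ^+ t)).
  by apply: lerD => //; apply: ler_wpM2l => //; rewrite divr_ge0 // ltW.
have h : 2 ^+ t <= 4 ^+ t / t.+1%:R :> R.
  rewrite ler_pdivlMr // four ler_wpM2l ?(ltW p2) //.
  by rewrite -natrX ler_nat; apply: ltn_expl.
have -> : 14 * 4 ^+ t / t.+1%:R = 3 / t.+1%:R * (2 * V) + 2 * (4 ^+ t / t.+1%:R) :> R.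
  by rewrite /V; field; rewrite lt0r_neq0.
by rewrite lerD2l ler_wpM2l.
Qed.

(** With [b = 4^t |T| / n] the left side is [n (b + t b ln 4 - b ln b) / (t + 1)]. Division by
    [t + 1] removes the factor [t], and [- b ln b <= t b + expR (- t)] handles small [b], at the
    price of a remainder [n 2^-t] summable over the levels. *)
Lemma ent_level_le (R : realType) (n t : nat) (T : {set 'I_n}) : (0 < n)%N ->
  4 ^+ t / t.+1%:R * ent R T <= 3 * (4 ^+ t * #|T|%:R) + n%:R * 2^-1 ^+ t.
Proof.
move=> n0; have n0' : (0 : R) < n%:R by rewrite ltr0n.
have t1 : (0 : R) < t.+1%:R by rewrite ltr0n.
have h0 : 0 <= (2^-1 : R) ^+ t by rewrite exprn_ge0 // invr_ge0.
have [->|T0] := eqVneq T finset.set0.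
  by rewrite /ent cards0 mul0r !mulr0 add0r mulr_ge0 // ltW.
have /andP[c1 cn] := set_card_ge1 R T0.
rewrite /ent; set c := #|T|%:R in c1 cn *.
have c0 : 0 < c by lra.
have p4 : 0 < (4 : R) ^+ t by rewrite exprn_gt0.
pose b := 4 ^+ t * c / n%:R.
have b0 : 0 < b by rewrite divr_gt0 // mulr_gt0.
have -> : n%:R / c = 4 ^+ t / b by rewrite /b; field; rewrite !lt0r_neq0.
rewrite ln_div ?posrE // lnXn // -[ln 4 *+ t]mulr_natl.
have L4 := ln4_le2 R.
have key : - (b * ln b) <= t%:R * b + expR (- t%:R).
  have z0 : 0 < expR (- t%:R) / b by rewrite divr_gt0 ?expR_gt0.
  have : ln (expR (- t%:R) / b) <= expR (- t%:R) / b - 1.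
    have -> : ln (expR (- t%:R) / b) = ln (1 + (expR (- t%:R) / b - 1)) by congr ln; ring.
    by apply: le_ln1Dx; lra.
  rewrite ln_div ?posrE ?expR_gt0 // expRK => /(ler_wpM2l (ltW b0)).
  have -> : b * (expR (- t%:R) / b - 1) = expR (- t%:R) - b by field; rewrite lt0r_neq0.
  by lra.
have et : expR (- t%:R) <= (2^-1 : R) ^+ t.
  rewrite -[t%:R]mulr1 -mulrN mulrC expRM_natr; apply: lerXn2r; rewrite ?nnegrE ?expR_ge0 //.
  by rewrite expRN lef_pV2 ?expR1_ge2 // posrE ?expR_gt0.
have ec : 4 ^+ t * c = n%:R * b by rewrite /b; field; rewrite lt0r_neq0.
have -> : 4 ^+ t / t.+1%:R * (c * (1 + (t%:R * ln 4 - ln b))) =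
    n%:R * (b + t%:R * b * ln 4 - b * ln b) / t.+1%:R.
  transitivity (4 ^+ t * c * (1 + (t%:R * ln 4 - ln b)) / t.+1%:R); first by ring.
  by rewrite ec; ring.
rewrite ec ler_pdivrMr //.
have -> : (3 * (n%:R * b) + n%:R * 2^-1 ^+ t) * t.+1%:R =
   n%:R * (3 * b * t.+1%:R + 2^-1 ^+ t * t.+1%:R) by ring.
apply: ler_wpM2l; first exact: ltW.
have tb : 0 <= t%:R * b by rewrite mulr_ge0 // ltW.
have q1 : t%:R * b * ln 4 <= t%:R * b * 2 by rewrite ler_wpM2l.
have q2 : (2^-1 : R) ^+ t <= 2^-1 ^+ t * t.+1%:R by rewrite ler_peMr // ler1n.
rewrite -[t.+1%:R]natr1 in q2 *; lra.
Qed.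

(** Since [trunc_log 2 0 = 0], zero coordinates have to be kept out of level 0 explicitly. *)
Definition level (n : nat) (m : 'I_n -> nat) (s : nat) : {set 'I_n} :=
  [set i | (0 < m i)%N && (trunc_log 2 (m i) == s)]%SET.

Lemma sum_level_le (R : realType) (n L : nat) (m : 'I_n -> nat) :
  \sum_(s < L) 4 ^+ s * #|level m s|%:R <= (\sum_i m i ^ 2)%N%:R :> R.
Proof.
have -> : \sum_(s < L) 4 ^+ s * #|level m s|%:R =
    \sum_i \sum_(s < L) 4 ^+ s * (i \in level m s)%:R :> R.
  rewrite exchange_big /=; apply: eq_bigr => s _.
  by rewrite -mulr_sumr -sum1_card natr_sum [in LHS]big_mkcond; congr (_ * _);
     apply: eq_bigr => i _; case: ifP.
rewrite natr_sum; apply: ler_sum => i _.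
under eq_bigr => s _ do rewrite inE.
have [m0|m0] := posnP (m i).
  by rewrite big1 // => s _; rewrite mulr0.
have /andP[le _] := trunc_log_bounds (isT : (1 < 2)%N) m0.
have e4 : 4 ^+ trunc_log 2 (m i) <= (m i ^ 2)%:R :> R.
  by rewrite -natrX ler_nat (_ : 4 = 2 ^ 2)%N // -expnM mulnC expnM leq_sqr.
case: (ltnP (trunc_log 2 (m i)) L) => hL; last first.
  rewrite big1 ?ler0n // => s _; case: eqP => /=; last by rewrite mulr0.
  by move=> e; have := ltn_ord s; rewrite -e ltnNge hL.
rewrite (bigD1 (Ordinal hL)) //= eqxx mulr1 big1 ?addr0 // => s.
by rewrite -val_eqE /= eq_sym => /negbTE ->; rewrite mulr0.
Qed.

Section Heavy.
Variables (R : realType) (n : nat) (A : 'M[bool]_n) (alpha w : R).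
Hypothesis adjA : is_adjacency A.
Hypothesis w_ge1 : 1 <= w.
Hypothesis n_gt0 : (0 < n)%N.
Hypothesis alpha_ge0 : 0 <= alpha.
Hypothesis discA : disc_event alpha w 8 A.
Variables (m m' : 'I_n -> nat).
Hypothesis hm : (\sum_i m i ^ 2 <= 16 * n)%N.
Hypothesis hm' : (\sum_i m' i ^ 2 <= 16 * n)%N.

Let L := (4 * n).+1.

Lemma edges_disc (S T : {set 'I_n}) (r : 'I_(8 * n + 3)) : 4 * w <= 2 ^+ r ->
  edges R A S T <= 2 ^+ r / w * (alpha * w ^+ 2 / n%:R * (#|S|%:R * #|T|%:R))
      + 8 * (ent R S + ent R T) / ln (2 ^+ r / w).
Proof.
move=> hr; have w0 : 0 < w := lt_le_trans ltr01 w_ge1.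
have n0 : (0 : R) < n%:R by rewrite ltr0n.
have r4 : 4 <= 2 ^+ r / w by rewrite ler_pdivlMr.
have L1 := ln4_ge1 r4.
have rhs0 : 0 <= 2 ^+ r / w * (alpha * w ^+ 2 / n%:R * (#|S|%:R * #|T|%:R))
      + 8 * (ent R S + ent R T) / ln (2 ^+ r / w).
  apply: addr_ge0.
    by rewrite !mulr_ge0 ?invr_ge0 ?exprn_ge0 ?sqr_ge0 ?ler0n // ltW.
  by apply: divr_ge0; [apply: mulr_ge0 => //; apply: addr_ge0; exact: ent_ge0|lra].
have [S0|S0] := eqVneq S finset.set0; first by rewrite {1}/edges {1}S0 big_set0.
have [T0|T0] := eqVneq T finset.set0.
  by rewrite {1}/edges {1}T0 big1 // => i _; rewrite big_set0.
have /forallP /(_ S) /forallP /(_ T) /forallP /(_ r) := discA.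
by rewrite S0 T0 hr.
Qed.

Lemma lev_ge (f : 'I_n -> nat) i s : i \in level f s -> (2 ^+ s : R) <= (f i)%:R.
Proof.
rewrite inE => /andP[f0 /eqP <-]; rewrite -natrX ler_nat.
by case/andP: (trunc_log_bounds (isT : (1 < 2)%N) f0).
Qed.

Lemma lev_lt (f : 'I_n -> nat) i s : i \in level f s -> (f i)%:R < (2 * 2 ^+ s : R).
Proof.
rewrite inE => /andP[f0 /eqP <-]; rewrite -exprS -natrX ltr_nat.
by case/andP: (trunc_log_bounds (isT : (1 < 2)%N) f0).
Qed.

Lemma lev_bound (f : 'I_n -> nat) i : (\sum_i f i ^ 2 <= 16 * n)%N ->
  (trunc_log 2 (f i) < L)%N.
Proof.
move=> hf; rewrite ltnS; apply: (@leq_trans (f i)).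
  have [->|f0] := posnP (f i); first by rewrite trunc_log0.
  case/andP: (trunc_log_bounds (isT : (1 < 2)%N) f0) => h _.
  by apply: leq_trans h; apply/ltnW/ltn_expl.
rewrite -leq_sqr; apply: (@leq_trans (16 * n)).
  by apply: leq_trans hf; rewrite (bigD1 i) //= leq_addr.
by rewrite expnMn; nia.
Qed.

(** The levels left to the discrepancy bound: heavy product, and moduli within a factor [2 w] of
    each other. Unbalanced pairs are left to the degree bound. *)
Definition mid (s t : nat) : bool :=
  [&& 4 * w <= 2 ^+ (s + t), 2 ^+ s <= 2 * w * 2 ^+ t & 2 ^+ t <= 2 * w * 2 ^+ s].

(** The gain [1 / (t + 1)] of the inner sum meets the entropy of level [t]; the constant is
    [14 * (3 * 16 + 2)]. *)
Lemma ent_sum_le (f : 'I_n -> nat) : (\sum_i f i ^ 2 <= 16 * n)%N ->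
  \sum_(t < L) \sum_(s < L | (4 * w <= 2 ^+ (s + t)) && (2 ^+ s <= 2 * w * 2 ^+ t))
     2 ^+ (s + t) / ln (2 ^+ (s + t) / w) * ent R (level f t) <= 700 * (n%:R * w).
Proof.
move=> hf; have w0 : 0 < w := lt_le_trans ltr01 w_ge1.
apply: (@le_trans _ _ (\sum_(t < L) w * 14 *
   (3 * (4 ^+ t * #|level f t|%:R) + n%:R * 2^-1 ^+ t))).
  apply: ler_sum => t _; rewrite -mulr_suml.
  apply: le_trans (ler_wpM2r (ent_ge0 _ _) (sum_log_geom_le _ _ w0)) _.
  rewrite (_ : _ * ent _ _ = w * 14 * (4 ^+ t / t.+1%:R * ent R (level f t))); last first.
    by field.
  by apply: ler_wpM2l; [rewrite mulr_ge0 // ltW|exact: ent_level_le].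
rewrite -mulr_sumr big_split /= -!mulr_sumr.
have h1 := sum_level_le R L f.
have h2 : (\sum_i f i ^ 2)%N%:R <= 16 * n%:R :> R by rewrite -natrM ler_nat.
have h3 := sum_half_le2 R L.
have n0 : (0 : R) <= n%:R by [].
have h4 := ler_wpM2l n0 h3.
have -> : 700 * (n%:R * w) = w * 14 * (50 * n%:R) by ring.
apply: ler_wpM2l; first by rewrite mulr_ge0 // ltW.
lra.
Qed.

(** The factor 4 pays for the two dyadic roundings. The mass term of the discrepancy bound gives
    [4 * 16 * 16 * alpha], and each of the two entropy terms [32 * 700]. *)
Lemma mid_sum_le :
  \sum_(s < L) \sum_(t < L | mid s t) 4 * 2 ^+ (s + t) * edges R A (level m s) (level m' t)
  <= (1024 * alpha + 448 * 100) * (n%:R * w).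
Proof.
have w0 : 0 < w := lt_le_trans ltr01 w_ge1.
have n0 : (0 : R) < n%:R by rewrite ltr0n.
pose a s : R := 4 ^+ s * #|level m s|%:R.
pose b t : R := 4 ^+ t * #|level m' t|%:R.
pose q s t : R := 2 ^+ (s + t) / ln (2 ^+ (s + t) / w).
have a0 s : 0 <= a s by rewrite mulr_ge0 // exprn_ge0.
have b0 t : 0 <= b t by rewrite mulr_ge0 // exprn_ge0.
apply: (@le_trans _ _ (\sum_(s < L) \sum_(t < L | mid s t)
  (4 * (alpha * w / n%:R) * (a s * b t) +
   32 * (q s t * ent R (level m s)) + 32 * (q s t * ent R (level m' t))))).
  apply: ler_sum => s _; apply: ler_sum => t /and3P[h4 _ _].
  have hr : (s + t < 8 * n + 3)%N by have := ltn_ord s; have := ltn_ord t; rewrite /L; lia.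
  have p0 : 0 <= 4 * (2 : R) ^+ (s + t) by rewrite mulr_ge0 // exprn_ge0.
  have r4 : 4 <= 2 ^+ (s + t) / w by rewrite ler_pdivlMr.
  have L1 := ln4_ge1 r4.
  apply: le_trans (ler_wpM2l p0 (@edges_disc _ _ (Ordinal hr) h4)) _.
  rewrite /= le_eqVlt; apply/orP; left; apply/eqP.
  have e4 k : 4 ^+ k = 2 ^+ k * 2 ^+ k :> R by rewrite -exprMn; congr (_ ^+ _); ring.
  rewrite /q /a /b !e4 exprD; field.
  by rewrite -exprD !lt0r_neq0 //; lra.
under eq_bigr do rewrite !big_split /=.
rewrite !big_split /=.
have q0 s t : 4 * w <= 2 ^+ (s + t) -> 0 <= q s t.
  move=> h4; have r4 : 4 <= 2 ^+ (s + t) / w by rewrite ler_pdivlMr.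
  have L1 := ln4_ge1 r4.
  by rewrite /q divr_ge0 ?exprn_ge0 //; lra.
have B2 : \sum_(s < L) \sum_(t < L | mid s t) 32 * (q s t * ent R (level m' t)) <=
    32 * (700 * (n%:R * w)).
  rewrite (exchange_big_dep predT) //=.
  apply: le_trans (ler_wpM2l _ (ent_sum_le hm')); last by [].
  rewrite mulr_sumr; apply: ler_sum => t _; rewrite mulr_sumr.
  rewrite big_mkcond [leRHS]big_mkcond /=; apply: ler_sum => s _.
  case: ifP => [hmid|_]; first by case/and3P: (hmid) => -> -> _ /=.
  case: ifP => // /andP[/q0 h4 _]; rewrite mulr_ge0 //.
  by apply: mulr_ge0 => //; exact: ent_ge0.
have B1 : \sum_(s < L) \sum_(t < L | mid s t) 32 * (q s t * ent R (level m s)) <=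
    32 * (700 * (n%:R * w)).
  apply: le_trans (ler_wpM2l _ (ent_sum_le hm)); last by [].
  rewrite mulr_sumr; apply: ler_sum => s _; rewrite mulr_sumr.
  rewrite big_mkcond [leRHS]big_mkcond /=; apply: ler_sum => t _.
  rewrite /q [(t + s)%N]addnC.
  case: ifP => [hmid|_]; first by case/and3P: (hmid) => -> _ -> /=.
  case: ifP => // /andP[/q0 h4 _]; rewrite mulr_ge0 //.
  by apply: mulr_ge0 => //; exact: ent_ge0.
have B0 : \sum_(s < L) \sum_(t < L | mid s t) 4 * (alpha * w / n%:R) * (a s * b t) <=
    1024 * alpha * (n%:R * w).
  have c0 : 0 <= 4 * (alpha * w / n%:R) by rewrite !mulr_ge0 ?invr_ge0 // ltW.
  apply: (@le_trans _ _ (4 * (alpha * w / n%:R) * ((\sum_(s < L) a s) * (\sum_(t < L) b t)))).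
    rewrite mulr_suml mulr_sumr; apply: ler_sum => s _.
    rewrite mulr_sumr mulr_sumr big_mkcond /=; apply: ler_sum => t _.
    by case: ifP => // _; rewrite mulr_ge0 // mulr_ge0.
  have h1 := sum_level_le R L m; have h2 := sum_level_le R L m'.
  have h3 : (\sum_i m i ^ 2)%N%:R <= 16 * n%:R :> R by rewrite -natrM ler_nat.
  have h4 : (\sum_i m' i ^ 2)%N%:R <= 16 * n%:R :> R by rewrite -natrM ler_nat.
  have -> : 1024 * alpha * (n%:R * w) =
     4 * (alpha * w / n%:R) * ((16 * n%:R) * (16 * n%:R)).
    by field; rewrite lt0r_neq0.
  apply: ler_wpM2l => //; apply: ler_pM.
  - by apply: sumr_ge0.
  - by apply: sumr_ge0.
  - exact: le_trans h1 h3.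
  - exact: le_trans h2 h4.
lra.
Qed.

(** If [m i >= w * m' j], then [m i * m' j <= m i ^ 2 / w], and the degree bound sums this to
    [16 * D * (n * w)]; the mirror case is the same. All other heavy pairs lie in levels [s], [t]
    with [mid s t]. *)
Lemma heavy_sum_le (D : R) :
  (forall i, (0 < m i)%N -> \sum_(j | (0 < m' j)%N) (A i j)%:R <= D * w ^+ 2) ->
  (forall j, (0 < m' j)%N -> \sum_(i | (0 < m i)%N) (A i j)%:R <= D * w ^+ 2) ->
  0 <= D ->
  \sum_i \sum_(j | 16 * w < (m i * m' j)%:R) (m i * m' j)%:R * (A i j)%:R <=
  (32 * D + 1024 * alpha + 448 * 100) * (n%:R * w).
Proof.
move=> deg deg' D0; have w0 : 0 < w := lt_le_trans ltr01 w_ge1.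
pose F1 i j : R := (0 < m i)%N%:R * ((m i)%:R ^+ 2 / w * ((0 < m' j)%N%:R * (A i j)%:R)).
pose F2 i j : R := (0 < m' j)%N%:R * ((m' j)%:R ^+ 2 / w * ((0 < m i)%N%:R * (A i j)%:R)).
pose F3 i j : R := \sum_(s < L) \sum_(t < L | mid s t)
   4 * 2 ^+ (s + t) * ((i \in level m s)%:R * ((j \in level m' t)%:R * (A i j)%:R)).
have F1_ge0 i j : 0 <= F1 i j.
  by rewrite /F1 !mulr_ge0 ?sqr_ge0 // invr_ge0 ltW.
have F2_ge0 i j : 0 <= F2 i j.
  by rewrite /F2 !mulr_ge0 ?sqr_ge0 // invr_ge0 ltW.
have F3_ge0 i j : 0 <= F3 i j.
  by apply: sumr_ge0 => s _; apply: sumr_ge0 => t _; rewrite !mulr_ge0 ?exprn_ge0.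
apply: (@le_trans _ _ (\sum_i \sum_j (F1 i j + F2 i j + F3 i j))).
  apply: ler_sum => i _; rewrite big_mkcond /=; apply: ler_sum => j _.
  have := F1_ge0 i j; have := F2_ge0 i j; have := F3_ge0 i j.
  case: ifP => [hv|_]; last by lra.
  have mi : (0 < m i)%N.
    by rewrite lt0n; apply/negP => /eqP e; move: hv; rewrite e mul0n; lra.
  have mj : (0 < m' j)%N.
    by rewrite lt0n; apply/negP => /eqP e; move: hv; rewrite e muln0; lra.
  have a0 : 0 <= (A i j)%:R :> R by [].
  have [h1|h1] := lerP ((m' j)%:R * w) ((m i)%:R).
    suff : (m i * m' j)%:R * (A i j)%:R <= F1 i j by lra.
    rewrite /F1 mi mj !mul1r; apply: ler_wpM2r => //.
    by rewrite ler_pdivlMr // natrM -mulrA expr2 ler_wpM2l.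
  have [h2|h2] := lerP ((m i)%:R * w) ((m' j)%:R).
    suff : (m i * m' j)%:R * (A i j)%:R <= F2 i j by lra.
    rewrite /F2 mi mj !mul1r; apply: ler_wpM2r => //.
    by rewrite ler_pdivlMr // natrM mulrAC mulrC expr2 ler_wpM2l.
  suff : (m i * m' j)%:R * (A i j)%:R <= F3 i j by lra.
  pose s := Ordinal (lev_bound i hm); pose t := Ordinal (lev_bound j hm').
  have is_ : i \in level m s by rewrite inE mi /=.
  have jt : j \in level m' t by rewrite inE mj /=.
  have := lev_ge is_; have := lev_lt is_; have := lev_ge jt; have := lev_lt jt.
  set x := 2 ^+ s; set y := 2 ^+ t => jl jg il ig.
  have x0 : 0 < x by rewrite exprn_gt0.
  have y0 : 0 < y by rewrite exprn_gt0.
  have mt : (m i * m' j)%:R <= 4 * 2 ^+ (s + t) :> R.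
    rewrite natrM exprD -/x -/y.
    have -> : 4 * (x * y) = (2 * x) * (2 * y) by ring.
    by apply: ler_pM => //; apply: ltW.
  have hmid : mid s t.
    apply/and3P; split; first by lra.
      by rewrite -/x -/y; nra.
    by rewrite -/x -/y; nra.
  rewrite /F3 (bigD1 s) //= (bigD1 t) //= is_ jt !mul1r -addrA.
  apply: ler_wpDr; last by apply: ler_wpM2r.
  apply: addr_ge0; first by apply: sumr_ge0 => t' _; rewrite !mulr_ge0 ?exprn_ge0.
  by apply: sumr_ge0 => s' _; apply: sumr_ge0 => t' _; rewrite !mulr_ge0 ?exprn_ge0.
under eq_bigr do rewrite !big_split /=.
rewrite !big_split /=.
have n0 : (0 : R) < n%:R by rewrite ltr0n.
have B1 : \sum_i \sum_j F1 i j <= 16 * D * (n%:R * w).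
  apply: (@le_trans _ _ (\sum_i (m i ^ 2)%:R * (D * w))).
    apply: ler_sum => i _; rewrite -mulr_sumr -mulr_sumr.
    have -> : \sum_(j < n) (0 < m' j)%N%:R * (A i j)%:R = \sum_(j | (0 < m' j)%N) (A i j)%:R :> R.
      by rewrite [RHS]big_mkcond; apply: eq_bigr => j _; case: ifP => _; rewrite ?mul1r ?mul0r.
    have [m0|m0] := posnP (m i); first by rewrite mul0r !mulr_ge0 // ltW.
    rewrite mul1r natrX -mulrA ler_wpM2l ?sqr_ge0 //.
    by rewrite mulrC ler_pdivrMr // -mulrA -expr2 deg.
  rewrite -mulr_suml -natr_sum.
  have -> : 16 * D * (n%:R * w) = (16 * n)%:R * (D * w) by rewrite natrM; ring.
  by rewrite ler_wpM2r ?ler_nat // mulr_ge0 // ltW.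
have B2 : \sum_i \sum_j F2 i j <= 16 * D * (n%:R * w).
  rewrite exchange_big /=.
  apply: (@le_trans _ _ (\sum_j (m' j ^ 2)%:R * (D * w))).
    apply: ler_sum => j _; rewrite -mulr_sumr -mulr_sumr.
    have -> : \sum_(i < n) (0 < m i)%N%:R * (A i j)%:R = \sum_(i | (0 < m i)%N) (A i j)%:R :> R.
      by rewrite [RHS]big_mkcond; apply: eq_bigr => i _; case: ifP => _; rewrite ?mul1r ?mul0r.
    have [m0|m0] := posnP (m' j); first by rewrite mul0r !mulr_ge0 // ltW.
    rewrite mul1r natrX -mulrA ler_wpM2l ?sqr_ge0 //.
    by rewrite mulrC ler_pdivrMr // -mulrA -expr2 deg'.
  rewrite -mulr_suml -natr_sum.
  have -> : 16 * D * (n%:R * w) = (16 * n)%:R * (D * w) by rewrite natrM; ring.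
  by rewrite ler_wpM2r ?ler_nat // mulr_ge0 // ltW.
have B3 : \sum_i \sum_j F3 i j <= (1024 * alpha + 448 * 100) * (n%:R * w).
  apply: le_trans mid_sum_le; rewrite le_eqVlt; apply/orP; left; apply/eqP.
  rewrite /F3; under eq_bigr do rewrite exchange_big /=.
  rewrite exchange_big /=; apply: eq_bigr => s _.
  under eq_bigr do rewrite exchange_big /=.
  rewrite exchange_big /=; apply: eq_bigr => t _.
  rewrite /edges [X in _ = _ * X]big_mkcond mulr_sumr /=; apply: eq_bigr => i _.
  case: (i \in level m s); last by rewrite mulr0 big1 // => j _; rewrite mul0r mulr0.
  rewrite -mulr_sumr [in RHS]big_mkcond /=; congr (_ * _); apply: eq_bigr => j _.
  by rewrite mul1r; case: (j \in _); rewrite ?mul1r ?mul0r.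
lra.
Qed.

End Heavy.

(** * Operator norm of the trimmed matrices *)

Definition bil (R : realType) (m n : nat) (M : 'M[R]_(m, n)) (x : 'I_m -> R)
    (y : 'I_n -> R) : R := \sum_i \sum_j x i * y j * M i j.

(** The one-sided bound suffices for the operator norm, as [x] may be replaced by its opposite. *)
Definition op_le (R : realType) (m n : nat) (M : 'M[R]_(m, n)) (c : R) : Prop :=
  forall x y, \sum_i x i ^+ 2 <= 1 -> \sum_j y j ^+ 2 <= 1 -> bil M x y <= c.

Lemma bilDl (R : realType) m n (M : 'M[R]_(m, n)) x x' y :
  bil M (fun i => x i + x' i) y = bil M x y + bil M x' y.
Proof.
rewrite /bil -big_split /=; apply: eq_bigr => i _.
by rewrite -big_split /=; apply: eq_bigr => j _; ring.
Qed.

Lemma bilDr (R : realType) m n (M : 'M[R]_(m, n)) x y y' :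
  bil M x (fun i => y i + y' i) = bil M x y + bil M x y'.
Proof.
rewrite /bil -big_split /=; apply: eq_bigr => i _.
by rewrite -big_split /=; apply: eq_bigr => j _; ring.
Qed.

Lemma bilZl (R : realType) m n (M : 'M[R]_(m, n)) c x y :
  bil M (fun i => c * x i) y = c * bil M x y.
Proof.
rewrite /bil mulr_sumr; apply: eq_bigr => i _.
by rewrite mulr_sumr; apply: eq_bigr => j _; ring.
Qed.

Lemma bilZr (R : realType) m n (M : 'M[R]_(m, n)) c x y :
  bil M x (fun i => c * y i) = c * bil M x y.
Proof.
rewrite /bil mulr_sumr; apply: eq_bigr => i _.
by rewrite mulr_sumr; apply: eq_bigr => j _; ring.
Qed.

Lemma sqr_sum_le1 (R : realType) (n : nat) (x : 'I_n -> R) i :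
  \sum_i x i ^+ 2 <= 1 -> `|x i| <= 1.
Proof.
move=> hx; rewrite -[leRHS]normr1 -ler_sqr ?nnegrE // !real_normK ?num_real // expr1n.
apply: le_trans hx; rewrite (bigD1 i) //= lerDl.
by apply: sumr_ge0 => j _; exact: sqr_ge0.
Qed.

(** Moduli are rounded down, so the rounded point stays in the ball and vanishes wherever [x]
    does. *)
Lemma lattice_round (R : realType) (n : nat) (x : 'I_n -> R) : (0 < n)%N ->
  \sum_i x i ^+ 2 <= 1 ->
  exists2 f : lattice n, lat_ball f /\ (forall i, x i = 0 -> (f i).2 = 0%N :> nat) &
    \sum_i (x i - lat_vec R f i) ^+ 2 <= 16^-1 /\
    (forall i, x i = 0 -> lat_vec R f i = 0).
Proof.
move=> n0 hx; have n0' : (0 : R) < n%:R by rewrite ltr0n.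
pose s : R := 4 * Num.sqrt n%:R.
have sq0 : 0 < Num.sqrt (n%:R : R) by rewrite sqrtr_gt0.
have s0 : 0 < s by rewrite mulr_gt0.
have s2 : s ^+ 2 = 16 * n%:R by rewrite exprMn sqr_sqrtr ?ltW //; ring.
pose m i : nat := Num.truncn (s * `|x i|).
have m_itv i : (m i)%:R <= s * `|x i| < (m i)%:R + 1.
  by have := truncn_itv (mulr_ge0 (ltW s0) (normr_ge0 (x i))); rewrite -natr1.
have m_le i : (m i < (4 * n).+1)%N.
  rewrite ltnS -(ler_nat R); have /andP[h _] := m_itv i; apply: le_trans h _.
  have := sqr_sum_le1 i hx => h1.
  apply: (@le_trans _ _ (s * 1)); first by rewrite ler_wpM2l // ltW.
  rewrite mulr1 /s natrM ler_wpM2l // -[leRHS](ger0_norm (ltW n0')) -sqrtr_sqr.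
  by apply: ler_wsqrtr; rewrite expr2 ler_peMr // ler1n.
pose f : lattice n := [ffun i => (x i < 0, Ordinal (m_le i))].
have fE i : lat_vec R f i = (-1) ^+ (x i < 0)%R * ((m i)%:R / s).
  by rewrite /lat_vec ffunE /= mulrA.
have xE i : x i = (-1) ^+ (x i < 0)%R * `|x i| by rewrite -numEsign.
have m0 i : x i = 0 -> m i = 0%N.
  by move=> e; rewrite /m e normr0 mulr0 truncn0.
exists f; split.
- rewrite /lat_ball -(ler_nat R) natrM natr_sum.
  apply: (@le_trans _ _ (\sum_i s ^+ 2 * x i ^+ 2)).
    apply: ler_sum => i _; rewrite ffunE /= natrX -[x i ^+ 2]real_normK ?num_real //.
    rewrite -exprMn; have /andP[h _] := m_itv i.
    by apply: lerXn2r; rewrite ?nnegrE ?mulr_ge0 // ltW.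
  by rewrite -mulr_sumr s2 ler_piMr // mulr_ge0 // ltW.
- by move=> i xi0; rewrite ffunE /= m0.
- apply: (@le_trans _ _ (\sum_(i < n) (16 * n%:R)^-1)); last first.
    rewrite sumr_const card_ord -[leLHS]mulr_natl.
    by rewrite le_eqVlt; apply/orP; left; apply/eqP; field; rewrite lt0r_neq0.
  apply: ler_sum => i _; rewrite fE [X in X - _]xE -mulrBr exprMn sqrr_sign mul1r.
  have /andP[h1 h2] := m_itv i.
  have e : `|x i| - (m i)%:R / s = (s * `|x i| - (m i)%:R) / s.
    by field; rewrite lt0r_neq0.
  rewrite e exprMn exprVn s2 ler_piMl ?invr_ge0 ?mulr_ge0 //.
  by apply: exprn_ile1; lra.
- by move=> i xi0; rewrite fE m0 // mul0r mulr0.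
Qed.

(** Write [x = u + r / 4] and [y = v + q / 4] with [u], [v] net points and [r], [q] again in the
    ball. A bound [beta] on the form improves to [b + beta / 2], whose fixed point is [2 * b];
    starting from the sum of the moduli of the entries, [K] rounds leave an excess [S / 2^K]. *)
Lemma bil_le_net (R : realType) (n : nat) (M : 'M[R]_n) (W : {set 'I_n}) (b : R) :
  (0 < n)%N -> (forall i j, ~~ ((i \in W) && (j \in W)) -> M i j = 0) ->
  (forall f g : lattice n, lat_ball f -> lat_ball g ->
     (forall i, i \notin W -> (f i).2 = 0%N :> nat) ->
     (forall i, i \notin W -> (g i).2 = 0%N :> nat) ->
     bil M (lat_vec R f) (lat_vec R g) <= b) ->
  op_le M (2 * b).
Proof.
move=> n0 suppM net.
pose S : R := \sum_i \sum_j `|M i j|.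
pose supp (x : 'I_n -> R) := forall i, i \notin W -> x i = 0.
have S0 : 0 <= S by apply: sumr_ge0 => i _; apply: sumr_ge0 => j _; exact: normr_ge0.
have step (K : nat) : forall x y, supp x -> supp y ->
    \sum_i x i ^+ 2 <= 1 -> \sum_j y j ^+ 2 <= 1 ->
    bil M x y <= 2 * b + S * 2^-1 ^+ K.
  elim: K => [|K IH] x y sx sy hx hy.
    have b0 : 0 <= b.
      have hz : \sum_(i < n) (0 : R) ^+ 2 <= 1 by rewrite big1 // => i _; rewrite expr0n.
      have [f [bf sf] [_ vf]] := lattice_round n0 hz.
      have := net f f bf bf (fun i _ => sf i erefl) (fun i _ => sf i erefl).
      by rewrite /bil big1 // => i _; rewrite big1 // => j _; rewrite vf // !mul0r.
    rewrite expr0 mulr1; apply: (@le_trans _ _ S); last by lra.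
    apply: ler_sum => i _; apply: ler_sum => j _.
    apply: le_trans (ler_norm _) _; rewrite !normrM ler_piMl //.
    by rewrite mulr_ile1 // sqr_sum_le1.
  have [f [bf zf] [rf vf]] := lattice_round n0 hx.
  have [g [bg zg] [rg vg]] := lattice_round n0 hy.
  pose u i := lat_vec R f i; pose v i := lat_vec R g i.
  pose r i := 4 * (x i - u i); pose q i := 4 * (y i - v i).
  have su : supp u by move=> i iW; rewrite /u vf // sx.
  have sv : supp v by move=> i iW; rewrite /v vg // sy.
  have sr : supp r by move=> i iW; rewrite /r su // sx // subrr mulr0.
  have sq : supp q by move=> i iW; rewrite /q sv // sy // subrr mulr0.
  have nr : \sum_i r i ^+ 2 <= 1.
    under eq_bigr do rewrite /r exprMn.
    rewrite -mulr_sumr; apply: (@le_trans _ _ (4 ^+ 2 * 16^-1)); last by lra.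
    by apply: ler_wpM2l => //; exact: sqr_ge0.
  have nq : \sum_i q i ^+ 2 <= 1.
    under eq_bigr do rewrite /q exprMn.
    rewrite -mulr_sumr; apply: (@le_trans _ _ (4 ^+ 2 * 16^-1)); last by lra.
    by apply: ler_wpM2l => //; exact: sqr_ge0.
  have xE : x = (fun i => u i + 4^-1 * r i) by apply/funext => i; rewrite /r; field.
  have yE : y = (fun i => v i + 4^-1 * q i) by apply/funext => i; rewrite /q; field.
  have h1 : bil M r y <= 2 * b + S * 2^-1 ^+ K by apply: IH.
  have h2 : bil M u q <= 2 * b + S * 2^-1 ^+ K.
    by apply: IH => //; apply: lat_vec_sqr.
  have h3 : bil M u v <= b.
    apply: net => // i iW; first by apply: zf; rewrite sx.
    by apply: zg; rewrite sy.
  rewrite xE bilDl bilZl {1}yE bilDr bilZr exprS; lra.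
have main x y : supp x -> supp y -> \sum_i x i ^+ 2 <= 1 -> \sum_j y j ^+ 2 <= 1 ->
    bil M x y <= 2 * b.
  move=> sx sy hx hy; rewrite leNgt; apply/negP => lt.
  pose e := bil M x y - 2 * b; have e0 : 0 < e by rewrite subr_gt0.
  pose K := (Num.truncn (S / e)).+1.
  have hK : S / e < K%:R by apply: truncnS_gt.
  have := step K x y sx sy hx hy; rewrite -lerBlDl -/e leNgt => /negP; apply.
  rewrite exprVn ltr_pdivrMr ?exprn_gt0 // mulrC -ltr_pdivrMr //.
  by apply: lt_le_trans hK _; rewrite -natrX ler_nat ltnW // ltn_expl.
move=> x y hx hy.
pose restr (x : 'I_n -> R) i := if i \in W then x i else 0.
have -> : bil M x y = bil M (restr x) (restr y).
  apply: eq_bigr => i _; apply: eq_bigr => j _; rewrite /restr.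
  case: ifP => iW; last by rewrite suppM ?mulr0 // iW.
  by case: ifP => jW //; rewrite suppM ?mulr0 // iW jW.
have nrestr z : \sum_i z i ^+ 2 <= 1 -> \sum_i restr z i ^+ 2 <= 1.
  apply: le_trans; apply: ler_sum => i _; rewrite /restr.
  by case: ifP => // _; rewrite expr0n sqr_ge0.
apply: main; rewrite ?nrestr //; by move=> i /negbTE iW; rewrite /restr iW.
Qed.

Section NormBound.
Variables (R : realType) (n : nat) (P : 'M[R]_n) (A : 'M[bool]_n) (alpha w K D : R).
Hypothesis adjA : is_adjacency A.
Hypothesis w_ge1 : 1 <= w.
Hypothesis n_gt0 : (0 < n)%N.
Hypothesis alpha_ge0 : 0 <= alpha.
Hypothesis P_ge0 : forall i j, 0 <= P i j.
Hypothesis Pbd : forall i j, P i j <= alpha * w ^+ 2 / n%:R.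
Hypothesis lightA : light_event P w K A.
Hypothesis discA : disc_event alpha w 8 A.
Hypothesis D_ge0 : 0 <= D.

(** Net vectors supported in [W] do not see the restriction, so the light event for the full matrix
    applies whatever [W] is. The 16 comes from the mesh: [|x_i y_j|] is [m i * m' j / (16 n)]. On
    heavy pairs [w / n < |x_i y_j|] turns the bound on [P i j] into [alpha * w * |x_i y_j|], and the
    squares sum to at most 1. *)
Lemma restricted_op_le (W : {set 'I_n}) :
  (forall i, i \in W -> \sum_(j in W) (A i j)%:R <= D * w ^+ 2) ->
  op_le (\matrix_(i, j) if (i \in W) && (j \in W) then (A i j)%:R - P i j else 0)
    (2 * ((K + (32 * D + 1024 * alpha + 448 * 100) / 16 + alpha) * w)).
Proof.
move=> degW; apply: (@bil_le_net _ _ _ W) => //.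
  by move=> i j /negbTE nW; rewrite mxE nW.
move=> f g bf bg sf sg.
have w0 : 0 < w := lt_le_trans ltr01 w_ge1.
have n0 : (0 : R) < n%:R by rewrite ltr0n.
set x := lat_vec R f; set y := lat_vec R g.
have x0 i : i \notin W -> x i = 0 by move=> iW; rewrite /x /lat_vec sf // mulr0 mul0r.
have y0 i : i \notin W -> y i = 0 by move=> iW; rewrite /y /lat_vec sg // mulr0 mul0r.
pose hv i j := ~~ light w x y i j.
have -> : bil (\matrix_(i, j) if (i \in W) && (j \in W) then (A i j)%:R - P i j else 0) x y =
   light_form P w x y A + \sum_i \sum_(j | hv i j) x i * y j * (A i j)%:R
   - \sum_i \sum_(j | hv i j) x i * y j * P i j.
  rewrite -addrA -sumrB -big_split /=; apply: eq_bigr => i _.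
  rewrite -sumrB (bigID (light w x y i)) /=; congr (_ + _); apply: eq_bigr => j _; rewrite mxE.
    case: ifP => // /negbT; rewrite negb_and => /orP[/x0 ->|/y0 ->];
    by rewrite ?mulr0 !mul0r.
  case: ifP => [_|/negbT]; first by rewrite mulrBr.
  by rewrite negb_and => /orP[/x0 ->|/y0 ->]; rewrite ?mulr0 !mul0r subrr.
have h1 : light_form P w x y A <= K * w.
  by have /forallP /(_ f) /forallP /(_ g) := lightA; rewrite bf bg.
pose m i : nat := (f i).2; pose m' i : nat := (g i).2.
have xm i : `|x i| = (m i)%:R / (4 * Num.sqrt n%:R).
  rewrite /x /lat_vec !normrM normrV ?normr_sign ?mul1r ?normr_nat; last first.
    by rewrite unitfE mulf_neq0 // lt0r_neq0 // sqrtr_gt0.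
  by rewrite [`|4 * _|]ger0_norm ?mulr_ge0 ?sqrtr_ge0.
have ym i : `|y i| = (m' i)%:R / (4 * Num.sqrt n%:R).
  rewrite /y /lat_vec !normrM normrV ?normr_sign ?mul1r ?normr_nat; last first.
    by rewrite unitfE mulf_neq0 // lt0r_neq0 // sqrtr_gt0.
  by rewrite [`|4 * _|]ger0_norm ?mulr_ge0 ?sqrtr_ge0.
have xym i j : `|x i * y j| = (m i * m' j)%:R / (16 * n%:R).
  have e : n%:R = Num.sqrt n%:R * Num.sqrt n%:R :> R by rewrite -expr2 sqr_sqrtr // ltW.
  rewrite normrM xm ym natrM [in RHS]e; field.
  by rewrite lt0r_neq0 // sqrtr_gt0.
have hvE i j : hv i j = (16 * w < (m i * m' j)%:R).
  rewrite /hv /light xym -ltNge ltr_pdivlMr ?mulr_gt0 //.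
  by have -> : w / n%:R * (16 * n%:R) = 16 * w by field; rewrite lt0r_neq0.
have h2 : \sum_i \sum_(j | hv i j) x i * y j * (A i j)%:R <=
    (32 * D + 1024 * alpha + 448 * 100) / 16 * w.
  apply: (@le_trans _ _ ((16 * n%:R)^-1 *
     \sum_i \sum_(j | 16 * w < (m i * m' j)%:R) (m i * m' j)%:R * (A i j)%:R)).
    rewrite mulr_sumr; apply: ler_sum => i _; rewrite mulr_sumr.
    rewrite (eq_bigl _ _ (hvE i)); apply: ler_sum => j _.
    rewrite mulrA ler_wpM2r // [leRHS]mulrC -xym.
    exact: ler_norm.
  have mW i : (0 < m i)%N -> i \in W by apply: contraLR => /sf; rewrite /m => ->.
  have m'W i : (0 < m' i)%N -> i \in W by apply: contraLR => /sg; rewrite /m' => ->.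
  have hh : \sum_i \sum_(j | 16 * w < (m i * m' j)%:R) (m i * m' j)%:R * (A i j)%:R <=
     (32 * D + 1024 * alpha + 448 * 100) * (n%:R * w).
    apply: heavy_sum_le => //.
    - move=> i /mW iW; apply: le_trans (degW i iW).
      rewrite big_mkcond [leRHS]big_mkcond /=; apply: ler_sum => j _.
      by case: ifP => [/m'W -> //|_]; case: ifP.
    - move=> j /m'W jW; apply: le_trans (degW j jW).
      rewrite big_mkcond [leRHS]big_mkcond /=; apply: ler_sum => i _.
      by rewrite (adjacency_sym i j adjA); case: ifP => [/mW -> //|_]; case: ifP.
  apply: le_trans (ler_wpM2l _ hh) _; first by rewrite invr_ge0 mulr_ge0 // ltW.
  by rewrite le_eqVlt; apply/orP; left; apply/eqP; field; rewrite lt0r_neq0.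
have h3 : - \sum_i \sum_(j | hv i j) x i * y j * P i j <= alpha * w.
  apply: (@le_trans _ _ (\sum_i \sum_j (alpha * w) * (x i ^+ 2 * y j ^+ 2))).
    rewrite -sumrN; apply: ler_sum => i _; rewrite -sumrN big_mkcond /=.
    apply: ler_sum => j _; case: ifP => [|_]; last first.
      by rewrite (mulr_ge0 (mulr_ge0 alpha_ge0 (ltW w0))) // mulr_ge0 // sqr_ge0.
    rewrite /hv /light -ltNge => hl.
    apply: le_trans (ler_norm _) _; rewrite normrN normrM (ger0_norm (P_ge0 _ _)).
    apply: le_trans (ler_wpM2l _ (Pbd i j)) _ => //.
    rewrite -exprMn -[(_ * y j) ^+ 2]real_normK ?num_real // expr2.
    set z := `|x i * y j| in hl *.
    have z0 : 0 <= z by rewrite /z.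
    have -> : z * (alpha * w ^+ 2 / n%:R) = alpha * w * (z * (w / n%:R)) by ring.
    apply: ler_wpM2l; first by rewrite mulr_ge0 // ltW.
    by apply: ler_wpM2l => //; apply: ltW.
  under eq_bigr do rewrite -mulr_sumr -mulr_sumr.
  rewrite -mulr_sumr -mulr_suml ler_piMr ?mulr_ge0 ?(ltW w0) //.
  by apply: mulr_ile1; rewrite ?lat_vec_sqr // sumr_ge0 // => i _; exact: sqr_ge0.
lra.
Qed.

(** Discrepancy of the heavy set [H] against all vertices, at the least admissible ratio, which lies
    between 4 and 8. If [|H| w^2 > n], then [ent R H <= |H| w^2] and the bound reads [tau |H| <= 8
    alpha w^2 |H| + 8 (|H| w^2 + n)]; the coefficient [8 * alpha + 9] leaves one copy of [|H| w^2]
    on the left. *)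
Lemma heavy_card_le (tau : R) :
  4 * w <= 2 ^+ (8 * n) -> (8 * alpha + 9) * w ^+ 2 <= tau ->
  #|[set i | tau < \sum_j (A i j)%:R]%SET|%:R <= 8 * n%:R / w ^+ 2.
Proof.
move=> wn htau; set H := [set i | _]%SET.
have w0 : 0 < w := lt_le_trans ltr01 w_ge1.
have n0 : (0 : R) < n%:R by rewrite ltr0n.
have w2 : 0 < w ^+ 2 by rewrite exprn_gt0.
rewrite ler_pdivlMr //.
have [->|H0] := eqVneq H finset.set0; first by rewrite cards0 mul0r mulr_ge0 // ltW.
have /andP[c1 cn] := set_card_ge1 R H0.
have [small|big] := lerP (#|H|%:R * w ^+ 2) n%:R; first by lra.
have ex : exists r, 4 * w <= 2 ^+ r by exists (8 * n)%N.
pose r := ex_minn ex.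
have [hr rn r8] : [/\ 4 * w <= 2 ^+ r, (r < 8 * n + 3)%N & 2 ^+ r <= 8 * w].
  rewrite /r; case: ex_minnP => s hs mins; split => //.
    by apply: leq_ltn_trans (mins _ wn) _; rewrite -[ltnLHS]addn0 ltn_add2l.
  case: s hs mins => [|s] hs mins; first by rewrite expr0; have := w_ge1; lra.
  have [|lt] := lerP (4 * w) (2 ^+ s); first by move/mins; rewrite ltnn.
  by rewrite exprS; lra.
have := edges_disc w_ge1 n_gt0 alpha_ge0 discA H finset.setT (r := Ordinal rn) hr.
rewrite /= => E.
have e1 : tau * #|H|%:R <= edges R A H finset.setT.
  rewrite mulrC mulr_natl -sumr_const; apply: ler_sum => i; rewrite inE => /ltW h.
  by apply: le_trans h _; rewrite [leRHS]big_mkcond; apply: ler_sum => j _; rewrite inE.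
have r4 : 4 <= 2 ^+ r / w by rewrite ler_pdivlMr.
have L1 := ln4_ge1 r4.
have entT : ent R (finset.setT : {set 'I_n}) = n%:R.
  by rewrite /ent cardsT card_ord divff ?lt0r_neq0 // ln1 addr0 mulr1.
have entH : ent R H <= #|H|%:R * w ^+ 2.
  rewrite /ent ler_wpM2l //.
  have q0 : 0 < n%:R / #|H|%:R :> R by rewrite divr_gt0 //; lra.
  have -> : ln (n%:R / #|H|%:R) = ln (1 + (n%:R / #|H|%:R - 1)) :> R by congr ln; ring.
  apply: le_trans (_ : 1 + (n%:R / #|H|%:R - 1) <= _).
    by rewrite lerD2l le_ln1Dx //; lra.
  have -> : 1 + (n%:R / #|H|%:R - 1) = n%:R / #|H|%:R :> R by ring.
  by rewrite ler_pdivrMr ?(mulrC (w ^+ 2)) ?ltW //; lra.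
rewrite entT cardsT card_ord in E.
have e2 : 2 ^+ r / w * (alpha * w ^+ 2 / n%:R * (#|H|%:R * n%:R)) <=
    8 * (alpha * w ^+ 2 * #|H|%:R).
  have -> : alpha * w ^+ 2 / n%:R * (#|H|%:R * n%:R) = alpha * w ^+ 2 * #|H|%:R.
    by field; rewrite lt0r_neq0.
  apply: ler_wpM2r; last by rewrite ler_pdivrMr.
  by rewrite (mulr_ge0 (mulr_ge0 alpha_ge0 (ltW w2))).
have e3 : 8 * (ent R H + n%:R) / ln (2 ^+ r / w) <= 8 * (#|H|%:R * w ^+ 2 + n%:R).
  rewrite ler_pdivrMr; last by lra.
  apply: le_trans (_ : 8 * (#|H|%:R * w ^+ 2 + n%:R) <= _); first by lra.
  rewrite ler_peMr // mulr_ge0 // addr_ge0 //.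
  by rewrite (mulr_ge0 _ (ltW w2)).
have e4 : (8 * alpha + 9) * w ^+ 2 * #|H|%:R <= tau * #|H|%:R by rewrite ler_wpM2r.
have e5 : 0 <= #|H|%:R * w ^+ 2 by rewrite (mulr_ge0 _ (ltW w2)).
lra.
Qed.

End NormBound.

(** * Frobenius error of the best rank [k] approximation *)

Lemma cauchy_schwarz (R : realType) (I : finType) (Q : pred I) (a b : I -> R) :
  (\sum_(i | Q i) a i * b i) ^+ 2 <= (\sum_(i | Q i) a i ^+ 2) * (\sum_(i | Q i) b i ^+ 2).
Proof.
have : 0 <= \sum_(i | Q i) \sum_(j | Q j) (a i * b j - a j * b i) ^+ 2.
  by apply: sumr_ge0 => i _; apply: sumr_ge0 => j _; exact: sqr_ge0.
have -> : \sum_(i | Q i) \sum_(j | Q j) (a i * b j - a j * b i) ^+ 2 =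
   (\sum_(i | Q i) a i ^+ 2) * (\sum_(i | Q i) b i ^+ 2) +
   (\sum_(i | Q i) b i ^+ 2) * (\sum_(i | Q i) a i ^+ 2)
   - 2 * ((\sum_(i | Q i) a i * b i) * (\sum_(i | Q i) a i * b i)).
  rewrite !big_distrlr /= mulr_sumr -sumrN -!big_split /=; apply: eq_bigr => i _.
  rewrite mulr_sumr -sumrN -!big_split /=; apply: eq_bigr => j _; ring.
rewrite expr2; lra.
Qed.

Definition frob2 (R : realType) (m n : nat) (M : 'M[R]_(m, n)) : R :=
  \sum_i \sum_j M i j ^+ 2.

Lemma frob2_ge0 (R : realType) m n (M : 'M[R]_(m, n)) : 0 <= frob2 M.
Proof. by apply: sumr_ge0 => i _; apply: sumr_ge0 => j _; exact: sqr_ge0. Qed.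

Lemma frobE (R : realType) m n (M : 'M[R]_(m, n)) : frob M ^+ 2 = frob2 M.
Proof. by rewrite sqr_sqrtr // frob2_ge0. Qed.

(** Column by column: for a column [v] of [Y] and [u = X v], the square [|u|^2] is the form at
    [(u, v)], hence at most [c |u| |v|]. *)
Lemma op_le_mulmx (R : realType) m n r (X : 'M[R]_(m, n)) (Y : 'M[R]_(n, r)) c :
  0 <= c -> op_le X c -> frob2 (X *m Y) <= c ^+ 2 * frob2 Y.
Proof.
move=> c0 hX; rewrite /frob2 exchange_big /= [in leRHS]exchange_big /= mulr_sumr.
apply: ler_sum => k _.
pose u i := (X *m Y) i k; pose v j := Y j k.
set t := (X in X <= _); set s := (X in c ^+ 2 * X).
have tE : t = bil X u v.
  apply: eq_bigr => i _; rewrite expr2 {2}mxE mulr_sumr; apply: eq_bigr => j _.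
  by rewrite /u /v; ring.
have t0 : 0 <= t by apply: sumr_ge0 => i _; exact: sqr_ge0.
have s0 : 0 <= s by apply: sumr_ge0 => i _; exact: sqr_ge0.
have [->|tn] := eqVneq t 0; first by rewrite mulr_ge0 // sqr_ge0.
have [s_0|sn] := eqVneq s 0.
  have v0 j : v j = 0.
    have /eqP := s_0; rewrite psumr_eq0 => [/allP /(_ j (mem_index_enum j))|i _]; last exact: sqr_ge0.
    by rewrite /= sqrf_eq0 => /eqP.
  by move: tn; rewrite tE /bil big1 ?eqxx // => i _; rewrite big1 // => j _; rewrite v0 mulr0 mul0r.
have tp : 0 < t by rewrite lt_neqAle eq_sym tn.
have sp : 0 < s by rewrite lt_neqAle eq_sym sn.
have ft : 0 < Num.sqrt t by rewrite sqrtr_gt0.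
have fs : 0 < Num.sqrt s by rewrite sqrtr_gt0.
have nu : \sum_i ((Num.sqrt t)^-1 * u i) ^+ 2 <= 1.
  under eq_bigr do rewrite exprMn.
  by rewrite -mulr_sumr exprVn sqr_sqrtr // (_ : \sum_i _ = t) // mulVf.
have nv : \sum_j ((Num.sqrt s)^-1 * v j) ^+ 2 <= 1.
  under eq_bigr do rewrite exprMn.
  by rewrite -mulr_sumr exprVn sqr_sqrtr // (_ : \sum_i _ = s) // mulVf.
have := hX _ _ nu nv; rewrite bilZl bilZr -tE => h.
have e : Num.sqrt t <= c * Num.sqrt s.
  rewrite -ler_pdivrMr //; apply: le_trans h; rewrite le_eqVlt; apply/orP; left; apply/eqP.
  have tt : t = Num.sqrt t * Num.sqrt t by rewrite -expr2 sqr_sqrtr.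
  by rewrite [X in _ * (_ * X)]tt; field; rewrite !lt0r_neq0.
rewrite -(sqr_sqrtr t0) -(sqr_sqrtr s0) -exprMn.
by apply: lerXn2r; rewrite ?nnegrE ?mulr_ge0 // sqrtr_ge0.
Qed.

Lemma tr_mul_sum (R : realType) m n (X Y : 'M[R]_(m, n)) :
  \tr (X *m Y^T) = \sum_i \sum_j X i j * Y i j.
Proof.
by apply: eq_bigr => i _; rewrite mxE; apply: eq_bigr => j _; rewrite mxE.
Qed.

(* The orthogonal projection [U] onto the row space of [D] has squared
   Frobenius norm [\tr U = \rank D], so no singular value decomposition is
   needed to bound the trace pairing by the operator norm. *)
Lemma inner_rank_le (R : realType) n (X D : 'M[R]_n) c :
  0 <= c -> op_le X c ->
  (\sum_i \sum_j X i j * D i j) ^+ 2 <= c ^+ 2 * (\rank D)%:R * frob2 D.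
Proof.
move=> c0 hX.
have [V [Vf DV]] : exists V : 'M[R]_(\rank D, n), row_free V /\ (D <= V)%MS.
  by exists (row_base D); rewrite row_base_free eq_row_base.
pose G := V *m V^T.
have Gu : G \in unitmx.
  rewrite -row_free_unit -kermx_eq0; apply/eqP/row_matrixP => i; rewrite row0.
  set x := row i _.
  have xG : x *m G = 0 by apply/sub_kermxP; exact: row_sub.
  have xV : x *m V = 0.
    have : \tr ((x *m V) *m (x *m V)^T) = 0.
      by rewrite trmx_mul mulmxA -(mulmxA x V V^T) xG mul0mx linear0.
    rewrite tr_mul_sum => /eqP; rewrite psumr_eq0 => [/allP h|? _]; last first.
      by apply: sumr_ge0 => j _; rewrite -expr2 sqr_ge0.
    apply/matrixP => a b; rewrite [RHS]mxE; have /= := h a (mem_index_enum a).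
    rewrite psumr_eq0 => [/allP /(_ b (mem_index_enum b)) /=|? _]; last by rewrite -expr2 sqr_ge0.
    by rewrite -expr2 sqrf_eq0 => /eqP.
  by apply: (row_free_inj Vf); rewrite /= mul0mx; exact: xV.
pose U := V^T *m invmx G *m V.
have UT : U^T = U.
  have GT : G^T = G by rewrite /G trmx_mul trmxK.
  by rewrite /U !trmx_mul trmxK trmx_inv GT mulmxA.
have UU : U *m U = U.
  rewrite /U -!mulmxA; congr (_ *m _); rewrite !mulmxA.
  by rewrite -(mulmxA (invmx G) V) mulVmx // mul1mx.
have trU : \tr U = (\rank D)%:R.
  rewrite /U -mulmxA mxtrace_mulC -mulmxA -/G mulVmx // mxtrace1 //.
have DU : D *m U = D.
  have /submxP[Y DE] := DV.
  rewrite [in LHS]DE /U -!mulmxA (mulmxA V) -/G (mulmxA G) mulmxV // mul1mx -DE //.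
have fU : frob2 U = (\rank D)%:R.
  rewrite -trU -[in RHS]UU -[X in _ *m X]UT tr_mul_sum.
  by apply: eq_bigr => i _; apply: eq_bigr => j _; rewrite expr2.
have -> : \sum_i \sum_j X i j * D i j = \sum_i \sum_j (X *m U) i j * D i j.
  by rewrite -!tr_mul_sum -[in LHS]DU trmx_mul UT mulmxA.
rewrite [X in X ^+ 2]pair_big /=.
apply: le_trans (cauchy_schwarz _ _ _) _.
have -> : \sum_(p : 'I_n * 'I_n) D p.1 p.2 ^+ 2 = frob2 D by rewrite /frob2 pair_big.
have -> : \sum_(p : 'I_n * 'I_n) (X *m U) p.1 p.2 ^+ 2 = frob2 (X *m U).
  by rewrite /frob2 pair_big.
by rewrite ler_wpM2r ?frob2_ge0 // -fU op_le_mulmx.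
Qed.

(** Optimality against [N] gives [|D|^2 <= 2 <X, D>] for [D = Q - N] and [X = M - N]. As [D] has
    rank at most [2 k], [inner_rank_le] bounds the pairing by [c sqrt (2 k) |D|]. *)
Lemma best_low_rank_close (R : realType) n k (M N Q : 'M[R]_n) c :
  0 <= c -> op_le (M - N) c -> (\rank N <= k)%N -> best_low_rank k M Q ->
  frob2 (Q - N) <= 8 * k%:R * c ^+ 2.
Proof.
move=> c0 hX rN [rQ minQ].
have := minQ N rN; rewrite !frobE => h.
pose X := M - N; pose D := Q - N.
have ip := inner_rank_le D c0 hX.
set s := \sum_i \sum_j _ in ip.
have key : frob2 (M - Q) = frob2 X - 2 * s + frob2 D.
  rewrite /s mulr_sumr -sumrB -big_split /=; apply: eq_bigr => i _.
  rewrite mulr_sumr -sumrB -big_split /=; apply: eq_bigr => j _.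
  by rewrite /X /D !mxE; ring.
have F0 := frob2_ge0 D.
have F2 : frob2 D <= 2 * s by rewrite key in h; rewrite -/X in h; lra.
have rD : (\rank D)%:R <= 2 * k%:R :> R.
  rewrite -natrM ler_nat; apply: leq_trans (mxrank_add _ _) _.
  by rewrite mxrank_opp mul2n -addnn leq_add.
have [->|Fn] := eqVneq (frob2 D) 0; first by rewrite !mulr_ge0 // sqr_ge0.
have Fp : 0 < frob2 D by rewrite lt_neqAle eq_sym Fn.
rewrite -/D -(ler_pM2r Fp).
apply: (@le_trans _ _ ((2 * s) ^+ 2)).
  by rewrite -expr2; apply: lerXn2r; rewrite ?nnegrE //; lra.
rewrite exprMn; apply: le_trans (ler_wpM2l (sqr_ge0 _) ip) _.
have -> : 8 * k%:R * c ^+ 2 * frob2 D = 2 ^+ 2 * (c ^+ 2 * (2 * k%:R) * frob2 D) by ring.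
apply: ler_wpM2l; first exact: sqr_ge0.
by apply: ler_wpM2r => //; apply: ler_wpM2l => //; exact: sqr_ge0.
Qed.

(** * Transfer to the vertex-deleted graphs *)

Lemma sum_lift (R : realType) (n : nat) (i0 : 'I_n) (F : 'I_n -> R) :
  \sum_(a < n.-1) F (lift i0 a) = \sum_(i < n | i != i0) F i.
Proof.
rewrite [RHS]big_mkcond [RHS](bigD1_ord i0) //= eqxx add0r; apply: eq_bigr => a _.
by rewrite eq_sym neq_lift.
Qed.

(** After extension by zero at [i0] the form splits into [A - P] restricted to the untrimmed set
    [W], the entries of [P] with a trimmed end, and the diagonal of [N]. Vertices trimmed in the
    minor also have large degree in [A], so there are at most [8 n / w^2] of them, and
    Cauchy-Schwarz bounds the second part by [6 alpha w]. *)
Lemma loo_op_le (R : realType) (n : nat) (P : 'M[R]_n) (A : 'M[bool]_n)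
    (alpha w K C1 c2 : R) (i0 : 'I_n) (N : 'M[R]_n.-1) :
  is_adjacency A -> 1 <= w -> (0 < n)%N -> 0 <= alpha ->
  (forall i j, 0 <= P i j) -> (forall i j, P i j <= alpha * w ^+ 2 / n%:R) ->
  (forall i, P i i = 0) ->
  light_event P w K A -> disc_event alpha w 8 A ->
  8 * alpha + 9 <= C1 -> 4 * w <= 2 ^+ (8 * n) ->
  (forall a b, a != b -> N a b = P (lift i0 a) (lift i0 b)) ->
  0 <= c2 -> (forall a, `|N a a| <= c2 * w) ->
  op_le (trim (C1 * (w ^+ 2 + 1)) (row' i0 (col' i0 A)) - N)
    ((2 * (K + (64 * C1 + 1024 * alpha + 448 * 100) / 16 + alpha) + 6 * alpha + c2) * w).
Proof.
move=> adjA w1 n_gt0 al0 P0 Pbd Pd lightA discA hC1 wn offN c20 diagN x y hx hy.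
have w0 : 0 < w := lt_le_trans ltr01 w1.
have n0 : (0 : R) < n%:R by rewrite ltr0n.
have C0 : 0 <= C1 by lra.
set tau := C1 * _.
pose deg i : R := \sum_(j | j != i0) (A i j)%:R.
pose W := [set i | (i != i0) && (deg i <= tau)]%SET.
pose H := [set i | tau < \sum_j (A i j)%:R]%SET.
have w2 : 1 <= w ^+ 2 by rewrite expr2; nra.
(* As [1 <= w], the trimming level [C1 (w^2 + 1)] is at most [2 C1 w^2]; hence [D = 2 C1] and the
   term [32 * D = 64 * C1]. *)
have degW i : i \in W -> \sum_(j in W) (A i j)%:R <= 2 * C1 * w ^+ 2.
  rewrite inE => /andP[_ h]; apply: le_trans (le_trans h _).
    rewrite /deg big_mkcond [leRHS]big_mkcond /=; apply: ler_sum => j _.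
    by rewrite inE; case: (j != i0) => //=; case: ifP.
  by rewrite /tau; have := ler_wpM2l C0 w2; lra.
have hM := restricted_op_le adjA w1 n_gt0 al0 P0 Pbd lightA discA (mulr_ge0 (ler0n R 2) C0) degW.
pose ext (z : 'I_n.-1 -> R) i := if unlift i0 i is Some a then z a else 0.
have extE z a : ext z (lift i0 a) = z a by rewrite /ext liftK.
have ext0 z : ext z i0 = 0 by rewrite /ext unlift_none.
have extsum z (F : R -> 'I_n -> R) : (forall i, F 0 i = 0) ->
    \sum_a F (z a) (lift i0 a) = \sum_i F (ext z i) i.
  move=> F0; rewrite (bigD1 i0) //= ext0 F0 add0r -sum_lift.
  by apply: eq_bigr => a _; rewrite extE.
have extn z : \sum_i ext z i ^+ 2 = \sum_a z a ^+ 2.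
  by rewrite (extsum z (fun t _ => t ^+ 2)) // => i; rewrite expr0n.
pose X := ext x; pose Y := ext y.
have hX : \sum_i X i ^+ 2 <= 1 by rewrite extn.
have hY : \sum_i Y i ^+ 2 <= 1 by rewrite extn.
pose bad i j := ~~ ((i \in W) && (j \in W)).
have trimE a b : trim tau (row' i0 (col' i0 A)) a b =
    if (lift i0 a \in W) && (lift i0 b \in W) then (A (lift i0 a) (lift i0 b))%:R else 0.
  have hvy c : (tau < \sum_b (row' i0 (col' i0 A) c b)%:R) = (lift i0 c \notin W).
    rewrite inE eq_sym neq_lift /= -ltNge /deg -sum_lift; congr (_ < _).
    by apply: eq_bigr => b' _; rewrite !mxE.
  by rewrite mxE !hvy -negb_and; case: (_ && _); rewrite //= !mxE.
have subE a b : (trim tau (row' i0 (col' i0 A)) - N) a b =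
    trim tau (row' i0 (col' i0 A)) a b - N a b by rewrite !mxE.
have -> : bil (trim tau (row' i0 (col' i0 A)) - N) x y =
   bil (\matrix_(i, j) if (i \in W) && (j \in W) then (A i j)%:R - P i j else 0) X Y
   - \sum_i \sum_(j | bad i j) X i * Y j * P i j - \sum_a x a * y a * N a a.
  transitivity (\sum_i \sum_j (X i * Y j * ((if (i \in W) && (j \in W) then (A i j)%:R else 0) - P i j))
     - \sum_a x a * y a * N a a).
    have -> : \sum_i \sum_j (X i * Y j * ((if (i \in W) && (j \in W) then (A i j)%:R else 0) - P i j)) =
      \sum_a \sum_b x a * y b * ((if (lift i0 a \in W) && (lift i0 b \in W)
         then (A (lift i0 a) (lift i0 b))%:R else 0) - P (lift i0 a) (lift i0 b)).
      rewrite -(extsum x (fun t i => \sum_j (t * Y j * ((if (i \in W) && (j \in W) then (A i j)%:R else 0) - P i j)))).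
        apply: eq_bigr => a _.
        rewrite -(extsum y (fun t j => x a * t * ((if (lift i0 a \in W) && (j \in W)
           then (A (lift i0 a) j)%:R else 0) - P (lift i0 a) j))) //.
        by move=> j; rewrite mulr0 mul0r.
      by move=> i; rewrite big1 // => j _; rewrite !mul0r.
    rewrite -sumrB; apply: eq_bigr => a _.
    rewrite [LHS](bigD1 a) //= [in RHS](bigD1 a) //= [in RHS]addrAC; congr (_ + _).
      by rewrite subE trimE Pd subr0 mulrBr.
    apply: eq_bigr => b ab; rewrite subE trimE offN //.
    by rewrite eq_sym.
  congr (_ - _); rewrite -sumrB; apply: eq_bigr => i _.
  rewrite [X in _ - X]big_mkcond -sumrB; apply: eq_bigr => j _; rewrite mxE /bad.
  by case: (_ && _) => /=; rewrite ?subr0 // mulr0 !sub0r mulrN.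
have h1 := hM X Y hX hY.
have h3 : - \sum_a x a * y a * N a a <= c2 * w.
  apply: (@le_trans _ _ (\sum_a (c2 * w) * ((x a ^+ 2 + y a ^+ 2) / 2))).
    rewrite -sumrN; apply: ler_sum => a _.
    apply: le_trans (ler_norm _) _; rewrite normrN normrM mulrC.
    apply: ler_pM => //; rewrite ler_norml; apply/andP; split; rewrite -subr_ge0.
      have -> : x a * y a - - ((x a ^+ 2 + y a ^+ 2) / 2) = (x a + y a) ^+ 2 / 2 by field.
      by rewrite divr_ge0 // sqr_ge0.
    have -> : (x a ^+ 2 + y a ^+ 2) / 2 - x a * y a = (x a - y a) ^+ 2 / 2 by field.
    by rewrite divr_ge0 // sqr_ge0.
  rewrite -mulr_sumr -mulr_suml big_split /=.
  by rewrite ler_piMr ?(mulr_ge0 c20 (ltW w0)) //; lra.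
have h2 : - \sum_i \sum_(j | bad i j) X i * Y j * P i j <= 6 * alpha * w.
  have cardH : #|H|%:R <= 8 * n%:R / w ^+ 2 :> R.
    apply: (heavy_card_le w1 n_gt0 al0 discA wn).
    by rewrite /tau; have := ler_wpM2r (sqr_ge0 w) hC1; lra.
  pose s (Z : 'I_n -> R) : R := \sum_i (i \in H)%:R * `|Z i|.
  pose t (Z : 'I_n -> R) : R := \sum_i `|Z i|.
  have s0 Z : 0 <= s Z by apply: sumr_ge0.
  have t0 Z : 0 <= t Z by apply: sumr_ge0.
  have st Z Z' : \sum_i Z i ^+ 2 <= 1 -> \sum_i Z' i ^+ 2 <= 1 -> s Z * t Z' <= 3 * n%:R / w.
    move=> hZ hZ'.
    have s2 : s Z ^+ 2 <= #|H|%:R.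
      apply: le_trans (cauchy_schwarz _ _ _) _.
      have -> : \sum_i (i \in H)%:R ^+ 2 = #|H|%:R :> R.
        rewrite -sum1_card natr_sum [RHS]big_mkcond; apply: eq_bigr => i _.
        by case: ifP => _; rewrite ?expr1n ?expr0n.
      rewrite -[leRHS]mulr1 ler_wpM2l //.
      by apply: le_trans hZ; apply: ler_sum => i _; rewrite real_normK ?num_real.
    have t2 : t Z' ^+ 2 <= n%:R.
      have := @cauchy_schwarz R _ predT (fun=> 1) (fun i => `|Z' i|).
      under eq_bigr do rewrite mul1r.
      move=> h; apply: le_trans h _.
      under eq_bigr do rewrite expr1n.
      rewrite sumr_const card_ord -[leRHS]mulr1 ler_wpM2l //.
      apply: le_trans hZ'; apply: ler_sum => i _.
      by rewrite real_normK ?num_real.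
    have wi : 0 <= w^-1 by rewrite invr_ge0 ltW.
    rewrite -ler_sqr ?nnegrE ?mulr_ge0 //.
    rewrite exprMn; apply: (@le_trans _ _ (8 * n%:R / w ^+ 2 * n%:R)).
      by apply: ler_pM; rewrite ?sqr_ge0 //; exact: le_trans s2 cardH.
    have -> : 8 * n%:R / w ^+ 2 * n%:R = 8 * (n%:R / w) ^+ 2 :> R by field; rewrite lt0r_neq0.
    have -> : (3 * n%:R / w) ^+ 2 = 9 * (n%:R / w) ^+ 2 :> R by ring.
    by apply: ler_wpM2r; rewrite ?sqr_ge0 // ler_nat.
  pose b := alpha * w ^+ 2 / n%:R.
  have b0 : 0 <= b by apply: divr_ge0 => //; rewrite mulr_ge0 // sqr_ge0.
  apply: (@le_trans _ _ (b * (s X * t Y + t X * s Y))); last first.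
    have -> : 6 * alpha * w = b * (2 * (3 * n%:R / w)).
      by rewrite /b; field; rewrite !lt0r_neq0.
    apply: ler_wpM2l => //; have := st X Y hX hY; have := st Y X hY hX.
    by rewrite [t X * _]mulrC; lra.
  rewrite /s /t !big_distrlr /= -big_split /= mulr_sumr -sumrN; apply: ler_sum => i _.
  rewrite -big_split /= mulr_sumr -sumrN big_mkcond /=; apply: ler_sum => j _.
  have inH k Z : k \notin W -> ext Z k != 0 -> k \in H.
    rewrite !inE negb_and negbK -ltNge => /orP[/eqP ->|]; first by rewrite ext0 eqxx.
    move=> h _; apply: lt_le_trans h _; rewrite /deg big_mkcond; apply: ler_sum => l _.
    by case: ifP.
  have rhs0 (z z' : R) : 0 <= z -> 0 <= z' -> 0 <= b * (z + z').
    by move=> ? ?; rewrite mulr_ge0 // addr_ge0.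
  have n0XY : 0 <= `|X i| * `|Y j| by rewrite mulr_ge0.
  have rhs1 : 0 <= b * ((i \in H)%:R * `|X i| * `|Y j| + `|X i| * ((j \in H)%:R * `|Y j|)).
    by apply: rhs0; rewrite !mulr_ge0.
  case: ifP => [|_]; last by [].
  rewrite /bad negb_and => hbad.
  apply: le_trans (ler_norm _) _; rewrite normrN !normrM (ger0_norm (P0 _ _)) mulrC.
  have [X0|Xn] := eqVneq (X i) 0; first by apply: le_trans rhs1; rewrite X0 normr0 mul0r mulr0.
  have [Y0|Yn] := eqVneq (Y j) 0; first by apply: le_trans rhs1; rewrite Y0 normr0 !mulr0.
  apply: ler_pM => //.
  case/orP: hbad => [iW|jW].
    by rewrite (inH i x iW Xn) mul1r lerDl !mulr_ge0.
  by rewrite (inH j y jW Yn) mul1r lerDr !mulr_ge0.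
lra.
Qed.

(** * Clustering of the rows *)

Section L1norm.
Variables (R : realType) (m : nat).
Implicit Types v w : 'rV[R]_m.

Lemma l1norm_ge0 v : 0 <= l1norm v.
Proof. exact: sumr_ge0. Qed.

Lemma l1normD v w : l1norm (v + w) <= l1norm v + l1norm w.
Proof.
by rewrite /l1norm -big_split; apply: ler_sum => j _; rewrite mxE ler_normD.
Qed.

Lemma l1normZ (c : R) v : l1norm (c *: v) = `|c| * l1norm v.
Proof. by rewrite /l1norm mulr_sumr; apply: eq_bigr => j _; rewrite mxE normrM. Qed.

Lemma l1normB v w : l1norm (v - w) = l1norm (w - v).
Proof. by rewrite -opprB -scaleN1r l1normZ normrN1 mul1r. Qed.

Lemma l1norm_dist v w : `|l1norm v - l1norm w| <= l1norm (v - w).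
Proof.
have h (x y : 'rV[R]_m) : l1norm x - l1norm y <= l1norm (x - y).
  by rewrite lerBlDr -[in leLHS](subrK y x) l1normD.
rewrite ler_norml h andbT lerNl opprB l1normB; exact: h.
Qed.

End L1norm.

(** Here [nu u] is the true direction of community [u] and [c j] the true norm of row [j]. The true
    labels cost at most [2 E], so the computed centres are within total weighted distance
    [(4 + 2 eps) E + xi] of the true directions, and vertices whose directions are closer than
    [b / 2] to a common centre share their community. The slack [xi] is needed because each infimum
    in the cost is only approached. *)
Lemma kmedian_bad (R : realType) (m k : nat) (Q N : 'M[R]_m) (z : 'I_m -> 'I_k)
    (z0 : 'I_m -> option 'I_k) (nu : 'I_k -> 'rV[R]_m) (c : 'I_m -> R) (eps b xi E : R) :
  0 <= eps -> 0 < b -> 0 < xi -> (0 < k)%N ->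
  (forall u, l1norm (nu u) = 1) -> (forall j, 0 <= c j) ->
  (forall j, row j N = c j *: nu (z j)) ->
  (forall u v, u != v -> b <= l1norm (nu u - nu v)) ->
  \sum_j l1norm (row j Q - row j N) <= E ->
  (forall j, (z0 j == None) = (l1norm (row j Q) == 0)) ->
  kmedian_cost Q z0 <= (1 + eps) * kmedian_cost Q (fun i => Some (z i)) ->
  exists2 bad : {set 'I_m},
    \sum_(j in bad) c j <= E + 2 / b * ((4 + 2 * eps) * E + xi) &
    (forall j, j \notin bad -> z0 j != None) /\
    (forall i j, i \notin bad -> j \notin bad -> z0 i = z0 j -> z i = z j).
Proof.
move=> eps0 b0 xi0 k0 nu1 c0 Nrow sep EQ S0 cost.
pose q j := l1norm (row j Q).
pose d (j : 'I_m) (v : 'rV[R]_m) := q j * l1norm ((q j)^-1 *: row j Q - v).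
have q0 j : 0 <= q j := l1norm_ge0 _.
have d0 j v : 0 <= d j v by rewrite mulr_ge0 // l1norm_ge0.
have nN j : l1norm (row j N) = c j by rewrite Nrow l1normZ nu1 mulr1 ger0_norm.
have dtrue j : q j != 0 -> d j (nu (z j)) <= 2 * l1norm (row j Q - row j N).
  move=> qn; rewrite /d -{1}[q j]ger0_norm // -l1normZ scalerBr scalerA divff // scale1r.
  have -> : row j Q - q j *: nu (z j) = (row j Q - row j N) + (c j - q j) *: nu (z j).
    by rewrite scalerBl -Nrow addrA subrK.
  apply: le_trans (l1normD _ _) _; rewrite l1normZ nu1 mulr1 -nN mulr_natl mulr2n lerD2l.
  by rewrite l1normB l1norm_dist.
pose S (y : 'I_m -> option 'I_k) u v := \sum_(j < m | (q j != 0) && (y j == Some u)) d j v.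
have S_ge0 y u v : 0 <= S y u v by apply: sumr_ge0.
have lb y u : has_lbound [set S y u v | v in [set: 'rV[R]_m]].
  by exists 0 => _ [v _ <-].
have hinf y u : has_inf [set S y u v | v in [set: 'rV[R]_m]].
  by split => //; exists (S y u 0), 0.
have costE y : kmedian_cost Q y = \sum_u inf [set S y u v | v in [set: 'rV[R]_m]] by [].
have ctrue : kmedian_cost Q (fun i => Some (z i)) <= 2 * E.
  rewrite costE; apply: (@le_trans _ _ (\sum_u S (fun i => Some (z i)) u (nu u))).
    by apply: ler_sum => u _; apply: ge_inf => //; exists (nu u).
  apply: (@le_trans _ _ (\sum_(j | q j != 0) d j (nu (z j)))).
    rewrite [leRHS](partition_big z predT) //=; apply: ler_sum => u _.
    by apply: ler_sum => j /andP[_ /eqP[->]].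
  apply: (@le_trans _ _ (\sum_j 2 * l1norm (row j Q - row j N))).
    rewrite big_mkcond; apply: ler_sum => j _; case: ifP => [/dtrue //|_].
    by rewrite mulr_ge0 // l1norm_ge0.
  by rewrite -mulr_sumr ler_wpM2l.
have k0' : (0 : R) < k%:R by rewrite ltr0n.
have exv u : exists v, S z0 u v < inf [set S z0 u v | v in [set: 'rV[R]_m]] + xi / k%:R.
  have [_ [v _ <-] lt] := inf_adherent (divr_gt0 xi0 k0') (hinf z0 u).
  by exists v.
pose v u := projT1 (cid (exv u)).
have vP u : S z0 u (v u) < inf [set S z0 u v | v in [set: 'rV[R]_m]] + xi / k%:R.
  exact: projT2 (cid (exv u)).
pose cen j : 'rV[R]_m := if z0 j is Some u then v u else 0.
have E0 : 0 <= E by apply: le_trans EQ; apply: sumr_ge0 => j _; exact: l1norm_ge0.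
have c1 : \sum_(j | q j != 0) d j (cen j) <= 2 * (1 + eps) * E + xi.
  apply: (@le_trans _ _ (\sum_u S z0 u (v u))).
    rewrite (partition_big (fun j => odflt (Ordinal k0) (z0 j)) predT) //=.
    apply: ler_sum => u _; rewrite /S big_mkcond [leRHS]big_mkcond /=.
    apply: ler_sum => j _; case: ifP => [/andP[qn zj]|_]; last by case: ifP.
    move: zj; have := S0 j; rewrite -/(q j) (negbTE qn) /cen.
    by case: (z0 j) => //= w _ /eqP ->; rewrite ?qn ?eqxx.
  apply: (@le_trans _ _ (\sum_(u < k) (inf [set S z0 u v | v in [set: 'rV[R]_m]] + xi / k%:R))).
    by apply: ler_sum => u _; exact: ltW.
  rewrite big_split /= -costE sumr_const card_ord -[_ *+ k]mulr_natr divfK ?lt0r_neq0 // lerD2r.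
  apply: le_trans cost _; rewrite [2 * _]mulrC -mulrA; apply: ler_wpM2l => //; lra.
have c2 : \sum_(j | q j != 0) q j * l1norm (nu (z j) - cen j) <= (4 + 2 * eps) * E + xi.
  apply: (@le_trans _ _ (\sum_(j | q j != 0) (2 * l1norm (row j Q - row j N) + d j (cen j)))).
    apply: ler_sum => j qn; apply: le_trans (_ : d j (nu (z j)) + d j (cen j) <= _); last first.
      by rewrite lerD2r dtrue.
    rewrite /d -mulrDr ler_wpM2l //.
    rewrite [X in _ <= X + _]l1normB.
    have {1}-> : nu (z j) - cen j = (nu (z j) - (q j)^-1 *: row j Q) + ((q j)^-1 *: row j Q - cen j).
      by rewrite addrA subrK.
    exact: l1normD.
  rewrite big_split /=.
  have h : \sum_(j | q j != 0) 2 * l1norm (row j Q - row j N) <= 2 * E.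
    rewrite -mulr_sumr ler_wpM2l //; apply: le_trans EQ; rewrite big_mkcond.
    by apply: ler_sum => j _; case: ifP => // _; exact: l1norm_ge0.
  lra.
pose bad := [set j | (q j == 0) || (b / 2 <= l1norm (nu (z j) - cen j))]%SET.
exists bad.
  apply: (@le_trans _ _ (\sum_(j in bad) (l1norm (row j Q - row j N) + q j))).
    apply: ler_sum => j _; rewrite -nN -[X in X <= _](subrK (q j)) lerD2r.
    by apply: le_trans (ler_norm _) _; rewrite l1normB l1norm_dist.
  rewrite big_split /=; apply: lerD.
    apply: le_trans EQ; rewrite big_mkcond; apply: ler_sum => j _.
    by case: ifP => // _; exact: l1norm_ge0.
  rewrite -invf_div ler_pdivlMl ?divr_gt0 //; apply: le_trans c2.
  rewrite mulr_sumr big_mkcond [leRHS]big_mkcond; apply: ler_sum => j _ /=.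
  rewrite inE; case: eqVneq => [->|qn] /=; first by rewrite mulr0.
  by case: ifP => [h|_]; [rewrite mulrC ler_wpM2l|rewrite mulr_ge0 // l1norm_ge0].
split => [j|i j]; first by rewrite inE negb_or => /andP[qn _]; rewrite S0.
rewrite !inE !negb_or -!ltNge => /andP[_ hi] /andP[_ hj] zij.
apply/eqP/negPn/negP => /sep; rewrite leNgt => /negP; apply.
have -> : nu (z i) - nu (z j) = (nu (z i) - cen i) + (cen j - nu (z j)).
  by rewrite {2}/cen -zij -/(cen i) addrA subrK.
apply: le_lt_trans (l1normD _ _) _; rewrite [X in _ + X]l1normB; lra.
Qed.

(** One good representative per community defines an injection of the [k] labels into themselves,
    hence a permutation. *)
Lemma relabel_perm (m k : nat) (z : 'I_m -> 'I_k) (z0 : 'I_m -> option 'I_k)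
    (bad : {set 'I_m}) :
  (forall j, j \notin bad -> z0 j != None) ->
  (forall i j, i \notin bad -> j \notin bad -> z0 i = z0 j -> z i = z j) ->
  (forall u, exists2 j, j \notin bad & z j = u) ->
  exists s : 'S_k, forall j, j \notin bad -> z0 j = Some (s (z j)).
Proof.
move=> nN inj surj.
pose r u := projT1 (cid2 (surj u)).
have rbad u : r u \notin bad by rewrite /r; case: cid2.
have rz u : z (r u) = u by rewrite /r; case: cid2.
pose s u := odflt u (z0 (r u)).
have sE u : z0 (r u) = Some (s u).
  by rewrite /s; have := nN _ (rbad u); case: (z0 (r u)).
have s_inj : injective s.
  by move=> u v e; rewrite -(rz u) -(rz v); apply: inj => //; rewrite !sE e.
exists (perm s_inj) => j jb; have := nN j jb; case e: (z0 j) => [l|//] _.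
have ll : l = perm s_inj ((perm s_inj)^-1%g l) by rewrite permKV.
set u := (perm s_inj)^-1%g l in ll.
by rewrite (inj j (r u) jb (rbad u)) ?rz -?ll // e sE ll permE.
Qed.

Lemma l1norm_sum_le (R : realType) (m : nat) (Q N : 'M[R]_m) (F : R) :
  0 <= F -> frob2 (Q - N) <= F ^+ 2 ->
  \sum_j l1norm (row j Q - row j N) <= m%:R * F.
Proof.
move=> F0 hF.
have -> : \sum_j l1norm (row j Q - row j N) =
    \sum_(u : 'I_m * 'I_m) 1 * `|(Q - N) u.1 u.2|.
  rewrite -(pair_big predT predT (fun i j => 1 * `|(Q - N) i j|)) /=.
  by apply: eq_bigr => i _; apply: eq_bigr => j _; rewrite mul1r !mxE.
rewrite -ler_sqr ?nnegrE ?mulr_ge0 //; last by apply: sumr_ge0 => u _; rewrite mul1r.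
apply: le_trans (cauchy_schwarz _ _ _) _; rewrite exprMn; apply: ler_pM.
- by apply: sumr_ge0 => u _; exact: sqr_ge0.
- by apply: sumr_ge0 => u _; exact: sqr_ge0.
- under eq_bigr do rewrite expr1n.
  by rewrite sumr_const card_prod card_ord natrM expr2.
- apply: le_trans hF; rewrite /frob2 pair_big /=.
  by apply: ler_sum => u _; rewrite real_normK ?num_real.
Qed.

(** Within a community the mean rows differ only by a scalar, which normalisation removes. Row [j]
    has norm at least [theta j * (p * M0)], so the bad weight of [kmedian_bad] controls bad
    [theta]-mass, and [G < M0] keeps any community from being wholly bad. The 11 comes from taking
    [xi = E] and from [b + 2 (5 + 2 eps) <= 11 (1 + eps)], as [b <= 1]. *)
Lemma spectral_cluster (R : realType) (m k : nat) (theta : 'I_m -> R) (z : 'I_m -> 'I_k)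
    (B : 'M[R]_k) (p q alpha M0 Mtot eps F : R) (Q : 'M[R]_m) (z0 : 'I_m -> option 'I_k) :
  1 <= alpha -> 0 < q -> q < p -> 0 <= eps -> 0 < F -> 0 < M0 -> (0 < k)%N ->
  (forall j, 0 <= theta j) ->
  (forall u, M0 <= \sum_(j | z j == u) theta j) -> \sum_j theta j <= Mtot ->
  (forall u v, 0 <= B u v <= alpha * p) -> (forall u, p <= B u u) ->
  (forall u v, u != v -> B u v <= q) ->
  frob2 (Q - \matrix_(i, j) (theta i * theta j * B (z i) (z j))) <= F ^+ 2 ->
  (forall j, (z0 j == None) = (l1norm (row j Q) == 0)) ->
  kmedian_cost Q z0 <= (1 + eps) * kmedian_cost Q (fun i => Some (z i)) ->
  let G := m%:R * F * (11 * (1 + eps)) / (M0 * (p - q) / (alpha * p * Mtot)) / (p * M0) in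
  G < M0 ->
  exists s : 'S_k, \sum_(j | z0 j != Some (s (z j))) theta j <= G.
Proof.
move=> al1 q0 qp eps0 F0 M0_gt0 k0 th0 mass tot Bbd Bdiag Boff hF hS0 hcost G GM.
set N := \matrix_(i, j) _ in hF.
have p0 : 0 < p by lra.
pose Z u := \sum_l theta l * B u (z l).
pose u0 := Ordinal k0.
have massle : M0 <= Mtot.
  apply: le_trans (mass u0) (le_trans _ tot); rewrite big_mkcond.
  by apply: ler_sum => j _; case: ifP.
have Mtot0 : 0 < Mtot by apply: lt_le_trans massle.
have Zlow u : p * M0 <= Z u.
  apply: (@le_trans _ _ (\sum_(l | z l == u) theta l * B u (z l))); last first.
    rewrite big_mkcond; apply: ler_sum => l _; case: ifP => // _.
    by rewrite mulr_ge0 //; case/andP: (Bbd u (z l)).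
  apply: (@le_trans _ _ (\sum_(l | z l == u) p * theta l)).
    by rewrite -mulr_sumr ler_wpM2l // ltW.
  by apply: ler_sum => l /eqP ->; rewrite mulrC ler_wpM2l.
have pM0 : 0 < p * M0 by rewrite mulr_gt0.
have Z0 u : 0 < Z u by apply: lt_le_trans (Zlow u).
have Zup u : Z u <= alpha * p * Mtot.
  apply: (@le_trans _ _ (\sum_l alpha * p * theta l)).
    apply: ler_sum => l _; rewrite mulrC ler_wpM2r //.
    by case/andP: (Bbd u (z l)).
  by rewrite -mulr_sumr ler_wpM2l // mulr_ge0 //; lra.
pose nu u : 'rV[R]_m := \row_l (theta l * B u (z l) / Z u).
have nu1 u : l1norm (nu u) = 1.
  transitivity (\sum_l theta l * B u (z l) / Z u).
    apply: eq_bigr => l _; rewrite mxE ger0_norm // divr_ge0 ?(ltW (Z0 u)) // mulr_ge0 //.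
    by case/andP: (Bbd u (z l)).
  by rewrite -mulr_suml -/(Z u) divff // lt0r_neq0.
pose c j := theta j * Z (z j).
have c0 j : 0 <= c j by rewrite mulr_ge0 // ltW.
have Nrow j : row j N = c j *: nu (z j).
  apply/rowP => l; rewrite !mxE /c; field.
  by rewrite lt0r_neq0.
pose b := M0 * (p - q) / (alpha * p * Mtot).
have apM : 0 < alpha * p * Mtot by rewrite !mulr_gt0 //; lra.
have b0 : 0 < b by rewrite divr_gt0 // mulr_gt0 // subr_gt0.
have b1 : b <= 1.
  rewrite ler_pdivrMr // mul1r mulrC; apply: ler_pM; [lra|lra| |exact: massle].
  by nra.
(* Only the block of the community with the smaller normaliser [Z] is inspected: there
   [B u v / Z u <= B u v / Z v], so unequal normalisers cannot hide the gap [p - q]. *)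
have sep1 u v : u != v -> Z v <= Z u -> b <= l1norm (nu u - nu v).
  move=> uv Zvu.
  apply: (@le_trans _ _ (\sum_(l | z l == v) theta l * ((p - q) / Z v))).
    rewrite -mulr_suml /b -mulrA; apply: ler_pM => //; first exact: ltW.
      by rewrite divr_ge0 ?(ltW apM) // subr_ge0 ltW.
    by rewrite ler_wpM2l ?subr_ge0 ?(ltW qp) // lef_pV2 ?posrE.
  rewrite /l1norm big_mkcond; apply: ler_sum => l _; case: ifP => // /eqP zl.
  rewrite !mxE zl.
  have -> : theta l * B u v / Z u - theta l * B v v / Z v =
     - (theta l * (B v v / Z v - B u v / Z u)) by ring.
  rewrite normrN; apply: le_trans (ler_norm _); rewrite ler_wpM2l //.
  have /andP[Buv0 _] := Bbd u v.
  have h : B u v / Z u <= B u v / Z v by rewrite ler_wpM2l // lef_pV2 ?posrE.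
  apply: (@le_trans _ _ ((B v v - B u v) / Z v)); last by rewrite mulrBl; lra.
  rewrite ler_wpM2r ?invr_ge0 ?(ltW (Z0 v)) //.
  by have := Bdiag v; have := Boff _ _ uv; lra.
have sep u v : u != v -> b <= l1norm (nu u - nu v).
  move=> uv; have [h|/ltW h] := lerP (Z v) (Z u); first exact: sep1.
  by rewrite l1normB sep1 // eq_sym.
have m0 : (0 < m)%N.
  rewrite lt0n; apply/negP => /eqP m0; have := mass u0.
  rewrite big1 ?leNgt ?M0_gt0 // => j _; exfalso.
  by have := leq_ltn_trans (leq0n j) (ltn_ord j); rewrite m0.
pose E := m%:R * F.
have E0 : 0 < E by rewrite mulr_gt0 // ltr0n.
have [bad hbad [nN inj]] := kmedian_bad eps0 b0 E0 k0 nu1 c0 Nrow sep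
   (l1norm_sum_le (ltW F0) hF) hS0 hcost.
have badG : \sum_(j in bad) theta j <= G.
  rewrite /G ler_pdivlMr //.
  apply: (@le_trans _ _ (\sum_(j in bad) c j)).
    by rewrite mulr_suml; apply: ler_sum => j _; rewrite ler_wpM2l.
  apply: le_trans hbad _; rewrite -/E -/b ler_pdivlMr //.
  have -> : (E + 2 / b * ((4 + 2 * eps) * E + E)) * b =
     E * (b + 2 * (5 + 2 * eps)) by field; rewrite lt0r_neq0.
  by rewrite ler_wpM2l ?(ltW E0) //; lra.
have surj u : exists2 j, j \notin bad & z j = u.
  apply: contrapT => nex.
  have : \sum_(j | z j == u) theta j <= \sum_(j in bad) theta j.
    rewrite big_mkcond [leRHS]big_mkcond; apply: ler_sum => j _.
    case: ifP => [/eqP zj|_]; last by case: ifP.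
    case: (boolP (j \in bad)) => // jb; exfalso; apply: nex; by exists j.
  by have := mass u; lra.
have [s hs] := relabel_perm nN inj surj.
exists s; apply: le_trans badG; rewrite big_mkcond [leRHS]big_mkcond.
apply: ler_sum => j _; case: ifP => [zj|_]; last by case: ifP.
by case: (boolP (j \in bad)) => // /hs h; rewrite h eqxx in zj.
Qed.

(** * Chernoff exponent *)

(* With [sp], [sq] the square roots of [p], [q] and [t = ln (sp / sq)], the
   unperturbed exponent [q (e^t - 1) - p (1 - e^-t)] equals [- (sp - sq)^2];
   relative errors of order [rho] in the edge masses and in the cluster sizes
   only cost [rho * sp * (sp - sq)], which is a small multiple of
   [(sp - sq)^2] because [rho] is small compared with [(p - q) / p]. *)
Lemma chernoff_bracket (R : realType) (sp sq alpha Y x eta rho T PD PC sD sC : R) :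
  0 < sq -> sq < sp -> sp <= Y * sq -> 1 <= alpha -> 0 <= rho ->
  rho <= x * ((sp ^+ 2 - sq ^+ 2) / sp ^+ 2) -> x <= 6^-1 -> 6 * x * Y <= 1 ->
  2 * x * (31 + 16 * alpha * Y) <= eta -> 0 <= x ->
  0 <= T -> 0 <= PD -> PD <= T * (sq ^+ 2 + 4 * alpha * sp ^+ 2 * rho) ->
  T * (sp ^+ 2 * (1 - 4 * rho)) <= PC ->
  sD <= 1 + 6 * rho -> 1 - 3 * rho <= sC ->
  PD * (expR (ln (sp / sq) * sD) - 1) - PC * (1 - expR (- (ln (sp / sq) * sC)))
    <= - ((1 - eta) * (T * (sp - sq) ^+ 2)).
Proof.
move=> sq0 sqp hY al1 r0 hr x6 xY hx x0 T0 PD0 hPD hPC hsD hsC.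
have sp0 : 0 < sp by lra.
have [spn sqn] := (lt0r_neq0 sp0, lt0r_neq0 sq0).
pose y := sp / sq; set t := ln (sp / sq).
have y1 : 1 < y by rewrite /y ltr_pdivlMr // mul1r.
have y0 : 0 < y by lra.
have yY : y <= Y by rewrite /y ler_pdivrMr.
have ety : expR t = y by rewrite /t lnK // posrE.
have t0 : 0 <= t by rewrite ln_ge0 // ltW.
have ty : t <= y - 1.
  have -> : t = ln (1 + (y - 1)) by congr ln; rewrite -/y; ring.
  by apply: le_ln1Dx; lra.
have dd : (sp ^+ 2 - sq ^+ 2) / sp ^+ 2 <= 1.
  by rewrite ler_pdivrMr ?exprn_gt0 // mul1r lerBlDr lerDl sqr_ge0.
have rx : rho <= x by apply: le_trans hr _; rewrite -[leRHS]mulr1 ler_wpM2l.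
have ry : 6 * rho * y <= 1.
  apply: le_trans xY; apply: ler_pM => //; first by rewrite mulr_ge0.
    by lra.
  by rewrite ler_wpM2l.
have rt : 6 * rho * t <= 1.
  by apply: le_trans ry; rewrite ler_wpM2l ?mulr_ge0 //; lra.
have rt0 : 0 <= rho * t by rewrite mulr_ge0.
have yt0 : 0 <= rho * (y - 1 - t) by rewrite mulr_ge0 //; lra.
have eD : expR (t * sD) - 1 <= (y - 1) * (1 + 18 * rho * y).
  have h1 : expR (t * sD) <= y * expR (6 * rho * t).
    rewrite -ety -expRD ler_expR.
    by apply: le_trans (ler_wpM2l t0 hsD) _; lra.
  have h2 := expR_le_quad rt.
  have h3 : 0 <= 6 * rho * t * (1 - 6 * rho * t) by rewrite mulr_ge0 //; lra.
  have h4 : expR (6 * rho * t) <= 1 + 18 * (rho * t) by nra.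
  have h5 := ler_wpM2l (ltW y0) h4.
  have h6 : 0 <= y * (rho * (y - 1 - t)) by rewrite mulr_ge0 // ltW.
  lra.
have eD0 : 0 <= (y - 1) * (1 + 18 * rho * y).
  have ry0 : 0 <= rho * y by rewrite mulr_ge0 // ltW.
  by apply: mulr_ge0; lra.
have eC : (1 - y^-1) * (1 - 9 * rho) <= 1 - expR (- (t * sC)).
  have h1 : expR (- (t * sC)) <= y^-1 * expR (3 * rho * t).
    rewrite -ety -expRN -expRD ler_expR.
    by have := ler_wpM2l t0 hsC; lra.
  have h2 : expR (3 * rho * t) <= 1 + 9 * (rho * t).
    have rt3 : 3 * rho * t <= 1 by lra.
    have := expR_le_quad rt3.
    have h3 : 0 <= 3 * rho * t * (1 - 3 * rho * t) by rewrite mulr_ge0 //; lra.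
    by nra.
  have yi : 0 <= y^-1 by rewrite invr_ge0 ltW.
  have h3 : expR (3 * rho * t) <= 1 + 9 * (rho * (y - 1)) by lra.
  have h4 := ler_wpM2l yi h3.
  have h5 : y^-1 * (1 + 9 * (rho * (y - 1))) = y^-1 + 9 * rho * (1 - y^-1).
    by field; rewrite lt0r_neq0.
  by rewrite h5 in h4; lra.
have C0 : 0 <= 1 - expR (- (t * sC)).
  by rewrite subr_ge0 -[leRHS]expR0 ler_expR lerNl oppr0 mulr_ge0 //; lra.
have hD : PD * (expR (t * sD) - 1) <=
   T * (sq ^+ 2 + 4 * alpha * sp ^+ 2 * rho) * ((y - 1) * (1 + 18 * rho * y)).
  apply: le_trans (ler_wpM2l PD0 eD) _; exact: ler_wpM2r.
have r4 : 0 <= 1 - 4 * rho by lra.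
have hC : T * (sp ^+ 2 * (1 - 4 * rho)) * ((1 - y^-1) * (1 - 9 * rho)) <=
    PC * (1 - expR (- (t * sC))).
  apply: (@le_trans _ _ (T * (sp ^+ 2 * (1 - 4 * rho)) * (1 - expR (- (t * sC))))).
    by apply: ler_wpM2l => //; exact: mulr_ge0 T0 (mulr_ge0 (sqr_ge0 _) r4).
  by apply: ler_wpM2r.
set D := sp - sq; have D0 : 0 < D by rewrite subr_gt0.
have key : (sq ^+ 2 + 4 * alpha * sp ^+ 2 * rho) * ((y - 1) * (1 + 18 * rho * y))
    - sp ^+ 2 * (1 - 4 * rho) * ((1 - y^-1) * (1 - 9 * rho)) <= - ((1 - eta) * D ^+ 2).
  have -> : (sq ^+ 2 + 4 * alpha * sp ^+ 2 * rho) * ((y - 1) * (1 + 18 * rho * y))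
    - sp ^+ 2 * (1 - 4 * rho) * ((1 - y^-1) * (1 - 9 * rho)) =
    - D ^+ 2 + sp * D * (rho * (18 + 4 * alpha * y * (1 + 18 * rho * y) + 13 - 36 * rho)).
    by rewrite /D /y; field; rewrite ?spn ?sqn.
  have L0 : 0 <= 31 + 16 * alpha * Y by nra.
  have b1 : 18 + 4 * alpha * y * (1 + 18 * rho * y) + 13 - 36 * rho <= 31 + 16 * alpha * Y.
    have : alpha * y * (1 + 18 * rho * y) <= alpha * Y * 4.
      apply: ler_pM; [by rewrite mulr_ge0 //; lra|by lra| |by lra].
      by rewrite ler_wpM2l //; lra.
    by lra.
  have b2 : sp * D * (rho * (18 + 4 * alpha * y * (1 + 18 * rho * y) + 13 - 36 * rho))
     <= sp * D * (rho * (31 + 16 * alpha * Y)).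
    by rewrite ler_wpM2l ?ler_wpM2l // mulr_ge0 // ltW.
  have b3 : sp * rho <= 2 * x * D.
    apply: le_trans (ler_wpM2l (ltW sp0) hr) _.
    have -> : sp * (x * ((sp ^+ 2 - sq ^+ 2) / sp ^+ 2)) = x * D * ((sp + sq) / sp).
      by rewrite /D; field.
    have -> : 2 * x * D = x * D * 2 by ring.
    apply: ler_wpM2l; first by rewrite mulr_ge0 // ltW.
    by rewrite ler_pdivrMr //; lra.
  have b4 : sp * D * (rho * (31 + 16 * alpha * Y)) <= eta * D ^+ 2.
    have -> : sp * D * (rho * (31 + 16 * alpha * Y)) = sp * rho * (D * (31 + 16 * alpha * Y)) by ring.
    apply: le_trans (ler_wpM2r _ b3) _; first by rewrite mulr_ge0 // ltW.
    have -> : 2 * x * D * (D * (31 + 16 * alpha * Y)) = 2 * x * (31 + 16 * alpha * Y) * D ^+ 2 by ring.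
    by rewrite ler_wpM2r // sqr_ge0.
  lra.
have := ler_wpM2l T0 key.
rewrite mulrBr; lra.
Qed.

(** Convex combination of the tangent bounds at [s * y], evaluated at [y] and at 0. *)
Lemma expR_convex (R : realType) (s y : R) : 0 <= s <= 1 ->
  expR (s * y) <= s * expR y + (1 - s).
Proof.
move=> /andP[s0 s1]; have e0 := expR_ge0 (s * y).
have h1 : expR (s * y) * (1 + (1 - s) * y) <= expR y.
  have -> : expR y = expR (s * y) * expR ((1 - s) * y) by rewrite -expRD; congr expR; ring.
  by rewrite ler_wpM2l // expR_ge1Dx.
have h2 : expR (s * y) * (1 + - (s * y)) <= 1.
  apply: (@le_trans _ _ (expR (s * y) * expR (- (s * y)))).
    by rewrite ler_wpM2l // expR_ge1Dx.
  by rewrite -expRD subrr expR0.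
have s1' : 0 <= 1 - s by lra.
have := ler_wpM2l s0 h1; have := ler_wpM2l s1' h2; lra.
Qed.

(* Jensen: [x |-> x^s] is concave. *)
Lemma mean_expR_le (R : realType) (n : nat) (a : 'I_n -> R) (s : R) : (0 < n)%N ->
  0 <= s <= 1 ->
  n%:R^-1 * \sum_i expR (- (s * a i)) <=
  expR (s * ln (n%:R^-1 * \sum_i expR (- a i))).
Proof.
move=> n0 hs; have n0' : 0 < n%:R :> R by rewrite ltr0n.
set J := n%:R^-1 * \sum_i expR (- a i).
have J0 : 0 < J.
  rewrite mulr_gt0 ?invr_gt0 //; apply: lt_le_trans (expR_gt0 (- a (Ordinal n0))) _.
  by rewrite (bigD1 (Ordinal n0)) //= lerDl; apply: sumr_ge0 => i _; exact: expR_ge0.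
apply: (@le_trans _ _ (n%:R^-1 * \sum_i expR (s * ln J) * (s * (expR (- a i) / J) + (1 - s)))).
  rewrite ler_wpM2l ?invr_ge0 ?(ltW n0') //; apply: ler_sum => i _.
  have -> : - (s * a i) = s * ln J + s * (- a i - ln J) by ring.
  rewrite expRD ler_wpM2l ?expR_ge0 //; apply: le_trans (expR_convex _ hs) _.
  by rewrite expRD [expR (- ln J)]expRN lnK ?posrE.
rewrite -mulr_sumr big_split /= -mulr_sumr -mulr_suml sumr_const card_ord -[_ *+ n]mulr_natl.
rewrite mulrCA -[leRHS]mulr1 ler_wpM2l ?expR_ge0 //.
have -> : \sum_i expR (- a i) = n%:R * J by rewrite /J mulVKf // lt0r_neq0.
by rewrite le_eqVlt; apply/orP; left; apply/eqP; field; rewrite !lt0r_neq0.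
Qed.

(** * The degree-corrected block model *)

Lemma adjacency_minor (n : nat) (i : 'I_n) (A : 'M[bool]_n) :
  is_adjacency A -> is_adjacency (row' i (col' i A)).
Proof.
move=> adjA; apply/andP; split.
  by apply/eqP/matrixP => a b; rewrite !mxE (adjacency_sym _ _ adjA).
by apply/forallP => a; rewrite !mxE adjacency_diag.
Qed.

Lemma le_supnorm (R : realType) (n : nat) (theta : 'I_n -> R) i :
  `|theta i| <= supnorm theta.
Proof. by rewrite /supnorm; apply: (le_bigmax_cond _ (fun i => `|theta i|)). Qed.

Lemma block_rank_le (R : realType) (m k : nat) (theta : 'I_m -> R) (z : 'I_m -> 'I_k)
    (B : 'M[R]_k) :
  (\rank (\matrix_(i, j) (theta i * theta j * B (z i) (z j)) : 'M[R]_m)%R <= k)%N.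
Proof.
pose U : 'M[R]_(m, k) := \matrix_(i, u) (if z i == u then theta i else 0).
have -> : \matrix_(i, j) (theta i * theta j * B (z i) (z j)) = U *m (B *m U^T) :> 'M[R]_m.
  apply/matrixP => i j; rewrite !mxE (bigD1 (z i)) //= [X in _ + X]big1 ?addr0; last first.
    by move=> u /negbTE zu; rewrite !mxE eq_sym zu mul0r.
  rewrite !mxE eqxx (bigD1 (z j)) //= [X in _ + X]big1 ?addr0; last first.
    by move=> u /negbTE zu; rewrite !mxE eq_sym zu mulr0.
  by rewrite !mxE eqxx; ring.
exact: leq_trans (mxrankM_maxl _ _) (rank_leq_col _).
Qed.

(** The constant of [loo_op_le] for [K = 2 (alpha + 37)] and [c2 = alpha / c]. *)
Definition op_const (R : realType) (alpha C1 c : R) : R :=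
  2 * (2 * (alpha + 37) + (64 * C1 + 1024 * alpha + 448 * 100) / 16 + alpha)
  + 6 * alpha + alpha / c.

(** The quantity [G] of [spectral_cluster] for [M0 = n / (2 k)], [Mtot = 2 n] and
    [F = 3 k op_const w], with [n] in place of the [n - 1] rows; [264 = 3 * 11 * 2 * 4]. *)
Definition mis_bound (R : realType) (k : nat) (alpha C1 c eps w p q : R) : R :=
  264 * k%:R ^+ 3 * alpha * op_const alpha C1 c * w * (1 + eps) / (p - q).

Section Model.
Variables (R : realType) (n k : nat) (theta : 'I_n -> R) (p q delta alpha c : R).
Variables (P : 'M[R]_n) (z : 'I_n -> 'I_k) (B : 'M[R]_k).
Let S := supnorm theta.
Let w := Num.sqrt (n%:R * p * S ^+ 2).
Hypothesis rep : dcbm_rep theta p q 1 delta P z B.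
Hypothesis B_le : forall u, B u u <= alpha * p.
Hypothesis alpha1 : 1 <= alpha.
Hypothesis q0 : 0 < q.
Hypothesis k2 : (2 <= k)%N.
Hypothesis c01 : 0 < c <= 1.
Hypothesis theta_ge : forall i, c <= theta i.
Hypothesis cn : c^-1 <= n%:R.
Hypothesis kn : 8 * k%:R <= n%:R :> R.
Hypothesis Sn : S <= n%:R / (8 * k%:R).
Hypothesis delta0 : 0 <= delta.
Hypothesis delta1 : delta <= 1 / 8.
Hypothesis Sp : n%:R^-1 <= S ^+ 2 * p.

Lemma model_qp : q < p.
Proof. by case: rep => [_ [_ [_ [_ [_ [_ []]]]]]]. Qed.

Lemma model_P01 i j : 0 <= P i j <= 1.
Proof. by case: rep => h _; exact: h. Qed.

Lemma model_BT u v : B u v = B v u.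
Proof. by case: rep => [_ [bt _]]; rewrite -[in LHS]bt mxE. Qed.

Lemma model_Pdiag i : P i i = 0.
Proof. by case: rep => [_ [_ [h _]]]; exact: h. Qed.

Lemma model_Poff i j : i != j -> P i j = theta i * theta j * B (z i) (z j).
Proof. by case: rep => [_ [_ [_ [h _]]]]; exact: h. Qed.

Lemma model_Boff u v : u != v -> B u v <= q.
Proof. by case: rep => [_ [_ [_ [_ [_ [h _]]]]]]; exact: h. Qed.

Lemma model_Bdiag u : p <= B u u.
Proof. by case: rep => [_ [_ [_ [_ [_ [_ [_ [h _]]]]]]]]; exact: h. Qed.

Lemma model_csize u : (n%:R / k%:R - 1 : R) <= (csize z u)%:R <= (n%:R / k%:R + 1 : R).
Proof.
case: rep => [_ [_ [_ [_ [_ [_ [_ [_ h]]]]]]]].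
by have := h u; rewrite !mul1r.
Qed.

Lemma model_p0 : 0 < p.
Proof. by apply: lt_trans q0 model_qp. Qed.

Lemma model_theta0 i : 0 < theta i.
Proof. by case/andP: c01 => h _; exact: lt_le_trans h (theta_ge i). Qed.

Lemma model_thetaS i : theta i <= S.
Proof. by have := le_supnorm theta i; rewrite ger0_norm // ltW // model_theta0. Qed.

Lemma model_k0 : 0 < k%:R :> R.
Proof. by rewrite ltr0n; apply: leq_trans k2. Qed.

Lemma model_n0 : 0 < n%:R :> R.
Proof. by have := model_k0; have := kn; lra. Qed.

Lemma model_nk : 8 <= n%:R / k%:R :> R.
Proof. by rewrite ler_pdivlMr ?model_k0. Qed.

Lemma model_mass u :
  (1 - delta) * (n%:R / k%:R - 1) <= \sum_(i | z i == u) theta i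
    <= (1 + delta) * (n%:R / k%:R + 1).
Proof.
have /andP[cl cu] := model_csize u; have nk8 := model_nk.
have cs0 : 0 < (csize z u)%:R :> R by lra.
have /andP[h1 h2] : 1 - delta <= (\sum_(i | z i == u) theta i) / (csize z u)%:R <= 1 + delta.
  by case: rep => [_ [_ [_ [_ [h _]]]]]; exact: h.
rewrite ler_pdivlMr // in h1; rewrite ler_pdivrMr // in h2.
have d0 := delta0; have d1 := delta1.
apply/andP; split.
  by apply: le_trans h1; apply: ler_wpM2l => //; lra.
by apply: le_trans h2 _; apply: ler_wpM2l => //; lra.
Qed.

Lemma model_nonempty u (i : 'I_n) : exists2 j, j != i & z j = u.
Proof.
have /andP[cl _] := model_csize u; have nk8 := model_nk.
have : (1 < csize z u)%N by rewrite -(ltr_nat R); lra.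
rewrite /csize (cardsD1 i) => h.
have : (0 < #|[set i | z i == u]%SET :\ i|)%N by move: h; case: (_ \in _) => /=; lia.
rewrite card_gt0 => /set0Pn[j]; rewrite !inE => /andP[ji /eqP zj].
by exists j.
Qed.

(** Off the diagonal, nonnegativity of [B] is read off from [P >= 0] at two vertices realising
    [(u, v)]. *)
Lemma model_Bbd u v : 0 <= B u v <= alpha * p.
Proof.
have p0 := model_p0; have qp := model_qp.
have [->|uv] := eqVneq u v.
  by rewrite B_le andbT; apply: le_trans (model_Bdiag v); exact: ltW.
apply/andP; split; last first.
  by apply: le_trans (model_Boff uv) _; have := alpha1; nra.
have i0 : 'I_n by apply: (@Ordinal _ 0); rewrite -(ltr_nat R) model_n0.
have [i _ zi] := model_nonempty u i0; have [j _ zj] := model_nonempty v i0.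
have ij : i != j by apply: contra uv => /eqP e; rewrite -zi -zj e.
have /andP[h _] := model_P01 i j; move: h; rewrite model_Poff // zi zj.
by rewrite pmulr_rge0 // mulr_gt0 // model_theta0.
Qed.

Lemma model_Psym i j : P i j = P j i.
Proof.
have [->//|ij] := eqVneq i j.
rewrite (model_Poff ij) (model_BT (z i)); rewrite eq_sym in ij.
by rewrite (model_Poff ij); ring.
Qed.

Lemma model_w2 : w ^+ 2 = n%:R * p * S ^+ 2.
Proof.
rewrite sqr_sqrtr //; apply: mulr_ge0; last exact: sqr_ge0.
by rewrite mulr_ge0 // ltW // model_p0.
Qed.

Lemma model_block_le i j : theta i * theta j * B (z i) (z j) <= alpha * w ^+ 2 / n%:R.
Proof.
rewrite model_w2.
have -> : alpha * (n%:R * p * S ^+ 2) / n%:R = S * S * (alpha * p).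
  by field; rewrite lt0r_neq0 // model_n0.
have /andP[b0 b1] := model_Bbd (z i) (z j).
apply: ler_pM => //; first by rewrite mulr_ge0 // ltW // model_theta0.
by apply: ler_pM; rewrite ?model_thetaS // ltW // model_theta0.
Qed.

Lemma model_block_ge0 i j : 0 <= theta i * theta j * B (z i) (z j).
Proof.
have /andP[b0 b1] := model_Bbd (z i) (z j).
by rewrite !mulr_ge0 // ltW // model_theta0.
Qed.

Lemma model_Pbd i j : P i j <= alpha * w ^+ 2 / n%:R.
Proof.
have [->|ij] := eqVneq i j; last by rewrite model_Poff // model_block_le.
by rewrite model_Pdiag; apply: le_trans (model_block_le j j); exact: model_block_ge0.
Qed.

Lemma model_w1 : 1 <= w.
Proof.
rewrite -[leLHS]sqrtr1 ler_wsqrtr //.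
have := Sp; have n0 := model_n0; rewrite -(ler_pM2l n0) mulfV ?lt0r_neq0 //.
by rewrite (mulrC (S ^+ 2)) mulrA.
Qed.

(** This is [P i j <= 1] for another vertex [j] of the community of [i]; it leads to the bound
    [w <= n / c]. *)
Lemma model_p_theta i : p * theta i * c <= 1.
Proof.
have [j ji zj] := model_nonempty (z i) i.
have /andP[_ h] := model_P01 i j; rewrite eq_sym in ji; rewrite model_Poff // zj in h.
apply: le_trans h; rewrite -mulrA mulrC.
have p0 := model_p0; have t0 := model_theta0 i; have /andP[c0 _] := c01.
apply: ler_pM; [by rewrite mulr_ge0 // ltW|exact: ltW| |exact: model_Bdiag].
by rewrite ler_wpM2l ?theta_ge // ltW.
Qed.

Lemma model_S0 : 0 <= S.
Proof. by rewrite /S /supnorm; elim/big_rec: _ => // i x _ x0; rewrite le_max x0 orbT. Qed.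

Lemma model_pS : p * S * c <= 1.
Proof.
have p0 := model_p0; have /andP[c0 _] := c01.
have -> : p * S * c = S * (p * c) by ring.
rewrite -ler_pdivlMr ?mulr_gt0 // mul1r /S /supnorm; apply/bigmax_leP; split.
  by rewrite invr_ge0 mulr_ge0 // ltW.
move=> i _; rewrite ger0_norm ?(ltW (model_theta0 i)) // -[leRHS]mul1r ler_pdivlMr ?mulr_gt0 //.
by rewrite mulrA (mulrC (theta i)) model_p_theta.
Qed.

Lemma model_wn : w <= n%:R / c.
Proof.
have /andP[c0 c1] := c01; have n0 := model_n0; have k0 := model_k0; have p0 := model_p0.
have w1 := model_w1.
rewrite -ler_sqr ?nnegrE ?divr_ge0 ?(ltW n0) ?(ltW c0) //; last by lra.
have Sle : S <= n%:R.
  apply: le_trans Sn _; rewrite ler_pdivrMr ?mulr_gt0 // ler_peMr ?(ltW n0) //.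
  by have : (1 : R) <= k%:R; [rewrite ler1n (leq_trans _ k2)|lra].
rewrite model_w2 exprMn exprVn ler_pdivlMr ?exprn_gt0 //.
have -> : n%:R * p * S ^+ 2 * c ^+ 2 = (p * S * c) * (n%:R * S * c) by ring.
rewrite -[leRHS]mul1r; have S0 := model_S0; apply: ler_pM.
- by rewrite !mulr_ge0 // ltW.
- by rewrite !mulr_ge0 // ltW.
- exact: model_pS.
rewrite expr2 -mulrA; apply: ler_wpM2l; first exact: ltW.
by apply: le_trans Sle; rewrite ler_piMr.
Qed.

Lemma model_w_exp : 4 * w <= 2 ^+ (8 * n).
Proof.
have /andP[c0 c1] := c01; have n0 := model_n0.
have h : w <= n%:R * n%:R by apply: le_trans model_wn _; rewrite ler_wpM2l // ltW.
apply: le_trans (ler_wpM2l _ h) _ => //.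
rewrite -natrM -[4]/(4%:R) -natrM -natrX ler_nat.
have e : (n < 2 ^ n)%N by apply: ltn_expl.
have n1 : (0 < n)%N by rewrite -(ltr_nat R).
apply: (@leq_trans (2 ^ (2 + n + n))); last by rewrite leq_exp2l //; lia.
by rewrite !expnD; nia.
Qed.

(** The deleted vertex weighs at most [n / (8 k)], and [delta <= 1 / 8]; since [n / k >= 8], at
    least half of [n / k] is left. *)
Lemma mass_minor (i : 'I_n) u :
  n%:R / (2 * k%:R) <= \sum_(a < n.-1 | z (lift i a) == u) theta (lift i a).
Proof.
have /andP[m1 _] := model_mass u.
have k0 := model_k0; have n0 := model_n0; have nk8 := model_nk.
have e : \sum_(a < n.-1 | z (lift i a) == u) theta (lift i a) =
   \sum_(j | j != i) (if z j == u then theta j else 0).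
  by rewrite -(sum_lift i (fun j => if z j == u then theta j else 0)) big_mkcond.
have e2 : \sum_(j | z j == u) theta j <= theta i + \sum_(j | j != i) (if z j == u then theta j else 0).
  rewrite big_mkcond (bigD1 i) //= lerD2r; case: ifP => // _.
  exact: ltW (model_theta0 i).
rewrite e; have tS := model_thetaS i; have Sn' := Sn.
have eS : n%:R / (8 * k%:R) = n%:R / k%:R / 8 :> R by field; rewrite lt0r_neq0.
have eM : n%:R / (2 * k%:R) = n%:R / k%:R / 2 :> R by field; rewrite lt0r_neq0.
rewrite eM; rewrite eS in Sn'; have d1 := delta1; have d0 := delta0.
by nra.
Qed.

Lemma mass_total (i : 'I_n) : \sum_(a < n.-1) theta (lift i a) <= 2 * n%:R.
Proof.
have k0 := model_k0; have n0 := model_n0; have nk8 := model_nk.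
rewrite sum_lift; apply: (@le_trans _ _ (\sum_j theta j)).
  rewrite [leRHS](bigD1 i) //= lerDr.
  exact: ltW (model_theta0 i).
rewrite (partition_big z predT) //=.
apply: (@le_trans _ _ (\sum_(u < k) (1 + delta) * (n%:R / k%:R + 1))).
  by apply: ler_sum => u _; case/andP: (model_mass u).
rewrite sumr_const card_ord -[leLHS]mulr_natr.
have -> : (1 + delta) * (n%:R / k%:R + 1) * k%:R = (1 + delta) * (n%:R + k%:R).
  by field; rewrite lt0r_neq0.
have kn' := kn; have d1 := delta1; have d0 := delta0.
by nra.
Qed.

Lemma good_perm (C1 eps : R) (A : 'M[bool]_n) (z0 : 'I_n.-1 -> option 'I_k) (i : 'I_n) :
  is_adjacency A -> 0 <= eps -> 8 * alpha + 9 <= C1 ->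
  light_event P w (2 * (alpha + 37)) A -> disc_event alpha w 8 A ->
  algorithm1_output (C1 * (n%:R * p * S ^+ 2 + 1)) eps (row' i (col' i A)) z0 ->
  mis_bound k alpha C1 c eps w p q < n%:R / (2 * k%:R) ->
  exists s : 'S_k, \sum_(a | z0 a != Some (s (z (lift i a)))) theta (lift i a)
     <= mis_bound k alpha C1 c eps w p q.
Proof.
move=> adjA eps0 hC1 lightA discA [Q [lowQ [S0 cost]]] small.
have p0 := model_p0; have qp := model_qp; have n0 := model_n0; have k0 := model_k0.
have w1 := model_w1; have /andP[c0 c1] := c01; have al1 := alpha1.
have w0 : 0 < w by lra.
have n_gt0 : (0 < n)%N by rewrite -(ltr_nat R).
have k_gt0 : (0 < k)%N by rewrite -(ltr_nat R).
have k1 : (1 : R) <= k%:R by rewrite ler1n.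
(* The mean with its diagonal filled in, which makes its rank at most [k]; the diagonal entries are
   at most [alpha w^2 / n <= (alpha / c) w]. *)
set N : 'M[R]_n.-1 := \matrix_(a, b)
  (theta (lift i a) * theta (lift i b) * B (z (lift i a)) (z (lift i b))).
have C0 : 0 < op_const alpha C1 c.
  have : 0 < alpha / c by rewrite divr_gt0 //; lra.
  by rewrite /op_const; lra.
have op : op_le (trim (C1 * (w ^+ 2 + 1)) (row' i (col' i A)) - N) (op_const alpha C1 c * w).
  apply: (loo_op_le adjA w1 n_gt0 _ _ model_Pbd model_Pdiag lightA discA hC1 model_w_exp) => //.
  - by lra.
  - by move=> a b; case/andP: (model_P01 a b).
  - move=> a b ab; rewrite mxE model_Poff //.
    by apply: contra ab => /eqP /lift_inj ->.
  - by rewrite divr_ge0 //; lra.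
  - move=> a; rewrite mxE ger0_norm ?model_block_ge0 //.
    apply: le_trans (model_block_le _ _) _.
    have -> : alpha * w ^+ 2 / n%:R = alpha * (w / n%:R) * w by ring.
    rewrite ler_wpM2r ?(ltW w0) // ler_wpM2l //; first by lra.
    rewrite ler_pdivrMr // mulrC; exact: model_wn.
rewrite model_w2 in op.
have Cw0 : 0 < op_const alpha C1 c * w by rewrite mulr_gt0.
have hF := best_low_rank_close (ltW Cw0) op (block_rank_le _ _ _) lowQ.
pose F := 3 * k%:R * (op_const alpha C1 c * w).
have F0 : 0 < F by rewrite mulr_gt0 // mulr_gt0.
have hF2 : frob2 (Q - N) <= F ^+ 2.
  apply: le_trans hF _; rewrite /F; set X := op_const _ _ _ * w.
  have -> : (3 * k%:R * X) ^+ 2 = 9 * k%:R * k%:R * X ^+ 2 by ring.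
  by rewrite ler_wpM2r ?sqr_ge0 //; nra.
have M0_gt0 : 0 < n%:R / (2 * k%:R) :> R by rewrite divr_gt0 // mulr_gt0.
have := spectral_cluster al1 q0 qp eps0 F0 M0_gt0 k_gt0
  (fun a => ltW (model_theta0 (lift i a))) (mass_minor i) (mass_total i)
  model_Bbd model_Bdiag model_Boff hF2 S0 (cost (fun a => z (lift i a))).
set G := _ / (p * _) => /= cluster.
have qp0 : 0 < p - q by lra.
have GE : G <= mis_bound k alpha C1 c eps w p q.
  have -> : mis_bound k alpha C1 c eps w p q = n%:R * F * (11 * (1 + eps)) /
     (n%:R / (2 * k%:R) * (p - q) / (alpha * p * (2 * n%:R))) / (p * (n%:R / (2 * k%:R))).
    rewrite /mis_bound /F; field.
    by rewrite !lt0r_neq0 //; lra.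
  rewrite /G; apply: ler_wpM2r.
    by rewrite invr_ge0 mulr_ge0 ?(ltW p0) ?(ltW M0_gt0).
  apply: ler_wpM2r.
    rewrite invr_ge0; apply: divr_ge0; first by rewrite mulr_ge0 ?(ltW M0_gt0) ?(ltW qp0).
    by apply: mulr_ge0; [apply: mulr_ge0; lra|apply: mulr_ge0 => //; lra].
  apply: ler_wpM2r; first by lra.
  apply: ler_wpM2r; first exact: ltW.
  by rewrite ler_nat leq_pred.
have [s hs] := cluster (le_lt_trans GE small).
by exists s; exact: le_trans hs GE.
Qed.

(** * Clusters and edge masses seen by a deleted vertex *)

Let Nb : R := n%:R / k%:R.

Definition mis_weight (i : 'I_n) (L : 'I_n -> option 'I_k) (s : 'S_k) : R :=
  \sum_(j | (j != i) && (L j != Some (s (z j)))) theta j.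

Definition cluster (i : 'I_n) (L : 'I_n -> option 'I_k) (l : 'I_k) : {set 'I_n} :=
  [set j | (j != i) && (L j == Some l)]%SET.

Section Labels.
Variables (i : 'I_n) (L : 'I_n -> option 'I_k) (s : 'S_k) (Gam : R).
Hypothesis mis_le : mis_weight i L s <= Gam.

Lemma mis_card_le :
  #|[set j | (j != i) && (L j != Some (s (z j)))]%SET|%:R <= Gam / c.
Proof.
have /andP[c0 _] := c01; rewrite ler_pdivlMr //; apply: le_trans mis_le.
rewrite -sum1_card natr_sum mulr_suml /mis_weight.
under eq_bigl do rewrite inE.
by apply: ler_sum => j _; rewrite mul1r theta_ge.
Qed.

(** The 2 covers the rounding of community sizes and the removed vertex [i]; mislabelled vertices
    number at most [Gam / c], as each weighs at least [c]. *)
Lemma label_card u :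
  Nb - (2 + Gam / c) <= #|cluster i L (s u)|%:R <= Nb + (2 + Gam / c).
Proof.
have /andP[cl cu] := model_csize u; have mc := mis_card_le.
set mis := [set j | _]%SET in mc.
have h1 : #|cluster i L (s u)|%:R <= (csize z u)%:R + #|mis|%:R :> R.
  rewrite -natrD ler_nat.
  apply: leq_trans (subset_leq_card (_ : _ \subset [set j | z j == u]%SET :|: mis)) _.
    apply/fintype.subsetP => j; rewrite !inE => /andP[ji /eqP Lj].
    rewrite ji Lj /=; have [//|zu] := eqVneq (z j) u.
    by apply/eqP => -[/perm_inj e]; rewrite e eqxx in zu.
  by rewrite cardsU leq_subr.
have h2 : (csize z u)%:R <= #|cluster i L (s u)|%:R + #|mis|%:R + 1 :> R.
  rewrite -natrD natr1 ler_nat.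
  apply: leq_trans (subset_leq_card (_ : _ \subset (cluster i L (s u) :|: mis) :|: [set i]%SET)) _.
    apply/fintype.subsetP => j; rewrite !inE => /eqP <-.
    by case: (j == i); case: (_ == _).
  have U2 (X Y : {set 'I_n}) : (#|X :|: Y| <= #|X| + #|Y|)%N by rewrite cardsU leq_subr.
  apply: leq_trans (U2 _ _) _; rewrite cards1 addn1 ltnS; exact: U2.
by apply/andP; split; rewrite /Nb; lra.
Qed.

(** True members of [v] connect to [i] at rate at most [q]; intruders are only bounded by
    [alpha * p], but their [theta]-weight is at most [Gam]. *)
Lemma other_edge_mass v : v != z i ->
  \sum_(j in cluster i L (s v)) P i j <=
  theta i * (q * \sum_(j | z j == v) theta j + alpha * p * Gam).
Proof.
move=> vi; have p0 := model_p0; have al1 := alpha1.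
have ti := ltW (model_theta0 i).
apply: (@le_trans _ _ (theta i * (q * \sum_(j | z j == v) theta j +
   alpha * p * mis_weight i L s))); last first.
  rewrite ler_wpM2l // lerD2l ler_wpM2l // mulr_ge0 //; lra.
rewrite /mis_weight mulrDr !mulr_sumr -[X in X + _]mulr_sumr mulr_sumr.
rewrite [leLHS]big_mkcond [X in X + _]big_mkcond [X in _ + X]big_mkcond -big_split /=.
apply: ler_sum => j _; have tj := ltW (model_theta0 j).
have r1 : 0 <= theta i * (q * theta j) by rewrite !mulr_ge0 // ltW.
have r2 : 0 <= theta i * (alpha * p * theta j) by rewrite !mulr_ge0 //; lra.
rewrite inE; case: ifP => [/andP[ji /eqP Lj]|_]; last first.
  by apply: addr_ge0; case: ifP.
have ij : i != j by rewrite eq_sym.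
rewrite (model_Poff ij) -mulrA ji Lj /=.
have [zj|zj] := eqVneq (z j) v.
  apply: ler_wpDr; first by case: ifP.
  rewrite ler_wpM2l // mulrC zj ler_wpM2r //; apply: model_Boff.
  by rewrite eq_sym.
have -> : Some (s v) != Some (s (z j)).
  by apply/eqP => -[/perm_inj e]; rewrite e eqxx in zj.
by rewrite add0r ler_wpM2l // mulrC ler_wpM2r //; case/andP: (model_Bbd (z i) (z j)).
Qed.

Lemma own_edge_mass :
  theta i * (p * (\sum_(j | z j == z i) theta j - theta i - Gam)) <=
  \sum_(j in cluster i L (s (z i))) P i j.
Proof.
have p0 := model_p0; have ti := ltW (model_theta0 i).
apply: (@le_trans _ _ (theta i * (p * (\sum_(j | z j == z i) theta j - theta i
   - mis_weight i L s)))).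
  by rewrite ler_wpM2l // ler_wpM2l ?(ltW p0) // lerD2l lerN2.
pose ok j := [&& j != i, L j == Some (s (z i)) & z j == z i].
apply: (@le_trans _ _ (theta i * (p * \sum_(j | ok j) theta j))); last first.
  rewrite !mulr_sumr big_mkcond [leRHS]big_mkcond; apply: ler_sum => j _ /=.
  rewrite inE /ok; case: (boolP (j != i)) => //= ji; case: (L j == _) => //=.
  have /andP[Pij _] := model_P01 i j; case: eqP => // zj.
  rewrite eq_sym in ji; rewrite model_Poff // zj -mulrA ler_wpM2l // mulrC.
  by rewrite ler_wpM2l ?model_Bdiag // ltW // model_theta0.
rewrite ler_wpM2l // ler_wpM2l ?(ltW p0) // lerBlDr lerBlDr.
rewrite /mis_weight [leLHS]big_mkcond (bigD1 i) //= eqxx addrC lerD2r.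
rewrite [X in X + _]big_mkcond [X in _ + X]big_mkcond [leLHS]big_mkcond -big_split /=.
apply: ler_sum => j _; have tj := ltW (model_theta0 j); rewrite /ok.
case: (j != i) => /=; last by rewrite ?addr0 ?lexx.
case: eqP => [->|_]; first by case: eqP => _ /=; rewrite ?addr0 ?add0r.
by rewrite andbF add0r; case: ifP.
Qed.

End Labels.

(** Dividing by the cluster sizes makes the tilted row a nonnegative multiple of the difference of
    the two averages compared in the vote; the factor [Nb] keeps the coefficients close to [t] and
    [- t]. *)
Definition tilt (i : 'I_n) (L : 'I_n -> option 'I_k) (d e : 'I_k) (j : 'I_n) : R :=
  let t := ln (Num.sqrt p / Num.sqrt q) in
  if L j == Some d then t * (Nb / #|cluster i L d|%:R)
  else if L j == Some e then - (t * (Nb / #|cluster i L e|%:R)) else 0.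

Lemma sum_two_labels (i : 'I_n) (L : 'I_n -> option 'I_k) (d e : 'I_k) (f g : 'I_n -> R) :
  d != e ->
  \sum_(j | j != i) (if L j == Some d then f j else if L j == Some e then g j else 0) =
  \sum_(j in cluster i L d) f j + \sum_(j in cluster i L e) g j.
Proof.
move=> de; rewrite [LHS]big_mkcond [X in X + _]big_mkcond [X in _ + X]big_mkcond -big_split.
apply: eq_bigr => j _; rewrite /= !inE; case: (j != i) => /=; last by rewrite addr0.
case: eqP => [->|_]; last by rewrite add0r.
have -> : (Some d == Some e) = false by apply/eqP => -[e']; rewrite e' eqxx in de.
by rewrite addr0.
Qed.

Lemma sqrt_pq : 0 < Num.sqrt q /\ Num.sqrt q < Num.sqrt p.
Proof. by split; [rewrite sqrtr_gt0|rewrite ltr_sqrt ?model_qp // model_p0]. Qed.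

Lemma Nb_ge8 : 8 <= Nb.
Proof. exact: model_nk. Qed.

Section Exponent.
Variables (x Y eta rho Gam : R).
Hypothesis hY : Num.sqrt p <= Y * Num.sqrt q.
Hypothesis rho0 : 0 <= rho.
Hypothesis hrho : rho <= x * ((p - q) / p).
Hypothesis x0 : 0 <= x.
Hypothesis x6 : x <= 6^-1.
Hypothesis xY : 6 * x * Y <= 1.
Hypothesis hx : 2 * x * (31 + 16 * alpha * Y) <= eta.
Hypothesis Gam0 : 0 <= Gam.
Hypothesis hGam : Gam <= rho * c * Nb.
Hypothesis hdelta : delta <= rho.
Hypothesis hN : 1 <= rho * Nb.
Hypothesis hS : S <= rho * Nb.

Let rate i := (1 - eta) * (theta i * Nb * (Num.sqrt p - Num.sqrt q) ^+ 2).

Lemma rho_le6 : rho <= 6^-1.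
Proof.
apply: le_trans hrho (le_trans _ x6); rewrite -[leRHS]mulr1; apply: ler_wpM2l => //.
by rewrite ler_pdivrMr ?model_p0 // mul1r lerBlDr lerDl ltW.
Qed.

(** Both parts of the error [2 + Gam / c] are absorbed, by [1 <= rho * Nb] and
    [Gam <= rho * c * Nb], whence the factor 3. *)
Lemma label_card_near (i : 'I_n) (L : 'I_n -> option 'I_k) (s : 'S_k) (u : 'I_k) :
  mis_weight i L s <= Gam ->
  Nb * (1 - 3 * rho) <= #|cluster i L (s u)|%:R <= Nb * (1 + 3 * rho).
Proof.
move=> hm; have /andP[h1 h2] := label_card hm u.
have /andP[c0 c1] := c01; have h8 := Nb_ge8.
have g : Gam / c <= rho * Nb.
  by rewrite ler_pdivrMr //; apply: le_trans hGam _; rewrite mulrAC.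
have hN' := hN; apply/andP; split; lra.
Qed.

(** This is [chernoff_bracket] with [T = theta i * Nb], the ideal edge mass per unit rate; the
    ratios [sD] and [sC] of ideal to actual cluster size are [1 + O (rho)]. *)
Lemma node_exponent (i : 'I_n) (L : 'I_n -> option 'I_k) (s : 'S_k) (v : 'I_k) :
  mis_weight i L s <= Gam -> v != z i ->
  \sum_(j | j != i) P i j * (expR (tilt i L (s v) (s (z i)) j) - 1) <= - rate i.
Proof.
move=> hm vi; have [sq0 sqp] := sqrt_pq.
have p0 := model_p0; have r6 := rho_le6; have h8 := Nb_ge8.
have /andP[c0 c1] := c01; have r0 := rho0.
have Nb0 : 0 < Nb by lra.
have dv : s v != s (z i) by apply: contra vi => /eqP /perm_inj ->.
set t := ln (Num.sqrt p / Num.sqrt q).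
have qE : q = Num.sqrt q ^+ 2 by rewrite sqr_sqrtr // ltW.
have pE : p = Num.sqrt p ^+ 2 by rewrite sqr_sqrtr // ltW.
pose sD := Nb / #|cluster i L (s v)|%:R; pose sC := Nb / #|cluster i L (s (z i))|%:R.
have -> : \sum_(j | j != i) P i j * (expR (tilt i L (s v) (s (z i)) j) - 1) =
    (\sum_(j in cluster i L (s v)) P i j) * (expR (t * sD) - 1) -
    (\sum_(j in cluster i L (s (z i))) P i j) * (1 - expR (- (t * sC))).
  rewrite -mulrN opprB !mulr_suml -sum_two_labels //; apply: eq_bigr => j _; rewrite /tilt.
  by case: ifP => // _; case: ifP => // _; rewrite expR0 subrr mulr0.
have /andP[D1 D2] := label_card_near v hm.
have /andP[E1 E2] := label_card_near (z i) hm.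
have ti := ltW (model_theta0 i).
have hd := hdelta; have d0 := delta0; have hN' := hN; have hS' := hS.
have tS := model_thetaS i.
have Gle : Gam <= rho * Nb.
  by apply: le_trans hGam _; rewrite -mulrA [c * _]mulrC mulrA ler_piMr // mulr_ge0 // ltW.
have rN0 : 0 <= rho * Nb by rewrite mulr_ge0 // ltW.
have rr0 : 0 <= (6^-1 - rho) * rho by rewrite mulr_ge0 //; lra.
have rrN0 : 0 <= (6^-1 - rho) * (rho * Nb) by rewrite mulr_ge0 //; lra.
have rN8 : 0 <= rho * (Nb - 8) by rewrite mulr_ge0 //; lra.
have dN0 : 0 <= (rho - delta) * Nb by rewrite mulr_ge0 //; lra.
rewrite /rate [theta i * Nb * _ ]mulrC [_ * (theta i * Nb)]mulrC.
apply: (@chernoff_bracket _ _ _ alpha Y x eta rho (theta i * Nb)) => //.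
- by rewrite -pE -qE.
- by rewrite mulr_ge0 // ltW.
- by apply: sumr_ge0 => j _; case/andP: (model_P01 i j).
- apply: le_trans (other_edge_mass hm vi) _; rewrite -pE -qE -[leRHS]mulrA ler_wpM2l //.
  have /andP[_ mv] := model_mass v; rewrite -/Nb in mv.
  have mv' : \sum_(j | z j == v) theta j <= Nb * (1 + 3 * rho) by nra.
  have qp := model_qp; have al1 := alpha1.
  have a1 : q * \sum_(j | z j == v) theta j <= q * (Nb * (1 + 3 * rho)) by rewrite ler_wpM2l // ltW.
  have a2 : alpha * p * Gam <= alpha * p * (rho * Nb).
    by rewrite ler_wpM2l // mulr_ge0 //; lra.
  have a3 : q * (rho * Nb) <= alpha * p * (rho * Nb).
    by rewrite ler_wpM2r //; nra.
  lra.
- apply: le_trans (own_edge_mass hm); rewrite -pE -[leLHS]mulrA ler_wpM2l //.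
  have /andP[ma _] := model_mass (z i); rewrite -/Nb in ma.
  rewrite mulrCA ler_wpM2l ?(ltW p0) //.
  by nra.
- rewrite /sD ler_pdivrMr; last by apply: lt_le_trans D1; rewrite mulr_gt0 //; lra.
  apply: (@le_trans _ _ ((1 + 6 * rho) * (Nb * (1 - 3 * rho)))).
    by nra.
  by rewrite ler_wpM2l //; lra.
- rewrite /sC ler_pdivlMr; last by apply: lt_le_trans E1; rewrite mulr_gt0 //; lra.
  apply: (@le_trans _ _ ((1 - 3 * rho) * (Nb * (1 + 3 * rho)))).
    by rewrite ler_wpM2l //; lra.
  have rrN : 0 <= rho * (rho * Nb) by rewrite mulr_ge0.
  by lra.
Qed.

End Exponent.

(** * Misplacement of a single vertex *)

Section NodeError.
Variables (alg1 : 'M[bool]_n.-1 -> 'I_n.-1 -> option 'I_k) (Gam : R).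

Definition loo_labels (i : 'I_n) (A : 'M[bool]_n) (j : 'I_n) : option 'I_k :=
  if unlift i j is Some a then alg1 (row' i (col' i A)) a else None.

(** The independence gained by leaving one vertex out: the labels of run [i] ignore row [i]. *)
Lemma loo_labels_offrow i A : loo_labels i (offrow i A) = loo_labels i A.
Proof.
apply/funext => j; rewrite /loo_labels.
suff -> : row' i (col' i (offrow i A)) = row' i (col' i A) by [].
by apply/matrixP => a b; rewrite !mxE ![_ == i]eq_sym !neq_lift.
Qed.

Definition well_labelled (i : 'I_n) (A : 'M[bool]_n) : bool :=
  [exists s : 'S_k, mis_weight i (loo_labels i A) s <= Gam].

(** The aligning permutation is selected from the deleted graph alone, as [row_tilt_le] requires;
    the identity is a placeholder when no permutation qualifies. *)
Definition loo_perm (i : 'I_n) (A : 'M[bool]_n) : 'S_k :=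
  odflt 1%g [pick s : 'S_k | mis_weight i (loo_labels i A) s <= Gam].

Lemma loo_permP i A : well_labelled i A ->
  mis_weight i (loo_labels i A) (loo_perm i A) <= Gam.
Proof.
rewrite /loo_perm => /existsP[s hs]; case: pickP => //= h.
by rewrite h in hs.
Qed.

(** Dominates the indicator that [i] is misplaced by a reliable run: one exponential per wrong
    community. *)
Definition node_error (i : 'I_n) (A : 'M[bool]_n) : R :=
  (well_labelled i A)%:R * \sum_(v | v != z i)
    expR (\sum_(j | j != i)
      tilt i (loo_labels i A) (loo_perm i A v) (loo_perm i A (z i)) j * (A i j)%:R).

Lemma node_error_ge0 i A : 0 <= node_error i A.
Proof. by rewrite mulr_ge0 // sumr_ge0 // => v _; exact: expR_ge0. Qed.

Lemma node_error_expect (i : 'I_n) (r : R) :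
  (forall (L : 'I_n -> option 'I_k) (s : 'S_k) (v : 'I_k),
     mis_weight i L s <= Gam -> v != z i ->
     \sum_(j | j != i) P i j * (expR (tilt i L (s v) (s (z i)) j) - 1) <= r) ->
  expect P (node_error i) <= k%:R * expR r.
Proof.
move=> hr.
pose f v A := (well_labelled i (offrow i A))%:R * expR (\sum_(j | j != i)
   tilt i (loo_labels i (offrow i A)) (loo_perm i (offrow i A) v)
     (loo_perm i (offrow i A) (z i)) j * (A i j)%:R).
have -> : expect P (node_error i) = \sum_(v | v != z i) expect P (f v).
  rewrite -expect_sum; apply: expect_eq => A _.
  by rewrite /node_error mulr_sumr /f /well_labelled /loo_perm loo_labels_offrow.
apply: (@le_trans _ _ (\sum_(v | v != z i) expR r)).
  apply: ler_sum => v vi.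
  apply: (@row_tilt_le _ _ _ i (well_labelled i) (fun M =>
    tilt i (loo_labels i M) (loo_perm i M v) (loo_perm i M (z i)))
    _ model_P01 model_Psym) => M _ GM.
  by apply: hr => //; exact: loo_permP.
rewrite sumr_const -[leLHS]mulr_natl ler_wpM2r ?expR_ge0 // ler_nat.
by rewrite -[leqRHS]card_ord max_card.
Qed.

(** If the vote prefers a wrong cluster, the difference of averages is nonnegative, hence so is the
    exponent of the corresponding term. *)
Lemma node_error_ge1 (i : 'I_n) (A : 'M[bool]_n) (l : 'I_k) :
  well_labelled i A -> l != loo_perm i A (z i) ->
  is_argmax (fun u : 'I_k =>
    (\sum_(j < n | (j != i) && (loo_labels i A j == Some u)) (A i j)%:R) /
     #|[set j | (j != i) && (loo_labels i A j == Some u)]%SET|%:R : R) l ->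
  1 <= node_error i A.
Proof.
move=> gA ls amax; set s := loo_perm i A in ls.
pose v := (s^-1)%g l; have sv : s v = l by rewrite /v permKV.
have vi : v != z i by apply: contra ls => /eqP <-; rewrite sv.
rewrite /node_error gA mul1r (bigD1 v) //=; apply: ler_wpDr.
  by apply: sumr_ge0 => u _; exact: expR_ge0.
rewrite -[leLHS]expR0 ler_expR -/s.
set t := ln (Num.sqrt p / Num.sqrt q).
have t0 : 0 <= t.
  have [sq0 sqp] := sqrt_pq.
  by rewrite ln_ge0 // ler_pdivlMr // mul1r ltW.
have h8 := Nb_ge8.
have dv : s v != s (z i) by rewrite sv.
have -> : \sum_(j | j != i) tilt i (loo_labels i A) (s v) (s (z i)) j * (A i j)%:R =
  t * Nb * ((\sum_(j in cluster i (loo_labels i A) (s v)) (A i j)%:R) /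
      #|cluster i (loo_labels i A) (s v)|%:R
   - (\sum_(j in cluster i (loo_labels i A) (s (z i))) (A i j)%:R) /
      #|cluster i (loo_labels i A) (s (z i))|%:R).
  rewrite mulrBr -mulrN -!mulrA.
  rewrite [_ / #|cluster i (loo_labels i A) (s v)|%:R]mulrC.
  rewrite [_ / #|cluster i (loo_labels i A) (s (z i))|%:R]mulrC -mulNr !mulrA.
  rewrite !mulr_sumr -sum_two_labels //; apply: eq_bigr => j _; rewrite /tilt -/t.
  case: ifP => _; first by rewrite !mulrA.
  case: ifP => _; last by rewrite mul0r.
  by rewrite !mulrA !mulrN !mulNr.
apply: mulr_ge0; first by rewrite mulr_ge0 //; lra.
rewrite subr_ge0; have := amax (s (z i)); rewrite -sv.
have e l' : \sum_(j in cluster i (loo_labels i A) l') (A i j)%:R =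
    \sum_(j < n | (j != i) && (loo_labels i A j == Some l')) (A i j)%:R :> R.
  by apply: eq_bigl => j; rewrite inE.
by rewrite !e.
Qed.

End NodeError.

(** Let [E] collect the vertices mislabelled in the first run or in run [i], and the two deleted
    vertices. Off [E] both runs are the truth up to their permutations, so the correct label
    overlaps in at least [csize z (z i) - |E|] vertices and any other in at most [|E|]. The
    condition [4 * (Gam / c) + 5 < Nb] says that [Nb - 1] exceeds twice the bound
    [2 * (Gam / c) + 2] on [|E|]. *)
Lemma algorithm3_loss_le (alg1 : 'M[bool]_n.-1 -> 'I_n.-1 -> option 'I_k) (Gam : R)
    (A : 'M[bool]_n) (zhat : 'I_n -> 'I_k) :
  algorithm3_output R alg1 A zhat ->
  (forall i, well_labelled alg1 Gam i A) -> 4 * (Gam / c) + 5 < Nb ->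
  loss R zhat z <= n%:R^-1 * \sum_i node_error alg1 Gam i A.
Proof.
move=> [loo [self [looE [looii [amax align]]]]] good small.
have looL i j : j != i -> loo i j = loo_labels alg1 i A j.
  rewrite /loo_labels; case: unliftP => [a ->|->]; first by rewrite looE.
  by rewrite eqxx.
pose s i := loo_perm alg1 Gam i A.
pose mis i := [set j | (j != i) && (loo_labels alg1 i A j != Some (s i (z j)))]%SET.
have mis_small i : #|mis i|%:R <= Gam / c.
  by apply: mis_card_le; exact: loo_permP (good i).
have node i : self i != s i (z i) -> 1 <= node_error alg1 Gam i A.
  move=> h; apply: node_error_ge1 (good i) h _ => v.
  have e l : \sum_(j < n | (j != i) && (loo i j == Some l)) (A i j)%:R =
     \sum_(j < n | (j != i) && (loo_labels alg1 i A j == Some l)) (A i j)%:R :> R.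
    by apply: eq_bigl => j; case: (boolP (j == i)) => //= ji; rewrite looL.
  have e2 l : [set j | (j != i) && (loo i j == Some l)]%SET =
     [set j | (j != i) && (loo_labels alg1 i A j == Some l)]%SET.
    by apply/setP => j; rewrite !inE; case: (boolP (j == i)) => //= ji; rewrite looL.
  by have := amax i v; rewrite !e !e2.
have n_gt0 : (0 < n)%N by rewrite -(ltr_nat R) model_n0.
pose i1 : 'I_n := Ordinal n_gt0.
have [zhat1 zhatE] := align i1 erefl.
have right i : self i = s i (z i) -> zhat i = s i1 (z i).
  move=> si; have [e|ii1] := eqVneq i i1; first by rewrite e zhat1 -e si.
  have am := zhatE i ii1.
  pose X u := ([set j | loo i1 j == Some u] :&: [set j | loo i j == Some (self i)])%SET.
  pose E := ((mis i1 :|: mis i) :|: ([set i1] :|: [set i]))%SET.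
  have outE j : j \notin E -> loo i1 j = Some (s i1 (z j)) /\ loo i j = Some (s i (z j)).
    rewrite !inE !negb_or !negb_and !negbK => /andP[/andP[h1 h2] /andP[j1 ji]].
    rewrite (negbTE j1) /= in h1; rewrite (negbTE ji) /= in h2.
    by rewrite !looL // (eqP h1) (eqP h2).
  have U2 (T T' : {set 'I_n}) : (#|T :|: T'| <= #|T| + #|T'|)%N by rewrite cardsU leq_subr.
  have cardE : #|E|%:R <= 2 * (Gam / c) + 2 :> R.
    apply: (@le_trans _ _ (#|mis i1|%:R + #|mis i|%:R + 2)).
      rewrite -!natrD ler_nat; apply: leq_trans (U2 _ _) _.
      apply: leq_add; first exact: U2.
      by apply: leq_trans (U2 _ _) _; rewrite !cards1.
    by have := mis_small i1; have := mis_small i; lra.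
  apply: contrapT => /eqP ne.
  pose u' := ((s i1)^-1)%g (zhat i); have su : s i1 u' = zhat i by rewrite /u' permKV.
  have u'z : u' != z i by apply: contra ne => /eqP <-; rewrite su.
  have low : (csize z (z i))%:R <= #|X (s i1 (z i))|%:R + #|E|%:R :> R.
    rewrite -natrD ler_nat; apply: leq_trans (U2 _ _); apply: subset_leq_card.
    apply/fintype.subsetP => j; rewrite inE => /eqP zj; rewrite inE.
    case: (boolP (j \in E)) => [_|/outE[h1 h2]]; first by rewrite orbT.
    by rewrite !inE h1 h2 zj si !eqxx.
  have up : #|X (zhat i)|%:R <= #|E|%:R :> R.
    rewrite ler_nat; apply: subset_leq_card; apply/fintype.subsetP => j.
    rewrite !inE -su; case: (boolP (j \in E)) => [h|/outE[-> ->]]; first by move: h; rewrite !inE.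
    move=> /andP[/eqP[/perm_inj zj] /eqP[]]; rewrite si => /perm_inj zi.
    by move: u'z; rewrite -zj zi eqxx.
  have /andP[cs _] := model_csize (z i); rewrite -/Nb in cs.
  by have := am (s i1 (z i)); rewrite -/(X _) -/(X _); lra.
have bigmin_le (r : seq 'S_k) (f : 'S_k -> nat) t :
    t \in r -> (\big[minn/n]_(s <- r) f s <= f t)%N.
  elim: r => // t' r IH; rewrite inE big_cons => /orP[/eqP ->|/IH h].
    exact: geq_minl.
  exact: leq_trans (geq_minr _ _) h.
rewrite /loss mulrC ler_wpM2l ?invr_ge0 //.
apply: (@le_trans _ _ #|[set i | zhat i != s i1 (z i)]%SET|%:R).
  by rewrite ler_nat; apply: (bigmin_le _ (fun t => #|[set i | zhat i != t (z i)]%SET|)); exact: mem_index_enum.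
rewrite -sum1_card natr_sum big_mkcond; apply: ler_sum => i _; rewrite inE.
case: eqP => [_|h] /=; first exact: node_error_ge0.
by apply: node; apply/eqP => /right.
Qed.

(** With [beta = 1] the two cases of the rate agree, since [n / 2] is [n / k] when [k = 2]. *)
Lemma rateE : rateI theta p q k 1 =
  - ln (n%:R^-1 * \sum_(i < n) expR (- (theta i * Nb * (Num.sqrt p - Num.sqrt q) ^+ 2))).
Proof.
rewrite /rateI; have -> : (if k == 2%N then n%:R / 2 else n%:R / (1 * k%:R)) = Nb.
  by rewrite /Nb; case: eqP => [->|_]; rewrite ?mul1r.
by [].
Qed.

Lemma rate_ge : c * Nb * (Num.sqrt p - Num.sqrt q) ^+ 2 <= rateI theta p q k 1.
Proof.
have n0 := model_n0; have h8 := Nb_ge8; have /andP[c0 _] := c01.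
rewrite rateE -lerN2 opprK; set D2 := (_ - _) ^+ 2.
have D20 : 0 <= D2 by exact: sqr_ge0.
rewrite -[leRHS]expRK ler_ln ?posrE ?expR_gt0 //; last first.
  have n_gt0 : (0 < n)%N by rewrite -(ltr_nat R).
  rewrite mulr_gt0 ?invr_gt0 // (bigD1 (Ordinal n_gt0)) //= ltr_pwDl ?expR_gt0 //.
  by apply: sumr_ge0 => i _; exact: expR_ge0.
rewrite ler_pdivrMl //; apply: (@le_trans _ _ (\sum_(i < n) expR (- (c * Nb * D2)))).
  apply: ler_sum => i _; rewrite ler_expR lerN2 ler_wpM2r // ler_wpM2r //.
  by lra.
by rewrite sumr_const card_ord -[leLHS]mulr_natl.
Qed.

(** Vertices are treated at accuracy [e / 2]: Jensen turns their mean error into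
    [expR (- (1 - e / 2) I)], Markov at level [expR (- (1 - e) I)] leaves [expR (- e I / 2)], and
    [rate_ge] makes this explicit. The term [2 / n] covers the two graph events. *)
Lemma loss_prob_ge (C1 eps e x Y rho : R)
    (alg1 : 'M[bool]_n.-1 -> 'I_n.-1 -> option 'I_k)
    (zhat : 'M[bool]_n -> 'I_n -> 'I_k) :
  0 <= eps -> 8 * alpha + 9 <= C1 -> 0 < e <= 1 ->
  Num.sqrt p <= Y * Num.sqrt q -> rho = x * ((p - q) / p) ->
  0 <= x -> x <= 6^-1 -> 6 * x * Y <= 1 -> 2 * x * (31 + 16 * alpha * Y) <= e / 2 ->
  mis_bound k alpha C1 c eps w p q <= rho * c * Nb ->
  delta <= rho -> 1 <= rho * Nb -> S <= rho * Nb -> 15 < Nb ->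
  (forall A : 'M[bool]_n.-1, is_adjacency A ->
     algorithm1_output (C1 * (n%:R * p * S ^+ 2 + 1)) eps A (alg1 A)) ->
  (forall A : 'M[bool]_n, is_adjacency A -> algorithm3_output R alg1 A (zhat A)) ->
  1 - (2 / n%:R + k%:R * expR (- (e / 2 * (c * Nb * (Num.sqrt p - Num.sqrt q) ^+ 2))))
  <= graph_prob P (fun A : 'M[bool]_n =>
       loss R (zhat A) z <= expR (- ((1 - e) * rateI theta p q k 1))).
Proof.
move=> eps0 hC1 /andP[e0 e1] hY hr x0 x6 xY hx hG hd hN hS N15 halg hz.
set Gam := mis_bound _ _ _ _ _ _ _ _ in hG.
have p0 := model_p0; have qp := model_qp; have n0 := model_n0; have k0 := model_k0.
have n_gt0 : (0 < n)%N by rewrite -(ltr_nat R).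
have /andP[c0 c1] := c01; have w1 := model_w1; have al1 := alpha1.
have w0 : 0 < w by lra.
have al0 : 0 <= alpha by lra.
have rho0 : 0 <= rho by rewrite hr mulr_ge0 // divr_ge0 // ltW // subr_gt0.
have rho6 : rho <= 6^-1 by apply: (rho_le6 (x := x)) => //; rewrite hr.
have Gam0 : 0 <= Gam.
  have C0 : 0 < op_const alpha C1 c.
    have : 0 < alpha / c by rewrite divr_gt0 //; lra.
    by rewrite /op_const; lra.
  apply: divr_ge0; last by lra.
  apply: mulr_ge0; last by lra.
  apply: mulr_ge0; last exact: ltW.
  apply: mulr_ge0; last exact: ltW.
  by apply: mulr_ge0 => //; apply: mulr_ge0 => //; rewrite exprn_ge0.
have GN : Gam / c <= Nb / 6.
  rewrite ler_pdivrMr //; apply: le_trans hG _.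
  have -> : Nb / 6 * c = 6^-1 * c * Nb by ring.
  by rewrite ler_wpM2r //; [lra|rewrite ler_wpM2r // ltW].
have Gsmall : Gam < n%:R / (2 * k%:R).
  have -> : n%:R / (2 * k%:R) = Nb / 2 by rewrite /Nb; field; rewrite lt0r_neq0.
  rewrite ler_pdivrMr // in GN.
  by have : Nb / 6 * c <= Nb / 6; [rewrite ler_piMr //; lra|lra].
set D2 := (Num.sqrt p - Num.sqrt q) ^+ 2.
set I := rateI theta p q k 1.
have [fL [fL0 fL1 fLe]] := light_event_prob model_P01 model_Psym model_Pdiag w0 n_gt0
   model_Pbd (lexx (2 * (alpha + 37))).
have [fD [fD0 fD1 fDe]] := disc_event_prob model_P01 model_Psym w0 n_gt0 al0 model_Pbd.
pose F A := fL A + fD A +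
   expR ((1 - e) * I) * (n%:R^-1 * \sum_i node_error alg1 Gam i A).
have F3_ge0 A : 0 <= expR ((1 - e) * I) * (n%:R^-1 * \sum_i node_error alg1 Gam i A).
  rewrite mulr_ge0 ?expR_ge0 // mulr_ge0 // sumr_ge0 // => i _.
  exact: node_error_ge0.
apply: le_trans (graph_prob_ge model_P01 (f := F) _ _).
- rewrite lerD2l lerN2 /F !expectD expectZ.
  have -> : 2 / n%:R = n%:R^-1 + n%:R^-1 :> R by ring.
  have eL : expect P fL <= n%:R^-1.
    apply: le_trans fLe _; rewrite expRN lef_pV2 ?posrE ?expR_gt0 //.
    by apply: le_trans (expR_ge1Dx _); lra.
  have eN : expR ((1 - e) * I) * expect P (fun A => n%:R^-1 * \sum_i node_error alg1 Gam i A)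
     <= k%:R * expR (- (e / 2 * (c * Nb * D2))).
    rewrite expectZ expect_sum.
    apply: (@le_trans _ _ (expR ((1 - e) * I) * (k%:R * expR (- ((1 - e / 2) * I))))).
      rewrite ler_wpM2l ?expR_ge0 //.
      apply: (@le_trans _ _ (k%:R * (n%:R^-1 * \sum_(i < n) expR (- ((1 - e / 2) * (theta i * Nb * D2)))))).
        rewrite mulrCA ler_wpM2l ?invr_ge0 ?(ltW n0) // mulr_sumr; apply: ler_sum => i _.
        apply: node_error_expect => L s v hm vi.
        by apply: (@node_exponent x Y (e / 2) rho Gam) => //; rewrite hr.
      rewrite ler_wpM2l //; apply: le_trans (mean_expR_le _ n_gt0 _) _; first by lra.
      by rewrite /I rateE mulrN opprK.
    rewrite mulrCA ler_wpM2l // -expRD ler_expR.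
    have hI := rate_ge; rewrite -/D2 -/I in hI.
    have e2 : 0 <= e / 2 by lra.
    by have := ler_wpM2l e2 hI; lra.
  by apply: lerD => //; exact: lerD.
- by move=> A _; rewrite /F addr_ge0 // addr_ge0.
move=> A adjA /negP; rewrite /F => nE.
have [lA|/fL1 h] := boolP (light_event P w (2 * (alpha + 37)) A); last first.
  by have := fD0 A; have := F3_ge0 A; lra.
have [dA|/fD1 h] := boolP (disc_event alpha w 8 A); last first.
  by have := fL0 A; have := F3_ge0 A; lra.
have good i : well_labelled alg1 Gam i A.
  have [s hs] := good_perm (z0 := alg1 (row' i (col' i A))) (i := i) adjA eps0 hC1 lA dA
    (halg _ (adjacency_minor i adjA)) Gsmall.
  apply/existsP; exists s; apply: le_trans hs; rewrite le_eqVlt; apply/orP; left; apply/eqP.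
  rewrite /mis_weight big_mkcondr /= -(sum_lift i (fun j =>
     if loo_labels alg1 i A j != Some (s (z j)) then theta j else 0)) [RHS]big_mkcond.
  by apply: eq_bigr => a _; rewrite /loo_labels liftK.
(* As [Gam / c <= Nb / 6], a third of [Nb] is left, and it exceeds 5. *)
have small : 4 * (Gam / c) + 5 < Nb by lra.
have := algorithm3_loss_le (hz A adjA) good small.
set X := n%:R^-1 * _ => lossX.
have big : expR (- ((1 - e) * I)) < X.
  by apply: lt_le_trans lossX; rewrite ltNge; apply/negP.
have : 1 <= expR ((1 - e) * I) * X.
  rewrite -ler_pdivrMl ?expR_gt0 // mulr1 -expRN; exact: ltW.
by have := fL0 A; have := fD0 A; lra.
Qed.

End Model.

(** * Asymptotics *)

Lemma dcbm_delta_ge0 (R : realType) (n k : nat) (theta : 'I_n -> R) (p q delta : R)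
    (P : 'M[R]_n) (z : 'I_n -> 'I_k) (B : 'M[R]_k) :
  dcbm_rep theta p q 1 delta P z B -> (0 < k)%N -> 0 <= delta.
Proof.
case=> [_ [_ [_ [_ [h _]]]]] k0; have /andP[] := h (Ordinal k0).
set m := _ / _ => h1 h2; have := le_trans h1 h2; lra.
Qed.

Lemma op_const_ge1 (R : realType) (alpha C1 c : R) :
  1 <= alpha -> 0 < c -> 8 * alpha + 9 <= C1 -> 1 <= op_const alpha C1 c.
Proof.
move=> al1 c0 hC1; have : 0 < alpha / c by rewrite divr_gt0 //; lra.
by rewrite /op_const; lra.
Qed.

(** The tolerance [x] is limited by [chernoff_bracket]; [kap] bounds the signal ratio, and its three
    constraints serve [regime_mis], [regime_mass] and [regime_exponent] in this order. *)
Lemma slack_constants (R : realType) (alpha c K M e C : R) :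
  1 <= alpha -> 0 < c <= 1 -> 1 <= K -> 1 <= M -> 0 < e <= 1 -> 1 <= C ->
  exists kap x : R, [/\ 0 < kap, 0 < x, x <= 6^-1, 6 * x * M <= 1 &
   [/\ 2 * x * (31 + 16 * alpha * M) <= e / 2,
       kap * (264 * K ^+ 4 * alpha * C) <= x * c, kap * K <= x * c ^+ 2 &
       4 * K * kap <= e * c ^+ 2]].
Proof.
move=> al1 /andP[c0 c1] K1 M1 /andP[e0 e1] C1.
pose L := 31 + 16 * alpha * M.
have L0 : 0 < L by rewrite /L; nra.
pose x : R := Num.min 6^-1 (Num.min (6 * M)^-1 (e / (4 * L))).
have x0 : 0 < x.
  by rewrite !lt_min invr_gt0 ?divr_gt0 ?invr_gt0 ?mulr_gt0 //; lra.
have x6 : x <= 6^-1 by rewrite ge_min lexx.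
have xM : 6 * x * M <= 1.
  have : x <= (6 * M)^-1 by rewrite !ge_min lexx orbT.
  by rewrite -[_^-1]mul1r ler_pdivlMr; [move=> h; lra|lra].
have xL : 2 * x * L <= e / 2.
  have : x <= e / (4 * L) by rewrite !ge_min lexx !orbT.
  by rewrite ler_pdivlMr; [move=> h; lra|lra].
clearbody x.
have h1 : K <= K ^+ 4 by rewrite -[leLHS]expr1 ler_weXn2l.
have h2 : K ^+ 4 <= K ^+ 4 * alpha by rewrite ler_peMr // exprn_ge0 //; lra.
have h3 : K ^+ 4 * alpha <= K ^+ 4 * alpha * C by rewrite ler_peMr //; lra.
set D := 264 * K ^+ 4 * alpha * C.
have KD : K * 264 <= D by rewrite /D; lra.
have D0 : 0 < D by lra.
pose kap : R := x * c ^+ 2 * e / D.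
have c20 : 0 < c ^+ 2 by rewrite exprn_gt0.
have kapE : kap * D = x * c ^+ 2 * e by rewrite divfK // lt0r_neq0.
have kap0 : 0 < kap by rewrite divr_gt0 // mulr_gt0 // mulr_gt0.
clearbody kap D; clear h1 h2 h3.
have kapKD := ler_wpM2l (ltW kap0) KD.
have kK0 : 0 <= kap * K by rewrite mulr_ge0 //; lra.
have xc2 : 0 <= x * c ^+ 2 by rewrite mulr_ge0 ?(ltW x0) ?(ltW c20).
have xc2e : x * c ^+ 2 * e <= x * c ^+ 2 by rewrite ler_piMr.
have c2e0 : 0 <= c ^+ 2 * e by rewrite mulr_ge0 ?(ltW c20) ?(ltW e0).
have xc : x * (c ^+ 2 * e) <= 6^-1 * (c ^+ 2 * e) by rewrite ler_wpM2r.
exists kap, x; split => //; split => //.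
- have ce : c * e <= 1 by rewrite mulr_ile1 // ltW.
  rewrite kapE (_ : x * c ^+ 2 * e = x * c * (c * e)); last by ring.
  by rewrite ler_piMr // mulr_ge0 // ltW.
- by lra.
- by lra.
Qed.

(** * Consequences of the signal condition, with [s], [sp], [D] for [sqrt n], [sqrt p], [p - q] *)

Section Regime.
Variables (R : realType) (c K kap x s sp S D k : R).
Hypothesis c0 : 0 < c.
Hypothesis c1 : c <= 1.
Hypothesis kap0 : 0 < kap.
Hypothesis x0 : 0 < x.
Hypothesis s1 : 1 <= s.
Hypothesis sp0 : 0 < sp.
Hypothesis k1 : 1 <= k.
Hypothesis kK : k <= K.
Hypothesis D0 : 0 < D.
Hypothesis Dp : D <= sp ^+ 2.
Hypothesis cS : c <= S.
Hypothesis spc : sp * c <= 1.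
Hypothesis main : S * (sp ^+ 2 * sp) <= kap * (s * D ^+ 2).

Let s0 : 0 < s. Proof. exact: lt_le_trans ltr01 s1. Qed.
Let k0 : 0 < k. Proof. exact: lt_le_trans ltr01 k1. Qed.
Let S0 : 0 < S. Proof. exact: lt_le_trans c0 cS. Qed.
Let sp2 : 0 < sp ^+ 2. Proof. exact: exprn_gt0. Qed.

(** A bound of [S] by a small multiple of [n / k] would not suffice when [(p - q) / p] is small. The
    sharper one comes from [main] by trading one factor [D] for [p] and using [sp * c <= 1 <= s];
    because [c <= S], it also yields [1 <= rho * n / k]. *)
Lemma regime_mass : kap * K <= x * c ^+ 2 ->
  S / c <= x * (D / sp ^+ 2) * (s ^+ 2 / k).
Proof.
move=> kapK; rewrite ler_pdivrMr //.
have -> : x * (D / sp ^+ 2) * (s ^+ 2 / k) * c = x * c * s ^+ 2 * D / (sp ^+ 2 * k).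
  by field; rewrite !lt0r_neq0.
rewrite ler_pdivlMr; last by rewrite mulr_gt0.
have hSp : S * sp ^+ 2 <= kap * s * D * sp.
  rewrite -(ler_pM2r sp0) -[leLHS]mulrA; apply: le_trans main _.
  have -> : kap * s * D * sp * sp = kap * s * D * sp ^+ 2 by ring.
  have -> : kap * (s * D ^+ 2) = kap * s * D * D by ring.
  apply: ler_wpM2l => //.
  by do ?apply: mulr_ge0; exact: ltW.
rewrite mulrA; apply: (@le_trans _ _ (kap * s * D * sp * K)).
  by apply: ler_pM => //; [rewrite mulr_ge0 // ltW|exact: ltW].
have -> : kap * s * D * sp * K = (kap * K) * (s * D * sp) by ring.
apply: (@le_trans _ _ (x * c ^+ 2 * (s * D * sp))).
  by apply: ler_wpM2r => //; do ?apply: mulr_ge0; exact: ltW.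
have -> : x * c ^+ 2 * (s * D * sp) = (x * c * D) * (s * (sp * c)) by ring.
have -> : x * c * s ^+ 2 * D = (x * c * D) * (s * s) by ring.
apply: ler_wpM2l; first by do ?apply: mulr_ge0; exact: ltW.
by apply: ler_wpM2l; [exact: ltW|exact: le_trans spc s1].
Qed.

(** An exponent [y >= 2 K / e] gives [K expR (- y) <= K / y <= e / 2]. Since [D <= p], [main] forces
    [c <= kap * s * sp]; multiplied by [main] itself, this makes [s^2 D^2 / p] at least
    [c^2 / kap^2]. *)
Lemma regime_exponent (e D2 : R) : 0 < e -> 4 * K * kap <= e * c ^+ 2 ->
  D ^+ 2 / (4 * sp ^+ 2) <= D2 ->
  2 * K / e <= e / 2 * (c * (s ^+ 2 / k) * D2).
Proof.
move=> e0 kape hD2.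
have K0 : 0 < K by apply: lt_le_trans kK.
have c2 : 0 < c ^+ 2 by rewrite exprn_gt0.
have h : c * (sp ^+ 2 * sp) <= kap * (s * D ^+ 2).
  by apply: le_trans main; apply: ler_wpM2r => //; do ?apply: mulr_ge0; exact: ltW.
have cks : c <= kap * s * sp.
  have h2 : kap * (s * D ^+ 2) <= kap * (s * (sp ^+ 2) ^+ 2).
    apply: ler_wpM2l; first exact: ltW.
    apply: ler_wpM2l; first exact: ltW.
    by apply: lerXn2r; rewrite ?nnegrE ?(ltW D0) ?(ltW sp2).
  have := le_trans h h2.
  have -> : kap * (s * (sp ^+ 2) ^+ 2) = kap * s * sp * (sp ^+ 2 * sp) by ring.
  by rewrite ler_pM2r // mulr_gt0.
have nD : c ^+ 2 * sp ^+ 2 <= kap ^+ 2 * (s ^+ 2 * D ^+ 2).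
  rewrite -(ler_pM2r sp0).
  have -> : c ^+ 2 * sp ^+ 2 * sp = c * (c * (sp ^+ 2 * sp)) by ring.
  have -> : kap ^+ 2 * (s ^+ 2 * D ^+ 2) * sp = kap * s * sp * (kap * (s * D ^+ 2)) by ring.
  apply: ler_pM => //; first exact: ltW.
  by do ?apply: mulr_ge0; exact: ltW.
have h1 : c ^+ 2 <= kap ^+ 2 * (s ^+ 2 * D ^+ 2 / sp ^+ 2).
  by rewrite mulrA ler_pdivlMr.
have h2 : e * c ^+ 2 * (4 * K * kap) <= e ^+ 2 * c ^+ 2 * c ^+ 2.
  have -> : e ^+ 2 * c ^+ 2 * c ^+ 2 = e * c ^+ 2 * (e * c ^+ 2) by ring.
  by apply: ler_wpM2l => //; do ?apply: mulr_ge0; exact: ltW.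
have h3 : (4 * K * kap) * (4 * K * kap) <= e * c ^+ 2 * (4 * K * kap).
  by apply: ler_wpM2r => //; do ?apply: mulr_ge0; rewrite ?ler0n // ltW.
have h4 : (4 * K * kap) * (4 * K * kap) <= e ^+ 2 * c ^+ 2 * c.
  apply: le_trans h3 (le_trans h2 _).
  have -> : e ^+ 2 * c ^+ 2 * c ^+ 2 = e ^+ 2 * c ^+ 2 * c * c by ring.
  by rewrite ler_piMr //; do ?apply: mulr_ge0; exact: ltW.
pose T := s ^+ 2 * D ^+ 2 / sp ^+ 2.
have h5 : (4 * K * kap) * (4 * K * kap) <= e ^+ 2 * c * (kap ^+ 2 * T).
  apply: le_trans h4 _; have -> : e ^+ 2 * c ^+ 2 * c = e ^+ 2 * c * c ^+ 2 by ring.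
  by apply: ler_wpM2l => //; do ?apply: mulr_ge0; exact: ltW.
have h6 : 16 * K ^+ 2 <= e ^+ 2 * c * T.
  have kap2 : 0 < kap ^+ 2 by rewrite exprn_gt0.
  rewrite -(ler_pM2r kap2).
  have -> : 16 * K ^+ 2 * kap ^+ 2 = (4 * K * kap) * (4 * K * kap) by ring.
  by have -> : e ^+ 2 * c * T * kap ^+ 2 = e ^+ 2 * c * (kap ^+ 2 * T) by ring.
apply: (@le_trans _ _ (e / 2 * (c * (s ^+ 2 / K) * (D ^+ 2 / (4 * sp ^+ 2))))); last first.
  apply: ler_wpM2l; first by rewrite divr_ge0 // ltW.
  apply: ler_pM => //.
  - by do ?apply: mulr_ge0; rewrite ?invr_ge0; exact: ltW.
  - by apply: divr_ge0; [exact: sqr_ge0|apply: mulr_ge0 => //; exact: ltW].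
  - apply: ler_wpM2l; first exact: ltW.
    apply: ler_wpM2l; first exact: sqr_ge0.
    by rewrite lef_pV2.
have -> : e / 2 * (c * (s ^+ 2 / K) * (D ^+ 2 / (4 * sp ^+ 2))) = e * c * T / (8 * K).
  by rewrite /T; field; rewrite !lt0r_neq0.
rewrite ler_pdivrMr // mulrAC ler_pdivlMr; last by rewrite mulr_gt0.
have -> : 2 * K * (8 * K) = 16 * K ^+ 2 by ring.
by apply: le_trans h6 _; rewrite le_eqVlt; apply/orP; left; apply/eqP; ring.
Qed.

(** Bounds [mis_bound] by [rho * c * n / k]: the signal condition multiplied by [s], with [kap]
    absorbing the constants. *)
Lemma regime_mis (alpha C eps : R) : 1 <= alpha -> 1 <= C -> 0 <= eps ->
  (1 + eps) * S * (sp ^+ 2 * sp) <= kap * (s * D ^+ 2) ->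
  kap * (264 * K ^+ 4 * alpha * C) <= x * c ->
  264 * k ^+ 3 * alpha * C * (s * sp * S) * (1 + eps) / D <=
  x * (D / sp ^+ 2) * c * (s ^+ 2 / k).
Proof.
move=> al1 C1 eps0 H hkap; rewrite ler_pdivrMr //.
have al0 : 0 < alpha := lt_le_trans ltr01 al1.
have C0 : 0 < C := lt_le_trans ltr01 C1.
have K0 : 0 < K := lt_le_trans k0 kK.
have -> : x * (D / sp ^+ 2) * c * (s ^+ 2 / k) * D = x * c * (s ^+ 2 * D ^+ 2) / (sp ^+ 2 * k).
  by field; rewrite !lt0r_neq0.
rewrite ler_pdivlMr; last by rewrite mulr_gt0.
have -> : 264 * k ^+ 3 * alpha * C * (s * sp * S) * (1 + eps) * (sp ^+ 2 * k) =
   264 * k ^+ 4 * alpha * C * (s * ((1 + eps) * S * (sp ^+ 2 * sp))) by ring.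
have e1 : 0 <= 1 + eps by rewrite addr_ge0.
apply: (@le_trans _ _ (264 * K ^+ 4 * alpha * C * (s * (kap * (s * D ^+ 2))))).
  apply: ler_pM.
  - by do ?apply: mulr_ge0; rewrite ?ler0n ?exprn_ge0 ?(ltW k0) ?(ltW al0) ?(ltW C0).
  - by do ?apply: mulr_ge0; rewrite // ltW.
  - apply: ler_wpM2r; first exact: ltW.
    apply: ler_wpM2r; first exact: ltW.
    apply: ler_wpM2l; first exact: ler0n.
    by apply: lerXn2r; rewrite ?nnegrE ?(ltW k0) ?(ltW K0).
  - by apply: ler_wpM2l => //; exact: ltW.
have -> : 264 * K ^+ 4 * alpha * C * (s * (kap * (s * D ^+ 2))) =
   kap * (264 * K ^+ 4 * alpha * C) * (s ^+ 2 * D ^+ 2) by ring.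
by apply: ler_wpM2r => //; rewrite mulr_ge0 ?sqr_ge0.
Qed.

End Regime.

(** The constants are fixed before [n], [k], [P] and [z]; this order of quantifiers is what yields
    an infimum over the parameter space. *)
Lemma loss_prob_uniform (R : realType) (alpha c K M e C1 : R) :
  1 <= alpha -> 0 < c <= 1 -> 1 <= K -> 1 <= M -> 0 < e <= 1 -> 8 * alpha + 9 <= C1 ->
  exists kap x : R, 0 < kap /\ 0 < x /\
  forall (n k : nat) (theta : 'I_n -> R) (p q delta eps : R)
    (alg1 : 'M[bool]_n.-1 -> 'I_n.-1 -> option 'I_k)
    (zhat : 'M[bool]_n -> 'I_n -> 'I_k) (P : 'M[R]_n) (z : 'I_n -> 'I_k),
  (2 <= k)%N -> k%:R <= K -> (forall i, c <= theta i) -> 0 < q -> p / q <= M ->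
  0 <= eps -> supnorm theta <= n%:R / (8 * k%:R) ->
  delta <= 1 / 8 -> delta <= x * ((p - q) / p) ->
  n%:R^-1 <= supnorm theta ^+ 2 * p ->
  (1 + eps) * supnorm theta * p `^ (3 / 2) / (Num.sqrt n%:R * (p - q) ^+ 2) <= kap ->
  16 * K <= n%:R -> c^-1 <= n%:R -> 4 / e <= n%:R ->
  (forall A : 'M[bool]_n.-1, is_adjacency A ->
     algorithm1_output (C1 * (n%:R * p * supnorm theta ^+ 2 + 1)) eps A (alg1 A)) ->
  (forall A : 'M[bool]_n, is_adjacency A -> algorithm3_output R alg1 A (zhat A)) ->
  param_space theta p q k 1 delta alpha (P, z) ->
  1 - e <= graph_prob P (fun A : 'M[bool]_n =>
       loss R (zhat A) z <= expR (- ((1 - e) * rateI theta p q k 1))).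
Proof.
move=> al1 c01 K1 M1 e01 hC1; have /andP[c0 c1] := c01; have /andP[e0 e1] := e01.
have C_ge1 := op_const_ge1 al1 c0 hC1.
have [kap [x [kap0 x0 x6 xM [xL kap_x kap_K kap_e]]]] :=
  slack_constants al1 c01 K1 M1 e01 C_ge1.
exists kap, x; split => //; split => //.
move=> n k theta p q delta eps alg1 zhat P z k2 kK hc q0 pqM eps0 hS hd1 hd hSp hkap n16 nc ne
  halg hz [B [rep Ble]]; rewrite /= in rep.
set S := supnorm theta in hS hSp hkap halg *.
have k_gt0 : (0 < k)%N by apply: leq_trans k2.
have k1 : 1 <= k%:R :> R by rewrite ler1n.
have n1 : 1 <= n%:R :> R by clear - K1 n16; lra.
have kn : 8 * k%:R <= n%:R :> R by clear - kK K1 n16; lra.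
have n0 : 0 < n%:R :> R := lt_le_trans ltr01 n1.
have n_gt0 : (0 < n)%N by rewrite -(ltr_nat R).
have delta0 := dcbm_delta_ge0 rep k_gt0.
have qp : q < p by case: rep => [_ [_ [_ [_ [_ [_ []]]]]]].
have p0 : 0 < p := lt_trans q0 qp.
have cS : c <= S.
  apply: le_trans (hc (Ordinal n_gt0)) _.
  by apply: le_trans (ler_norm _) (le_supnorm _ _).
have S0 : 0 < S := lt_le_trans c0 cS.
have pS : p * S * c <= 1.
  exact: (model_pS rep al1 q0 k2 c01 hc nc kn hS delta0 hd1 hSp).
pose sp := Num.sqrt p; pose s : R := Num.sqrt n%:R.
have sp0 : 0 < sp by rewrite sqrtr_gt0.
have s1 : 1 <= s by rewrite -[leLHS]sqrtr1 ler_wsqrtr.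
have pE : p = sp ^+ 2 by rewrite sqr_sqrtr // ltW.
have nE : n%:R = s ^+ 2 by rewrite sqr_sqrtr // ltW.
pose Dq := p - q; have Dq0 : 0 < Dq by rewrite subr_gt0.
have Dqp : Dq <= sp ^+ 2 by rewrite -pE /Dq lerBlDr lerDl ltW.
have pow : p `^ (3 / 2) = sp ^+ 2 * sp.
  have -> : 3 / 2 = 1 + 2^-1 :> R by field.
  by rewrite powRD ?powRr1 ?powR12_sqrt ?(ltW p0) -?pE // (lt0r_neq0 p0) implybT.
have H : (1 + eps) * S * (sp ^+ 2 * sp) <= kap * (s * Dq ^+ 2).
  move: hkap; rewrite pow ler_pdivrMr //.
  by rewrite mulr_gt0 ?exprn_gt0 // (lt_le_trans ltr01 s1).
have H1 : S * (sp ^+ 2 * sp) <= kap * (s * Dq ^+ 2).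
  apply: le_trans H; rewrite -mulrA ler_peMl ?lerDl //.
  by do ?apply: mulr_ge0; exact: ltW.
have spc : sp * c <= 1.
  have spc0 : 0 <= sp * c by do ?apply: mulr_ge0; exact: ltW.
  rewrite -(@ler_pXn2r _ 2) ?nnegrE // exprMn -pE expr1n; apply: le_trans pS.
  rewrite expr2 mulrA; apply: ler_wpM2r; first exact: ltW.
  by apply: ler_wpM2l => //; exact: ltW.
have Sc := regime_mass c0 kap0 x0 s1 sp0 k1 kK Dq0 Dqp cS spc H1 kap_K.
rewrite -pE -nE in Sc.
have hS2 : S <= x * (Dq / p) * (n%:R / k%:R).
  by apply: le_trans Sc; rewrite ler_pdivlMr // ler_piMr // ltW.
have hN : 1 <= x * (Dq / p) * (n%:R / k%:R).
  by apply: le_trans Sc; rewrite ler_pdivlMr // mul1r.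
have N15 : 15 < n%:R / k%:R :> R.
  by rewrite ltr_pdivlMr ?(lt_le_trans ltr01 k1) //; clear - n16 kK K1; lra.
have hG := regime_mis c0 s1 sp0 k1 kK Dq0 cS al1 C_ge1 eps0 H kap_x.
have wE : Num.sqrt (n%:R * p * S ^+ 2) = s * sp * S.
  rewrite sqrtrM; last by rewrite mulr_ge0 // ltW.
  by rewrite sqrtrM ?(ltW n0) // sqrtr_sqr gtr0_norm.
rewrite -pE -nE -wE in hG.
have hY : sp <= M * Num.sqrt q.
  have M0 : 0 <= M := le_trans ler01 M1.
  rewrite -(@ler_pXn2r _ 2) ?nnegrE ?mulr_ge0 ?sqrtr_ge0 //.
  rewrite exprMn -pE sqr_sqrtr ?(ltW q0) // -ler_pdivrMr //.
  by apply: le_trans pqM _; rewrite expr2 ler_peMr.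
apply: le_trans (@loss_prob_ge R n k theta p q delta alpha c P z B rep Ble al1 q0 k2 c01 hc nc kn
  hS delta0 hd1 hSp C1 eps e x M _ alg1 zhat eps0 hC1 e01 hY erefl (ltW x0) x6 xM xL hG
  hd hN hS2 N15 halg hz).
rewrite lerD2l lerN2.
have t1 : 2 / n%:R <= e / 2.
  rewrite ler_pdivrMr // in ne; rewrite ler_pdivrMr //; clear - ne; lra.
set D2 := (_ - _) ^+ 2.
have D2low : Dq ^+ 2 / (4 * sp ^+ 2) <= D2.
  have DE : Dq = (sp - Num.sqrt q) * (sp + Num.sqrt q).
    by rewrite -subr_sqr -pE sqr_sqrtr // ltW.
  rewrite ler_pdivrMr ?mulr_gt0 ?exprn_gt0 // DE exprMn ler_wpM2l ?sqr_ge0 //.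
  have sqp : Num.sqrt q <= sp by rewrite ler_wsqrtr // ltW.
  have -> : 4 * sp ^+ 2 = (2 * sp) ^+ 2 by ring.
  have sq0 : 0 <= Num.sqrt q := sqrtr_ge0 q.
  by apply: lerXn2r; rewrite ?nnegrE; clear - sq0 sqp; lra.
have yK := regime_exponent c0 c1 kap0 s1 sp0 k1 kK Dq0 Dqp cS H1 e0 kap_e D2low.
rewrite -nE in yK; set y := e / 2 * _ in yK *.
have Ke0 : 0 < 2 * K / e by rewrite divr_gt0 // mulr_gt0 // (lt_le_trans ltr01 K1).
have y0 : 0 < y by apply: lt_le_trans yK.
have t2 : k%:R * expR (- y) <= e / 2.
  apply: (@le_trans _ _ (K * (2 * K / e)^-1)).
    apply: ler_pM => //; rewrite ?expR_ge0 // expRN lef_pV2 ?posrE ?expR_gt0 //.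
    by apply: le_trans yK _; apply: le_trans (expR_ge1Dx _); rewrite lerDr.
  have -> : K * (2 * K / e)^-1 = e / 2.
    by field; rewrite !lt0r_neq0 // (lt_le_trans ltr01 K1).
  by [].
by have := lerD t1 t2; rewrite -splitr.
Qed.

(** Take [eta n = 1 / (J n + 1)] with [J n] the largest [j <= n] whose threshold [N j] is at most
    [n]. The cap [j <= n] makes the maximum exist, and [J n] tends to infinity since every threshold
    is eventually passed. *)
Lemma diagonal_vanishing (R : realType) (Q : R -> nat -> Prop) :
  (forall e : R, 0 < e <= 1 -> \forall n \near \oo, Q e n) ->
  exists eta : nat -> R, [/\ forall n, 0 <= eta n, eta @ \oo --> (0 : R) &
    \forall n \near \oo, Q (eta n) n].
Proof.
move=> hQ.
have hQj (j : nat) : exists N : nat, forall n, (N <= n)%N -> Q j.+1%:R^-1 n.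
  have : 0 < (j.+1%:R^-1 : R) <= 1 by rewrite invr_gt0 ltr0n /= invf_le1 ?ltr0n // ler1n.
  by move=> /hQ [N _ hN]; exists N.
have [N hN] := choice hQj.
pose J (n : nat) : nat := (\max_(j < n.+1 | (N j <= n)%N) j)%N.
have JQ n : (N 0%N <= n)%N -> Q (J n).+1%:R^-1 n.
  move=> n0; apply: hN; rewrite /J.
  have ex : (0 < #|[pred j : 'I_n.+1 | (N j <= n)%N]|)%N by apply/card_gt0P; exists ord0.
  by have [j] := eq_bigmax_cond (fun j : 'I_n.+1 => j : nat) ex; rewrite inE => h ->.
have Jge j n : (maxn j (N j) <= n)%N -> (j <= J n)%N.
  rewrite geq_max -ltnS => /andP[jn Nj].
  exact: (@leq_bigmax_cond _ _ (fun i : 'I_n.+1 => i : nat) (Ordinal jn) Nj).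
exists (fun n => (J n).+1%:R^-1); split; first by [].
  2: by exists (N 0%N).
apply/cvgrPdist_le => e e0.
have [j hj] : exists j : nat, e^-1 <= j%:R.
  by exists (Num.truncn e^-1).+1; apply/ltW/truncnS_gt.
exists (maxn j (N j)) => // n /= hn.
rewrite sub0r normrN ger0_norm ?invr_ge0 // -[leRHS]invrK lef_pV2 ?posrE ?invr_gt0 ?ltr0n //.
by apply: le_trans hj _; rewrite ler_nat; apply: leqW; exact: Jge.
Qed.

Theorem theorem3 (R : realType) (alpha : R) (halpha : 1 <= alpha) :
  exists2 C0 : R, 0 < C0 &
  forall (C1 : R) (k : nat -> nat) (theta : forall n : nat, 'I_n -> R)
    (p q delta eps : nat -> R)
    (alg1 : forall n : nat, 'M[bool]_n.-1 -> 'I_n.-1 -> option 'I_(k n))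
    (zhat : forall n : nat, 'M[bool]_n -> 'I_n -> 'I_(k n)),
  C0 <= C1 ->
  (forall n, (2 <= k n)%N) ->
  (forall n i, 0 <= theta n i) ->
  (forall n, 0 < q n) ->
  (forall n, 0 <= eps n) ->
  (delta =o_\oo (fun=> 1 : R)) ->
  (forall n, 1 < p n / q n) ->
  ((fun n => p n / q n) =O_\oo (fun=> 1 : R)) ->
  ((fun n => supnorm (theta n)) =o_\oo (fun n => n%:R / (k n)%:R : R)) ->
  ((fun n => (k n)%:R : R) =O_\oo (fun=> 1 : R)) ->
  (exists2 c : R, 0 < c & \forall n \near \oo, forall i, c <= theta n i) ->
  (delta =o_\oo (fun n => (p n - q n) / p n)) ->
  (\forall n \near \oo, n%:R^-1 <= supnorm (theta n) ^+ 2 * p n) ->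
  ((fun n => (1 + eps n) * supnorm (theta n) * p n `^ (3 / 2)
             / (Num.sqrt n%:R * (p n - q n) ^+ 2)) =o_\oo (fun=> 1 : R)) ->
  (forall n (A : 'M[bool]_n.-1), is_adjacency A ->
     algorithm1_output (C1 * (n%:R * p n * supnorm (theta n) ^+ 2 + 1)) (eps n)
       A (alg1 n A)) ->
  (forall n (A : 'M[bool]_n), is_adjacency A ->
     algorithm3_output R (alg1 n) A (zhat n A)) ->
  exists2 eta : nat -> R, eta =o_\oo (fun=> 1 : R) &
    prob_inf [set graph_prob Pz.1 (fun A : 'M[bool]_n =>
                loss R (zhat n A) Pz.2
                  <= expR (- ((1 - eta n) * rateI (theta n) (p n) (q n) (k n) 1)))
             | Pz in param_space (theta n) (p n) (q n) (k n) 1 (delta n) alpha]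
      @[n --> \oo] --> (1 : R).
Proof.
(* The threshold of [heavy_card_le], which depends on [alpha] alone. *)
exists (8 * alpha + 9); first by lra.
move=> C1 k theta p q delta eps alg1 zhat hC1 k2 _ q0 eps0 delta_o1 pq1 pqO So kO [c cpos hc]
  delta_o Sp kappa_o halg hz.
have p0 n : 0 < p n by have := pq1 n; rewrite ltr_pdivlMr // mul1r; apply: lt_trans.
have qp n : q n < p n by have := pq1 n; rewrite ltr_pdivlMr // mul1r.
have [K [K1 hK]] : exists K : R, 1 <= K /\ \forall n \near \oo, (k n)%:R <= K.
  have [K0 [_ h]] := (eqOP _ _ _).1 kO.
  exists (Num.max 1 (K0 + 1)); split; first by rewrite le_max lexx.
  have /h : K0 < Num.max 1 (K0 + 1) by rewrite lt_max ltrDl ltr01 orbT.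
  apply: filterS => n; rewrite normr1 mulr1; exact: le_trans (ler_norm _).
have [M [M1 hM]] : exists M : R, 1 <= M /\ \forall n \near \oo, p n / q n <= M.
  have [K0 [_ h]] := (eqOP _ _ _).1 pqO.
  exists (Num.max 1 (K0 + 1)); split; first by rewrite le_max lexx.
  have /h : K0 < Num.max 1 (K0 + 1) by rewrite lt_max ltrDl ltr01 orbT.
  apply: filterS => n; rewrite normr1 mulr1; exact: le_trans (ler_norm _).
pose c' := Num.min c 1.
have c01 : 0 < c' <= 1 by rewrite lt_min cpos ltr01 ge_min lexx orbT.
have eventually_Q (e : R) : 0 < e <= 1 -> \forall n \near \oo,
    forall Pz, param_space (theta n) (p n) (q n) (k n) 1 (delta n) alpha Pz ->
    1 - e <= graph_prob Pz.1 (fun A : 'M[bool]_n =>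
      loss R (zhat n A) Pz.2
        <= expR (- ((1 - e) * rateI (theta n) (p n) (q n) (k n) 1))).
  move=> e01; have /andP[e0 e1] := e01.
  have [kap [x [kap0 [x0 main]]]] := loss_prob_uniform halpha c01 K1 M1 e01 hC1.
  have h1 := (eqoP _ _ _).1 delta_o1 (1 / 8) (ltac:(lra)).
  have h2 := (eqoP _ _ _).1 So (1 / 8) (ltac:(lra)).
  have h3 := (eqoP _ _ _).1 delta_o x x0.
  have h4 := (eqoP _ _ _).1 kappa_o kap kap0.
  near=> n.
  have n0 : 0 <= n%:R / (k n)%:R :> R by rewrite divr_ge0.
  have d1 : `|delta n| <= 1 / 8 * `|1 : R| by near: n; exact: h1.
  have S1 : `|supnorm (theta n)| <= 1 / 8 * `|n%:R / (k n)%:R : R| by near: n; exact: h2.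
  have d2 : `|delta n| <= x * `|(p n - q n) / p n| by near: n; exact: h3.
  have k1 : `|(1 + eps n) * supnorm (theta n) * p n `^ (3 / 2)
             / (Num.sqrt n%:R * (p n - q n) ^+ 2)| <= kap * `|1 : R| by near: n; exact: h4.
  rewrite normr1 mulr1 in d1; rewrite normr1 [kap * 1]mulr1 in k1.
  rewrite [X in _ <= _ * X]ger0_norm // in S1.
  rewrite [X in _ <= _ * X]ger0_norm in d2; last by apply: divr_ge0; rewrite ?subr_ge0; exact: ltW.
  case=> P z hPz.
  apply: (main n (k n) (theta n) (p n) (q n) (delta n) (eps n) (alg1 n)) => //.
  - by near: n.
  - move=> i; rewrite /c' ge_min; apply/orP; left; move: i; near: n; exact: hc.
  - by near: n.
  - apply: (le_trans (ler_norm _)); apply: (le_trans S1).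
    by rewrite le_eqVlt; apply/orP; left; apply/eqP; field; rewrite pnatr_eq0 -lt0n (leq_trans _ (k2 n)).
  - exact: le_trans (ler_norm _) d1.
  - exact: le_trans (ler_norm _) d2.
  - by near: n.
  - exact: le_trans (ler_norm _) k1.
  - by near: n; apply: nbhs_infty_ger.
  - by near: n; apply: nbhs_infty_ger.
  - by near: n; apply: nbhs_infty_ger.
  - by move=> A; exact: halg.
  - by move=> A; exact: hz.
have [eta [eta_ge0 eta0 hQ]] := diagonal_vanishing eventually_Q.
exists eta.
  apply/eqoP => e e0; move/cvgrPdist_le : eta0 => /(_ e e0).
  by apply: filterS => n; rewrite sub0r normrN normr1 mulr1.
(* The adjoined element 1 makes the set nonempty and bounds the infimum from above, so the squeeze
   covers an empty parameter space too. *)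
apply: (@squeeze_cvgr _ _ _ _ (fun n => 1 - eta n) (fun=> 1)); last exact: cvg_cst.
  move: hQ; apply: filterS => n hn; set T := [set _ | _ in _].
  have lb : lbound (1 |` T) (1 - eta n).
    by move=> _ [->|[Pz hPz <-]]; [rewrite lerBlDr lerDl|exact: hn].
  apply/andP; split; first by apply: lb_le_inf => //; exists 1; left.
  by apply: ge_inf; [exists (1 - eta n)|left].
by rewrite -[X in _ --> X]subr0; apply: cvgB => //; exact: cvg_cst.
Unshelve. all: by end_near.
Qed.
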